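(* Let $S=S_W\in Sp(n)$ be a free symplectic matrix, generated by the quadratic form $W(x,x')=\tfrac12\langle Px,x\rangle-\langle Lx,x'\rangle+\tfrac12\langle Qx',x'\rangle$, with $\det(S-I)\neq0$; let $m$ be an integer with $m\pi\equiv\arg\det L\bmod 2\pi$, and let $W_{xx}=P+Q-L-L^T$. Then $\widehat{R}_{\nu}(S)=\widehat{S}_{W,m}$ provided that the integer $\nu$ is chosen so that $$\nu\equiv m-\mathrm{Inert}\,W_{xx}\pmod 4,$$ in which case we have $$\frac1\pi\arg\det(S-I)\equiv-\nu+n\pmod 2.$$
   Context: Write $z=(x,p)\in\mathbb{R}^{n}\times\mathbb{R}^{n}=\mathbb{R}^{2n}$. The standard symplectic form is $\sigma(z,z')=\langle p,x'\rangle-\langle p',x\rangle=\langle Jz,z'\rangle$ with $J=\begin{bmatrix}0&I\\ -I&0\end{bmatrix}$, and $Sp(n)$ is the group of real linear automorphisms of $\mathbb{R}^{2n}$ preserving $\sigma$. For $z_0=(x_0,p_0)$ the Weyl–Heisenberg operator is $\widehat{T}(z_0)f(x)=e^{i(\langle p_0,x\rangle-\frac12\langle p_0,x_0\rangle)}f(x-x_0)$, $f$ a function on $\mathbb{R}^n$. For $S\in Sp(n)$ with $\det(S-I)\ne0$ put $M_S=\tfrac12 J(S+I)(S-I)^{-1}$ (a real symmetric matrix) and, for $\nu\in\mathbb{Z}$, define the Mehlig–Wilkinson operator $$\widehat{R}_{\nu}(S)=\left(\frac{1}{2\pi}\right)^{n}\frac{i^{\nu}}{\sqrt{|\det(S-I)|}}\int_{\mathbb{R}^{2n}}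 e^{\frac{i}{2}\langle M_{S}z,z\rangle}\,\widehat{T}(z)\,d^{2n}z,$$ the integral being understood weakly (integrate matrix coefficients $(\widehat T(z)f,g)_{L^2}$ for Schwartz functions $f,g$ on $\mathbb{R}^n$). In $W$, $P,Q$ are real symmetric $n\times n$ matrices and $L$ is a real $n\times n$ matrix with $\det L\neq0$. The free symplectic matrix generated by $W$ is $$S_W=\begin{bmatrix}L^{-1}Q & L^{-1}\\ P L^{-1}Q-L^T & P L^{-1}\end{bmatrix};$$ a symplectic matrix $\begin{bmatrix}A&B\\ C&D\end{bmatrix}$ is free if $\det B\neq0$, and then it equals $S_W$ with $P=DB^{-1}$, $L=B^{-1}$, $Q=B^{-1}A$. For $m$ as in the claim (two choices modulo $4$), the quadratic Fourier transform is $$\widehat{S}_{W,m}f(x)=\left(\tfrac{1}{2\pi i}\right)^{n/2}i^{m}\sqrt{|\det L|}\int_{\mathbb{R}^n} e^{iW(x,x')}f(x')\,d^nx',\qquad i^{-n/2}:=e^{-i\pi n/4},$$ for $f\in\mathcal{S}(\mathbb{R}^n)$, extended to a unitary operator on $L^2(\mathbb{R}^n)$. $W_{xx}$ is the Hessian matrix of $x\mapsto W(x,x)$. $\mathrm{Inert}\,R$ denotes the number of negative eigenvalues of a real symmetric matrix $R$. For a nonzero real number $a$, $\arg a\in\{0,\pi\}$ modulo $2\pi$. *)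

(* Defs.v *)
From HB Require Import structures.
From mathcomp Require Import all_boot all_order all_algebra.
From mathcomp Require Import all_classical all_reals all_analysis.
From mathcomp Require Import polyrcf complex.

Set Implicit Arguments.
Unset Strict Implicit.
Unset Printing Implicit Defensive.

Import Order.TTheory GRing.Theory Num.Theory.
Import numFieldTopology.Exports numFieldNormedType.Exports.

Local Open Scope classical_set_scope.
Local Open Scope ring_scope.

Section LebesgueRn.
Variable R : realType.
Local Notation RR := (measurableTypeR R).

Definition tcons n (z : RR * n.-tuple RR) : n.+1.-tuple RR :=
  [the n.+1.-tuple RR of z.1 :: z.2].

Definition tuncons n (t : n.+1.-tuple RR) : RR * n.-tuple RR :=
  (thead t, [tuple of behead t]).

Lemma measurable_tcons n : measurable_fun [set: RR * n.-tuple RR] (@tcons n).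
Proof. exact: measurable_cons. Qed.

Lemma measurable_tuncons n : measurable_fun [set: n.+1.-tuple RR] (@tuncons n).
Proof.
apply/measurable_fun_pairP; split; last exact: measurable_behead.
exact: (measurable_tnth ord0).
Qed.

Lemma tconsK n : cancel (@tcons n) (@tuncons n).
Proof. by case=> x t; congr pair; apply/val_inj. Qed.

Section step.
Variables (n : nat) (mu : {sigma_finite_measure set (n.-tuple RR) -> \bar R}).

Definition leb_succ : set (n.+1.-tuple RR) -> \bar R :=
  pushforward (@lebesgue_measure R \x mu)%E (@tcons n).

Let leb_succ0 : leb_succ set0 = 0%E.
Proof. by rewrite /leb_succ /pushforward preimage_set0 measure0. Qed.

Let leb_succ_ge0 A : (0 <= leb_succ A)%E.
Proof. by rewrite /leb_succ /pushforward; exact: measure_ge0. Qed.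

Let leb_succ_sigma_additive : semi_sigma_additive leb_succ.
Proof.
move=> F mF tF mUF; rewrite /leb_succ /pushforward preimage_bigcup.
apply: measure_semi_sigma_additive.
- by move=> k; rewrite -[X in measurable X]setTI; exact: measurable_tcons.
- apply/trivIsetP => i j _ _ ij; rewrite -preimage_setI.
  by move/trivIsetP : tF => /(_ _ _ _ _ ij) ->//; rewrite preimage_set0.
- by rewrite -preimage_bigcup -[X in measurable X]setTI; exact: measurable_tcons.
Qed.

HB.instance Definition _ := isMeasure.Build _ _ _ leb_succ
  leb_succ0 leb_succ_ge0 leb_succ_sigma_additive.

Let leb_succ_sigma_finite : sigma_finite setT leb_succ.
Proof.
have /sigma_finiteP[F [TF ndF Foo]] := sigma_finiteT (@lebesgue_measure R).
have /sigma_finiteP[G [TG ndG Goo]] := sigma_finiteT mu.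
exists (fun k => @tuncons n @^-1` (F k `*` G k)).
  rewrite -preimage_bigcup (_ : \bigcup_k _ = setT) ?preimage_setT//.
  rewrite -subTset -setXTT TF TG => -[x y] [/= [i _ Fix] [k _ Gky]].
  exists (maxn i k) => //; split.
  - by move: x Fix; exact/subsetPset/ndF/leq_maxl.
  - by move: y Gky; exact/subsetPset/ndG/leq_maxr.
move=> k; have [mF Fk] := Foo k; have [mG Gk] := Goo k; split.
  by rewrite -[X in measurable X]setTI; apply: measurable_tuncons => //;
     exact: measurableX.
rewrite /leb_succ /pushforward -comp_preimage.
rewrite (_ : _ \o _ = id) ?preimage_id; last by apply/funext => z; exact: tconsK.
by rewrite product_measure1E// lte_mul_pinfty// ge0_fin_numE.
Qed.

HB.instance Definition _ :=
  Measure_isSigmaFinite.Build _ _ _ leb_succ leb_succ_sigma_finite.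
End step.


(* Lebesgue measure on R^n: the n-fold product of Lebesgue measure on R, carried
   from pairs to tuples; on R^0 it is the unit mass of the only point. *)
Fixpoint leb n : {sigma_finite_measure set (n.-tuple RR) -> \bar R} :=
  if n isn't n'.+1 then @dirac _ (0.-tuple RR) [tuple] R else leb_succ (leb n').

End LebesgueRn.

Section Analysis.
Variable R : realType.
Local Notation RR := (measurableTypeR R).
Local Notation C := R[i].

Definition vec n (t : n.-tuple RR) : 'cV[R]_n := \col_i tnth t i.

Definition cintegral d (T : measurableType d) (mu : {measure set T -> \bar R})
    (F : T -> C) : C :=
  Complex (\int[mu]_t complex.Re (F t)) (\int[mu]_t complex.Im (F t)).

Definition integral_Rn n (F : 'cV[R]_n -> C) : C :=
  cintegral (leb R n) (fun t => F (vec t)).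

(* z = (x, p) is the column x over p. *)
Definition integral_R2n n (F : 'cV[R]_(n + n) -> C) : C :=
  cintegral (leb R n \x leb R n)%E (fun t => F (col_mx (vec t.1) (vec t.2))).

Definition aeq n (f g : 'cV[R]_n -> C) : Prop :=
  {ae leb R n, forall t, f (vec t) = g (vec t)}.

Definition inner n (f g : 'cV[R]_n -> C) : C :=
  integral_Rn (fun x => f x * conjc (g x)).

Definition L2 n (f : 'cV[R]_n -> C) : Prop :=
  [/\ measurable_fun setT (fun t : n.-tuple RR => complex.Re (f (vec t))),
      measurable_fun setT (fun t : n.-tuple RR => complex.Im (f (vec t))) &
      (\int[leb R n]_t ((complex.Re (f (vec t))) ^+ 2 +
                        (complex.Im (f (vec t))) ^+ 2)%:E < +oo)%E].

(* Operators act on representatives, so linearity and surjectivity hold up to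
   null sets; linear + isometric makes U compatible with aeq. *)
Definition unitary_operator n (U : ('cV[R]_n -> C) -> ('cV[R]_n -> C)) : Prop :=
  [/\ forall f, L2 f -> L2 (U f),
      forall (a : C) f g, L2 f -> L2 g ->
        aeq (U (fun x => a * f x + g x)) (fun x => a * U f x + U g x),
      forall f g, L2 f -> L2 g -> inner (U f) (U g) = inner f g &
      forall h, L2 h -> exists2 f, L2 f & aeq (U f) h].

(* iter_partial [:: i1; ..; ik] u = d_(i1) ... d_(ik) u. *)
Definition iter_partial n (s : seq 'I_n) (u : 'cV[R]_n -> R) : 'cV[R]_n -> R :=
  foldr (fun i v => 'D_(delta_mx i 0 : 'cV[R]_n) v) u s.

(* Differentiability of all iterated partial derivatives makes u smooth. *)
Definition real_schwartz n (u : 'cV[R]_n -> R) : Prop :=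
  forall s : seq 'I_n,
    (forall x, differentiable (iter_partial s u) x) /\
    (forall a : 'I_n -> nat, exists K : R, forall x : 'cV[R]_n,
       `|(\prod_(i < n) x i 0 ^+ a i) * iter_partial s u x| <= K).

Definition schwartz n (f : 'cV[R]_n -> C) : Prop :=
  real_schwartz (fun x => complex.Re (f x)) /\
  real_schwartz (fun x => complex.Im (f x)).

End Analysis.

Section Symplectic.
Variable R : realType.
Local Notation C := R[i].

Definition dot n (u v : 'cV[R]_n) : R := \sum_i u i 0 * v i 0.

Definition sigma n (z z' : 'cV[R]_(n + n)) : R :=
  dot (dsubmx z) (usubmx z') - dot (dsubmx z') (usubmx z).

Definition Jmx n : 'M[R]_(n + n) := block_mx 0 1%:M (- 1%:M) 0.

Definition Sp n (S : 'M[R]_(n + n)) : Prop :=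
  S \in unitmx /\ forall z z', sigma (S *m z) (S *m z') = sigma z z'.

Definition free_symplectic n (P L Q : 'M[R]_n) : 'M[R]_(n + n) :=
  block_mx (invmx L *m Q) (invmx L)
           (P *m invmx L *m Q - L^T) (P *m invmx L).

Definition Wform n (P L Q : 'M[R]_n) (x x' : 'cV[R]_n) : R :=
  2^-1 * dot (P *m x) x - dot (L *m x) x' + 2^-1 * dot (Q *m x') x'.

Definition Wxx n (P L Q : 'M[R]_n) : 'M[R]_n := P + Q - L - L^T.

(* Negative eigenvalues are counted with multiplicity. *)
Definition Inert n (A : 'M[R]_n) : nat :=
  \sum_(a <- rootsR (char_poly A) | a < 0) mup a (char_poly A).

Definition real_arg (a : R) : R := if 0 < a then 0 else pi.

(* a = b modulo c *)
Definition eqmodR (c a b : R) : Prop := exists k : int, a = b + k%:~R * c.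

Definition expi (t : R) : C := Complex (cos t) (sin t).

Definition imag : C := Complex 0 1.

Definition weyl_heisenberg n (z0 : 'cV[R]_(n + n)) (f : 'cV[R]_n -> C)
    : 'cV[R]_n -> C :=
  let x0 := usubmx z0 in let p0 := dsubmx z0 in
  fun x => expi (dot p0 x - 2^-1 * dot p0 x0) * f (x - x0).

Definition M_ n (S : 'M[R]_(n + n)) : 'M[R]_(n + n) :=
  2^-1 *: (Jmx n *m (S + 1%:M) *m invmx (S - 1%:M)).

(* The matrix coefficient (R_nu(S) f, g): the operator-valued integral is weak. *)
Definition mehlig_wilkinson n (nu : int) (S : 'M[R]_(n + n))
    (f g : 'cV[R]_n -> C) : C :=
  real_complex R ((2 * pi)^-1 ^+ n) * (imag ^ nu)
  / real_complex R (Num.sqrt `|\det (S - 1%:M)|)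
  * integral_R2n (fun z =>
      expi (2^-1 * dot (M_ S *m z) z) * inner (weyl_heisenberg z f) g).

(* A equals R_nu(S), an operator known only through its matrix coefficients on
   Schwartz functions. *)
Definition is_mehlig_wilkinson n (nu : int) (S : 'M[R]_(n + n))
    (A : ('cV[R]_n -> C) -> ('cV[R]_n -> C)) : Prop :=
  forall f g, schwartz f -> schwartz g ->
    inner (A f) g = mehlig_wilkinson nu S f g.

(* (1 / (2 pi i))^(n/2) is (2 pi)^(- n/2) e^(- i pi n / 4). *)
Definition quadratic_fourier n (P L Q : 'M[R]_n) (m : int) (f : 'cV[R]_n -> C)
    : 'cV[R]_n -> C :=
  fun x =>
    real_complex R ((2 * pi) `^ (- (n%:R / 2))) * expi (- (pi * n%:R / 4))
    * (imag ^ m) * real_complex R (Num.sqrt `|\det L|)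
    * integral_Rn (fun x' => expi (Wform P L Q x x') * f x').

(* U is the unitary extension of the integral operator to L^2(R^n). *)
Definition is_quadratic_fourier n (P L Q : 'M[R]_n) (m : int)
    (U : ('cV[R]_n -> C) -> ('cV[R]_n -> C)) : Prop :=
  unitary_operator U /\
  forall f, schwartz f -> aeq (U f) (quadratic_fourier P L Q m f).

End Symplectic.

(* Main.v *)
Require Import Defs.
From mathcomp Require Import all_boot all_order all_algebra.
From mathcomp Require Import all_classical all_reals all_analysis.
From mathcomp Require Import measurable_realfun polyrcf complex.
From mathcomp Require Import zify ring lra.

(** Let K = W_xx, D = (P - Q - L + L^T)/2 and B = P + Q + L + L^T.  Then
    det (S - I) = (-1)^n det L^-1 det K, which gives the statement on the
    argument, and with q = p0 - D x0
      <M_S (x0,p0), (x0,p0)>/2 = <B x0, x0>/8 - <K^-1 q, q>/2.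
    The coefficient (T(x0,p0) f, g) decays in x0 and p0, so the
    Mehlig-Wilkinson integral is the limit of the same integral with the extra
    factor exp(- e |q|^2 / 2).  There Fubini applies and the integral over p0
    is a complex Gaussian integral; as e tends to 0 it becomes a constant times
    exp(i <K y, y>/2) with y = x - x0/2, where the constant carries the phase
    exp(i pi (n - 2 Inert (- K^-1))/4), that is exp(- i pi n/4) i^(Inert K).
    Finally <B x0, x0>/8 + <D x0, y> + <K y, y>/2 = W(x, x - x0), and
    substituting x' = x - x0 gives the kernel of the quadratic Fourier
    transform. *)

Set Implicit Arguments.
Unset Strict Implicit.
Unset Printing Implicit Defensive.

Import Order.TTheory GRing.Theory Num.Theory.
Import numFieldTopology.Exports numFieldNormedType.Exports.

Local Open Scope classical_set_scope.
Local Open Scope ring_scope.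

(** The phase exp(i <M_S z, z>/2) has modulus 1, so the integrals over x and p0 cannot be exchanged
    by absolute convergence before damping. Hence the factor depending on e, and hence bounds
    uniform in e for the limit afterwards. The majorants are built from one integrable product,
    prod_i (1 + x_i^2)^-1. The only substitutions established for Lebesgue measure on R^n are
    translations and reflection, so the damped Gaussian integral, whose matrix is not diagonal, is
    not diagonalized by a change of variables. Instead its phase is deformed to s <M p, p>/2 + t <y,
    p>; integration by parts makes the integral solve linear differential equations in t and in s,
    with a known value at s = t = 0. Diagonalization then enters only through algebra. This also
    settles the branch of det (e - i s M)^(-1/2): it is the one continuous in s from s = 0. Each
    eigenvalue contributes half an arctangent, which tends to pi/4 times its sign as e tends to 0;
    the sum of these is the phase with the inertia. Integration by parts is also what gives the
    decay of the coefficient in p0. *)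

(** * Real and imaginary parts, modulus and exponential of complex numbers *)

Section ComplexNumbers.
Variable R : realType.
Local Notation C := R[i].
Local Notation Re := (@complex.Re R).
Local Notation Im := (@complex.Im R).
Local Notation normc := (@Normc.normc R).
Local Notation "x %:C" := (real_complex R x).

Lemma eq_ReIm (z w : C) : Re z = Re w -> Im z = Im w -> z = w.
Proof. by case: z w => [a b] [c d] /= -> ->. Qed.

Lemma Re_D (z w : C) : Re (z + w) = Re z + Re w.
Proof. by case: z w => [a b] [c d]. Qed.

Lemma Im_D (z w : C) : Im (z + w) = Im z + Im w.
Proof. by case: z w => [a b] [c d]. Qed.

Lemma Re_N (z : C) : Re (- z) = - Re z.
Proof. by case: z. Qed.

Lemma Im_N (z : C) : Im (- z) = - Im z.
Proof. by case: z. Qed.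

Lemma Re_M (z w : C) : Re (z * w) = Re z * Re w - Im z * Im w.
Proof. by case: z w => [a b] [c d]. Qed.

Lemma Im_M (z w : C) : Im (z * w) = Re z * Im w + Im z * Re w.
Proof. by case: z w => [a b] [c d]. Qed.

Lemma Re_conjc (z : C) : Re (conjc z) = Re z.
Proof. by case: z. Qed.

Lemma Im_conjc (z : C) : Im (conjc z) = - Im z.
Proof. by case: z. Qed.

Lemma Re_sum (I : Type) (r : seq I) (P : pred I) (F : I -> C) :
  Re (\sum_(i <- r | P i) F i) = \sum_(i <- r | P i) Re (F i).
Proof. by apply: (big_morph Re Re_D). Qed.

Lemma Im_sum (I : Type) (r : seq I) (P : pred I) (F : I -> C) :
  Im (\sum_(i <- r | P i) F i) = \sum_(i <- r | P i) Im (F i).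
Proof. by apply: (big_morph Im Im_D). Qed.

Definition ReIm := (Re_D, Im_D, Re_N, Im_N, Re_M, Im_M, Re_conjc, Im_conjc).

Lemma normc_sqrtE (z : C) : normc z = Num.sqrt (Re z ^+ 2 + Im z ^+ 2).
Proof. by case: z. Qed.

Lemma normc_ge0 (z : C) : 0 <= normc z.
Proof. by rewrite normc_sqrtE sqrtr_ge0. Qed.

Lemma normc_Re (z : C) : `|Re z| <= normc z.
Proof. by rewrite normc_sqrtE -sqrtr_sqr ler_wsqrtr// lerDl sqr_ge0. Qed.

Lemma normc_Im (z : C) : `|Im z| <= normc z.
Proof. by rewrite normc_sqrtE -sqrtr_sqr ler_wsqrtr// lerDr sqr_ge0. Qed.

Lemma normc_le (z : C) : normc z <= `|Re z| + `|Im z|.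
Proof.
rewrite normc_sqrtE -[leRHS]ger0_norm ?addr_ge0// -sqrtr_sqr ler_wsqrtr//.
by rewrite sqrrD !real_normK ?num_real// lerD2r lerDl mulrn_wge0 ?mulr_ge0.
Qed.

Lemma normcD (z w : C) : normc (z + w) <= normc z + normc w.
Proof.
have := ler_normD z w; rewrite !normc_def /=.
by rewrite -!normc_sqrtE -raddfD lecR.
Qed.

Lemma normc_conj (z : C) : normc (conjc z) = normc z.
Proof. by rewrite !normc_sqrtE !ReIm sqrrN. Qed.

Lemma normc_real (a : R) : normc a%:C = `|a|.
Proof. by rewrite normc_sqrtE /= expr0n addr0 sqrtr_sqr. Qed.

Lemma normc_expi (a : R) : normc (expi a) = 1.
Proof. by rewrite normc_sqrtE /= cos2Dsin2 sqrtr1. Qed.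

Lemma expiD (a b : R) : expi (a + b) = expi a * expi b.
Proof. by apply: eq_ReIm; rewrite !ReIm /= ?cosD ?sinD//; ring. Qed.

Lemma expi0 : expi (0 : R) = 1.
Proof. by rewrite /expi cos0 sin0. Qed.

Lemma expi_sum (I : finType) (F : I -> R) :
  expi (\sum_i F i) = \prod_i expi (F i).
Proof. by apply: (big_morph _ expiD expi0). Qed.

Definition cexp (z : C) : C := (expR (Re z))%:C * expi (Im z).

Lemma cexpD (z w : C) : cexp (z + w) = cexp z * cexp w.
Proof. by rewrite /cexp !ReIm expRD expiD rmorphM/=; ring. Qed.

Lemma cexp0 : cexp 0 = 1.
Proof. by rewrite /cexp /= expR0 expi0 mulr1. Qed.

Lemma normc_cexp (z : C) : normc (cexp z) = expR (Re z).
Proof.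
by rewrite /cexp Normc.normcM normc_real normc_expi mulr1 ger0_norm ?expR_ge0.
Qed.

Lemma cexpN (z : C) : cexp z * cexp (- z) = 1.
Proof. by rewrite -cexpD subrr cexp0. Qed.

End ComplexNumbers.

(** * Measurability of vector-valued and complex-valued maps *)

Section Measurability.
Variable R : realType.
Local Notation C := R[i].
Local Notation RR := (measurableTypeR R).
Local Notation Re := (@complex.Re R).
Local Notation Im := (@complex.Im R).

Definition unvec n (x : 'cV[R]_n) : n.-tuple RR := [tuple x i 0 | i < n].

Lemma unvecK n : cancel (@unvec n) (@vec R n).
Proof. by move=> x; apply/matrixP => i j; rewrite mxE tnth_mktuple ord1. Qed.

(** Measurability is stated coordinate by coordinate because the sigma-algebra in use lives on
    tuples, not on column vectors. *)
Definition mvec d (T : measurableType d) n (h : T -> 'cV[R]_n) :=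
  forall i, measurable_fun [set: T] (fun t => h t i 0).

Definition cmeas d (T : measurableType d) (F : T -> C) :=
  measurable_fun [set: T] (fun t => Re (F t)) /\
  measurable_fun [set: T] (fun t => Im (F t)).

Lemma mvec_vec n : mvec (@vec R n).
Proof.
move=> i; rewrite (_ : (fun _ => _) = (@tnth n RR)^~ i); last first.
  by apply/funext => t; rewrite mxE.
exact: measurable_tnth.
Qed.

Section closure.
Context d (T : measurableType d).

Lemma measurable_unvec n (h : T -> 'cV[R]_n) :
  mvec h -> measurable_fun [set: T] (fun t => unvec (h t)).
Proof.
move=> mh; apply/measurable_fun_tnthP => i.
have -> : tnth (T := RR) ^~ i \o (fun t => unvec (h t)) = (fun t => h t i 0).
  by apply/funext => t; rewrite /= tnth_mktuple.
exact: mh.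
Qed.

Lemma mvec_comp d' (T' : measurableType d') n (h : T -> 'cV[R]_n) (k : T' -> T) :
  mvec h -> measurable_fun setT k -> mvec (h \o k).
Proof. by move=> mh mk i; exact: (measurableT_comp (mh i) mk). Qed.

Lemma mvecD n (h k : T -> 'cV[R]_n) : mvec h -> mvec k -> mvec (fun t => h t + k t).
Proof.
move=> mh mk i; rewrite (_ : (fun _ => _) = (fun t => h t i 0 + k t i 0)).
  exact: measurable_funD.
by apply/funext => t; rewrite mxE.
Qed.

Lemma mvecZ n (a : R) (h : T -> 'cV[R]_n) : mvec h -> mvec (fun t => a *: h t).
Proof.
move=> mh i; rewrite (_ : (fun _ => _) = (fun t => a * h t i 0)).
  exact: measurable_funM.
by apply/funext => t; rewrite mxE.
Qed.

Lemma mvecN n (h : T -> 'cV[R]_n) : mvec h -> mvec (fun t => - h t).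
Proof.
move=> mh; rewrite (_ : (fun _ => _) = (fun t => -1 *: h t)); first exact: mvecZ.
by apply/funext => t; rewrite scaleN1r.
Qed.

Lemma mvecM m n (A : 'M[R]_(m, n)) (h : T -> 'cV[R]_n) :
  mvec h -> mvec (fun t => A *m h t).
Proof.
move=> mh i; rewrite (_ : (fun _ => _) = (fun t => \sum_j A i j * h t j 0)).
  by apply: measurable_sum => j; exact: measurable_funM.
by apply/funext => t; rewrite mxE.
Qed.

Lemma mvec_cst n (x : 'cV[R]_n) : mvec (fun _ : T => x).
Proof. by move=> i; exact: measurable_cst. Qed.

Lemma measurable_dot n (h k : T -> 'cV[R]_n) :
  mvec h -> mvec k -> measurable_fun setT (fun t => dot (h t) (k t)).
Proof.
by move=> mh mk; apply: measurable_sum => j; exact: measurable_funM.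
Qed.

(* The sigma-algebra on tuples is the product one: [h] is approximated by
   functions with values in the grid of step 1/(k+1). *)
Lemma measurable_continuous_comp n (u : 'cV[R]_n -> R) (h : T -> 'cV[R]_n) :
  continuous u -> mvec h -> measurable_fun setT (fun t => u (h t)).
Proof.
move=> cu mh.
pose N (k : nat) t : 'cV[int]_n := \col_i Num.floor (h t i 0 * k.+1%:R).
pose q (k : nat) (z : 'cV[int]_n) : 'cV[R]_n := \col_i ((z i 0)%:~R / k.+1%:R).
apply: (@measurable_fun_cvg _ _ _ _ (fun (k : nat) t => u (q k (N k t)))) => [k|t _].
- have mN z : measurable [set t | N k t = z].
    rewrite (_ : [set _ | _] =
      \bigcap_(i in [set: 'I_n]) ([set: T] `&` (fun t => h t i 0 * k.+1%:R)
         @^-1` `[(z i 0)%:~R, (z i 0 + 1)%:~R[%classic)).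
      apply: fin_bigcap_measurable => // i _.
      by apply: measurable_funM => //; exact: measurable_itv.
    apply/seteqP; split => [t /= Nt i _|t H].
      by split => //=; rewrite in_itv/= -Nt mxE floor_le floorD1_gt.
    apply/matrixP => i j; rewrite ord1 !mxE.
    by have [_ /=] := H i Logic.I; rewrite in_itv/= => ?; exact/floor_def.
  (* The grid has countably many points, so the preimage of [B] is a countable union of the
     measurable cells of [mN], whatever [u] does on the grid. *)
  move=> _ B mB; rewrite setTI.
  rewrite (_ : _ @^-1` B =
     \bigcup_z [set t | N k t = z /\ B (u (q k z))]).
    apply: countable_bigcupT_measurable; first exact: countableP.
    move=> z; have [Bz|nBz] := pselect (B (u (q k z))).
      by rewrite (_ : mkset _ = [set t | N k t = z])//; apply/seteqP; split => // t [].
    by rewrite (_ : mkset _ = set0)//; apply/seteqP; split => // t [].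
  apply/seteqP; split => [t /= Bt|t [z _ [/= <-]]//].
  by exists (N k t).
- suff qh : (fun k => q k (N k t)) @ \oo --> h t.
    exact: (cvg_comp _ _ qh (cu (h t))).
  apply/cvgrPdist_le => e e0.
  near=> k; rewrite [leLHS]mx_normrE; apply/bigmax_leP; split; first exact: ltW.
  move=> [i j] _ /=; rewrite !mxE ord1.
  have k0 : 0 < k.+1%:R :> R by [].
  have -> (a b : R) : a - b / k.+1%:R = (a * k.+1%:R - b) / k.+1%:R.
    by rewrite mulrBl mulfK// gt_eqF.
  rewrite normrM [X in _ * X]ger0_norm ?invr_ge0 ?ltW//.
  rewrite ltr_pdivrMr// ger0_norm ?subr_ge0 ?floor_le//.
  rewrite (@lt_le_trans _ _ 1)//.
    by rewrite ltrBlDl -intrD1 floorD1_gt.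
  rewrite mulrC -ler_pdivrMr// div1r; near: k.
  exists (Num.truncn e^-1) => // k /= ke.
  by rewrite (le_trans (ltW (truncnS_gt _)))// ler_nat ltnS.
Unshelve. all: by end_near. Qed.

Lemma cmeasM (F G : T -> C) : cmeas F -> cmeas G -> cmeas (fun t => F t * G t).
Proof.
move=> [? ?] [? ?]; split.
  under eq_fun do rewrite Re_M.
  by apply: measurable_funB; exact: measurable_funM.
under eq_fun do rewrite Im_M.
by apply: measurable_funD; exact: measurable_funM.
Qed.

Lemma cmeasD (F G : T -> C) : cmeas F -> cmeas G -> cmeas (fun t => F t + G t).
Proof.
move=> [? ?] [? ?]; split.
  by under eq_fun do rewrite Re_D; exact: measurable_funD.
by under eq_fun do rewrite Im_D; exact: measurable_funD.
Qed.

Lemma cmeas_conj (F : T -> C) : cmeas F -> cmeas (fun t => conjc (F t)).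
Proof.
move=> [? ?]; split; first by under eq_fun do rewrite Re_conjc.
by under eq_fun do rewrite Im_conjc; exact: measurableT_comp.
Qed.

Lemma cmeas_cst (c : C) : cmeas (fun _ : T => c).
Proof. by split; exact: measurable_cst. Qed.

Lemma cmeas_real (a : T -> R) : measurable_fun setT a ->
  cmeas (fun t => real_complex R (a t)).
Proof. by move=> ma; split => //=; exact: measurable_cst. Qed.

Lemma cmeas_expi (a : T -> R) : measurable_fun setT a ->
  cmeas (fun t => expi (a t)).
Proof.
move=> ma; split => /=; apply: (measurableT_comp _ ma).
  by apply: continuous_measurable_fun; exact: continuous_cos.
by apply: continuous_measurable_fun; exact: continuous_sin.
Qed.

Lemma cmeas_cexp (F : T -> C) : cmeas F -> cmeas (fun t => cexp (F t)).
Proof.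
move=> [mR mI]; apply: cmeasM; last exact: cmeas_expi.
by apply: cmeas_real; apply: (measurableT_comp _ mR); exact: measurable_expR.
Qed.

Lemma cmeas_comp d' (T' : measurableType d') (F : T -> C) (k : T' -> T) :
  cmeas F -> measurable_fun setT k -> cmeas (fun t => F (k t)).
Proof. by move=> [mR mI] mk; split; [exact: (measurableT_comp mR)|exact: (measurableT_comp mI)]. Qed.

Lemma cmeas_continuous n (f : 'cV[R]_n -> C) (h : T -> 'cV[R]_n) :
  continuous (Re \o f) -> continuous (Im \o f) -> mvec h -> cmeas (fun t => f (h t)).
Proof.
by move=> cR cI mh; split; [apply: (measurable_continuous_comp cR)|
  apply: (measurable_continuous_comp cI)].
Qed.

End closure.
End Measurability.

(** * Integrals of complex functions and dominated convergence *)

Section ComplexIntegral.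
Variable R : realType.
Local Notation C := R[i].
Local Notation Re := (@complex.Re R).
Local Notation Im := (@complex.Im R).
Local Notation normc := (@Normc.normc R).

Section one_measure.
Context d (T : measurableType d) (mu : {measure set T -> \bar R}).
Implicit Types (F G : T -> C) (a b : T -> R).

Definition rint a := mu.-integrable [set: T] (EFin \o a).

Definition cint F := rint (Re \o F) /\ rint (Im \o F).

Lemma rint_le a b : measurable_fun setT a -> rint b ->
  (forall t, `|a t| <= b t) -> rint a.
Proof.
move=> ma ib ab; apply: (le_integrable measurableT _ _ ib).
  exact/measurable_EFinP.
by move=> t _; rewrite /= lee_fin (le_trans (ab t))// ler_norm.
Qed.

Lemma rintD a b : rint a -> rint b -> rint (fun t => a t + b t).
Proof. by move=> ia ib; exact: (integrableD measurableT ia ib). Qed.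

Lemma rintB a b : rint a -> rint b -> rint (fun t => a t - b t).
Proof. by move=> ia ib; exact: (integrableB measurableT ia ib). Qed.

Lemma rintZ (k : R) a : rint a -> rint (fun t => k * a t).
Proof. by move=> ia; exact: (integrableZl measurableT k ia). Qed.

Lemma rint_meas a : rint a -> measurable_fun setT a.
Proof. by move=> /integrableP[/measurable_EFinP]. Qed.

Lemma cint_le F b : cmeas F -> rint b -> (forall t, normc (F t) <= b t) -> cint F.
Proof.
move=> [mR mI] ib Fb; split; apply: (rint_le _ ib) => // t.
  by rewrite (le_trans (normc_Re _)).
by rewrite (le_trans (normc_Im _)).
Qed.

Lemma cint_meas F : cint F -> cmeas F.
Proof. by move=> [iR iI]; split; exact: rint_meas. Qed.

Lemma cintD F G : cint F -> cint G -> cint (fun t => F t + G t).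
Proof.
move=> [? ?] [? ?]; split.
  by rewrite /comp; under eq_fun do rewrite Re_D; exact: rintD.
by rewrite /comp; under eq_fun do rewrite Im_D; exact: rintD.
Qed.

Lemma cintZ (c : C) F : cint F -> cint (fun t => c * F t).
Proof.
move=> [iR iI]; split; rewrite /comp.
  by under eq_fun do rewrite Re_M; apply: rintB; exact: rintZ.
by under eq_fun do rewrite Im_M; apply: rintD; exact: rintZ.
Qed.

Lemma eq_cintegral F G : F =1 G -> cintegral mu F = cintegral mu G.
Proof. by move=> /funext ->. Qed.

Lemma cintegralD F G : cint F -> cint G ->
  cintegral mu (fun t => F t + G t) = cintegral mu F + cintegral mu G.
Proof.
move=> [? ?] [? ?]; apply: eq_ReIm; rewrite !ReIm /=.
  by under eq_Rintegral do rewrite Re_D; rewrite RintegralD.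
by under eq_Rintegral do rewrite Im_D; rewrite RintegralD.
Qed.

Lemma cintegralZ (c : C) F : cint F ->
  cintegral mu (fun t => c * F t) = c * cintegral mu F.
Proof.
move=> [iR iI]; apply: eq_ReIm; rewrite !ReIm /=.
  under eq_Rintegral do rewrite Re_M.
  by rewrite RintegralB ?RintegralZl//; exact: rintZ.
under eq_Rintegral do rewrite Im_M.
by rewrite RintegralD ?RintegralZl//; exact: rintZ.
Qed.

Lemma cintegral_sum (I : finType) (F : I -> T -> C) : (forall i, cint (F i)) ->
  cint (fun t => \sum_i F i t) /\
  cintegral mu (fun t => \sum_i F i t) = \sum_i cintegral mu (F i).
Proof.
move=> iF; elim: (index_enum I) => [|i s [IH1 IH2]].
  rewrite big_nil; under eq_fun do rewrite big_nil; split.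
    by split; exact: integrable0.
  by rewrite /cintegral /= /Rintegral integral0.
rewrite big_cons -IH2 -cintegralD//.
have -> : (fun t => \sum_(j <- i :: s) F j t) = (fun t => F i t + \sum_(j <- s) F j t).
  by apply/funext => t; rewrite big_cons.
by split => //; exact: cintD.
Qed.

Lemma le_Rintegral_ge0 a b : measurable_fun setT a -> rint b ->
  (forall t, 0 <= a t) -> (forall t, a t <= b t) ->
  \int[mu]_t a t <= \int[mu]_t b t.
Proof.
move=> ma ib a0 ab; apply: le_Rintegral => //.
by apply: (rint_le _ ib) => // t; rewrite ger0_norm.
Qed.

(** Real and imaginary parts are estimated separately, whence the factor 2; it is harmless because
    only boundedness is ever extracted from this. *)
Lemma normc_cintegral F b : cint F -> rint b -> (forall t, normc (F t) <= b t) ->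
  normc (cintegral mu F) <= 2 * \int[mu]_t b t.
Proof.
move=> [iR iI] ib Fb; rewrite (le_trans (normc_le _))//= mulr2n mulrDl mul1r lerD//.
  apply: (le_trans (le_normr_Rintegral measurableT iR)).
  apply: le_Rintegral_ge0 => // [|t].
    by apply: measurableT_comp => //; exact: rint_meas.
  by rewrite (le_trans (normc_Re _)).
apply: (le_trans (le_normr_Rintegral measurableT iI)).
apply: le_Rintegral_ge0 => // [|t].
  by apply: measurableT_comp => //; exact: rint_meas.
by rewrite (le_trans (normc_Im _)).
Qed.

Definition ccvg (u : nat -> C) (l : C) :=
  (fun k => Re (u k)) @ \oo --> Re l /\ (fun k => Im (u k)) @ \oo --> Im l.

Lemma rint_dominated (f : nat -> T -> R) (g : T -> R) b :
  (forall k, measurable_fun setT (f k)) -> rint b ->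
  (forall k t, `|f k t| <= b t) -> (forall t, f ^~ t @ \oo --> g t) ->
  (fun k => \int[mu]_t f k t) @ \oo --> \int[mu]_t g t.
Proof.
move=> mf ib fb fg.
have mg : measurable_fun setT g.
  by apply: (@measurable_fun_cvg _ _ _ _ f) => // t _; exact: fg.
have h1 : {ae mu, forall t, [set: T] t -> (f k t)%:E @[k --> \oo] --> (EFin \o g) t}.
  by apply: aeW => t _; apply: cvg_EFin; [exact: nearW|exact: fg].
have h2 : {ae mu, forall t k, [set: T] t -> (`|(f k t)%:E| <= (EFin \o b) t)%E}.
  by apply: aeW => t k _; rewrite lee_fin.
have [||ig _ cv] := @dominated_convergence _ _ _ mu _ measurableT
   (fun k t => (f k t)%:E) (EFin \o g) (EFin \o b) _ _ h1 ib h2.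
- by move=> k; exact/measurable_EFinP.
- exact/measurable_EFinP.
apply: fine_cvg; rewrite fineK//.
by apply: integrable_fin_num.
Qed.

Lemma ccvg_dominated (F : nat -> T -> C) G b :
  (forall k, cmeas (F k)) -> rint b ->
  (forall k t, normc (F k t) <= b t) -> (forall t, ccvg (F ^~ t) (G t)) ->
  ccvg (fun k => cintegral mu (F k)) (cintegral mu G).
Proof.
move=> mF ib Fb FG; split => /=; apply: (rint_dominated _ ib).
- by move=> k; have [] := mF k.
- by move=> k t; rewrite (le_trans (normc_Re _)).
- by move=> t; have [] := FG t.
- by move=> k; have [] := mF k.
- by move=> k t; rewrite (le_trans (normc_Im _)).
- by move=> t; have [] := FG t.
Qed.

End one_measure.
End ComplexIntegral.

(** * Derivatives of complex functions, differentiation under the integral, Fubini *)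

Section DerivativesAndFubini.
Variable R : realType.
Local Notation C := R[i].
Local Notation Re := (@complex.Re R).
Local Notation Im := (@complex.Im R).
Local Notation normc := (@Normc.normc R).

Definition cder (phi : R -> C) (s : R) (l : C) :=
  is_derive s 1 (fun r => Re (phi r)) (Re l) /\ is_derive s 1 (fun r => Im (phi r)) (Im l).

Lemma cderM (f g : R -> C) s (df dg : C) : cder f s df -> cder g s dg ->
  cder (fun r => f r * g r) s (df * g s + f s * dg).
Proof.
move=> [? ?] [? ?]; split; rewrite !ReIm.
  under eq_fun do rewrite Re_M.
  by apply: is_derive_eq; rewrite /GRing.scale/=; ring.
under eq_fun do rewrite Im_M.
by apply: is_derive_eq; rewrite /GRing.scale/=; ring.
Qed.

Lemma cderD (f g : R -> C) s (df dg : C) : cder f s df -> cder g s dg ->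
  cder (fun r => f r + g r) s (df + dg).
Proof.
by move=> [? ?] [? ?]; split; rewrite !ReIm;
  [under eq_fun do rewrite Re_D|under eq_fun do rewrite Im_D]; exact: is_deriveD.
Qed.

Lemma cder_conj (f : R -> C) s (df : C) : cder f s df ->
  cder (fun r => conjc (f r)) s (conjc df).
Proof.
by move=> [? ?]; split; rewrite !ReIm;
  [under eq_fun do rewrite Re_conjc|under eq_fun do rewrite Im_conjc; exact: is_deriveN].
Qed.

Lemma cder_cst (c : C) s : cder (fun=> c) s 0.
Proof. by split; exact: is_derive_cst. Qed.

Lemma cder_real (f : R -> R) (s df : R) : is_derive s 1 f df ->
  cder (fun r => real_complex R (f r)) s (real_complex R df).
Proof. by move=> ?; split => //=; exact: is_derive_cst. Qed.

Lemma cder_eq (f : R -> C) s l l' : cder f s l -> l = l' -> cder f s l'.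
Proof. by move=> + <-. Qed.

Lemma cder_cexp (f : R -> C) s df : cder f s df ->
  cder (fun r => cexp (f r)) s (df * cexp (f s)).
Proof.
move=> [dR dI]; have dE : is_derive s 1 (fun r => expR (Re (f r))) (expR (Re (f s)) * Re df).
  exact: (@is_derive1_comp _ expR).
have dC : is_derive s 1 (fun r => cos (Im (f r))) (- sin (Im (f s)) * Im df).
  exact: (@is_derive1_comp _ cos).
have dS : is_derive s 1 (fun r => sin (Im (f r))) (cos (Im (f s)) * Im df).
  exact: (@is_derive1_comp _ sin).
have dX : cder (fun r => expi (Im (f r))) s
    (Complex (- sin (Im (f s)) * Im df) (cos (Im (f s)) * Im df)) by [].
apply: cder_eq; first exact: cderM (cder_real dE) dX.
by rewrite /cexp; apply: eq_ReIm; rewrite !ReIm /=; ring.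
Qed.

(** This is the uniqueness argument for the differential equations below: the unknown times the
    inverse of the candidate solution has derivative 0. *)
Lemma cder0_cst (f : R -> C) : (forall s, cder f s 0) -> forall s t, f s = f t.
Proof.
move=> df s t; apply: eq_ReIm.
  by apply: (@is_derive_0_is_cst _ (Re \o f)) => r; have [] := df r.
by apply: (@is_derive_0_is_cst _ (Im \o f)) => r; have [] := df r.
Qed.

Section under_integral.
Context d (T : measurableType d) (mu : {measure set T -> \bar R}).

Lemma is_derive_Rintegral (f df : R -> T -> R) (b : T -> R) (s : R) :
  (forall r, rint mu (f r)) -> rint mu b ->
  (forall (r : R) t, is_derive r 1 (f ^~ t) (df r t)) ->
  (forall r t, `|df r t| <= b t) ->
  is_derive s 1 (fun r => \int[mu]_t f r t) (\int[mu]_t df s t).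
Proof.
move=> mf ib fdf dfb.
have dE r t : derive1 (f ^~ t) r = df r t by rewrite derive1E; apply: derive_val.
(* The bound [b] is valid for every parameter, so any open interval around [s] would do. *)
have sI : (`]s - 1, s + 1[%classic : set R) s.
  by rewrite /= in_itv/= ltrBlDr ltrDl ltr01.
have dfI r t : (`]s - 1, s + 1[%classic : set R) r -> [set: T] t -> derivable (f ^~ t) r 1.
  by move=> _ _; have [] := fdf r t.
have b0 t : 0 <= b t by apply: le_trans (dfb s t).
have bI r t : (`]s - 1, s + 1[%classic : set R) r -> [set: T] t ->
    `|partial1of2 f r t| <= b t.
  by move=> _ _; rewrite /partial1of2 dE.
have mI r : (`]s - 1, s + 1[%classic : set R) r -> mu.-integrable setT (EFin \o f r).
  by move=> _; exact: mf.
apply: DeriveDef.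
  exact: (derivable_under_integral measurableT sI mI dfI b0 ib bI).
rewrite -derive1E (differentiation_under_integral measurableT sI mI dfI b0 ib bI).
by apply: eq_Rintegral => t _; rewrite /partial1of2 dE.
Qed.

Lemma cder_cintegral (f df : R -> T -> C) (b : T -> R) (s : R) :
  (forall r, cint mu (f r)) -> rint mu b ->
  (forall r t, cder (f ^~ t) r (df r t)) ->
  (forall r t, normc (df r t) <= b t) ->
  cder (fun r => cintegral mu (f r)) s (cintegral mu (df s)).
Proof.
move=> mf ib fdf dfb; split => /=.
  apply: (@is_derive_Rintegral (fun r t => Re (f r t)) (fun r t => Re (df r t)) b) => //.
  - by move=> r; have [] := mf r.
  - by move=> r t; have [] := fdf r t.
  - by move=> r t; rewrite (le_trans (normc_Re _)).
apply: (@is_derive_Rintegral (fun r t => Im (f r t)) (fun r t => Im (df r t)) b) => //.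
- by move=> r; have [] := mf r.
- by move=> r t; have [] := fdf r t.
- by move=> r t; rewrite (le_trans (normc_Im _)).
Qed.

End under_integral.

Section Fubini.
Context d1 (T1 : measurableType d1) d2 (T2 : measurableType d2).
Variables (m1 : {sigma_finite_measure set T1 -> \bar R})
          (m2 : {sigma_finite_measure set T2 -> \bar R}).

Lemma cmeas_section (F : T1 * T2 -> C) x : cmeas F -> cmeas (fun y => F (x, y)).
Proof. by move=> mF; apply: (cmeas_comp mF); exact: measurable_pair1. Qed.

Lemma rint_prod (a : T1 -> R) (b : T2 -> R) : rint m1 a -> rint m2 b ->
  rint (m1 \x m2)%E (fun z => a z.1 * b z.2).
Proof.
move=> ia ib.
have ma := rint_meas ia; have mb := rint_meas ib.
have mab : measurable_fun [set: T1 * T2] (fun z : T1 * T2 => a z.1 * b z.2).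
  by apply: measurable_funM; [exact: (measurableT_comp ma)|exact: (measurableT_comp mb)].
apply/integrable12ltyP; first exact/measurable_EFinP.
have /integrableP[_ Ia] := ia; have /integrableP[_ Ib] := ib.
rewrite (eq_integral (fun x => (`|a x|%:E * \int[m2]_y `|b y|%:E)%E)); last first.
  move=> x _; rewrite -ge0_integralZl//=.
  - by apply: eq_integral => y _ /=; rewrite normrM EFinM.
  - by apply/measurable_EFinP; exact: measurableT_comp.
rewrite ge0_integralZr//=.
- by apply: lte_mul_pinfty => //; [exact: integral_ge0|rewrite ge0_fin_numE// integral_ge0].
- by apply/measurable_EFinP; exact: measurableT_comp.
- exact: integral_ge0.
Qed.

Lemma rfubini12 (f : T1 * T2 -> R) : rint (m1 \x m2)%E f ->
  (forall x, rint m2 (fun y => f (x, y))) ->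
  \int[m1]_x \int[m2]_y f (x, y) = \int[(m1 \x m2)%E]_z f z.
Proof.
move=> i_f if2; rewrite /Rintegral -(integral12_prod_meas1 i_f).
by congr fine; apply: eq_integral => x _; rewrite fineK//; exact: integrable_fin_num (if2 x).
Qed.

Lemma rfubini21 (f : T1 * T2 -> R) : rint (m1 \x m2)%E f ->
  (forall y, rint m1 (fun x => f (x, y))) ->
  \int[m2]_y \int[m1]_x f (x, y) = \int[(m1 \x m2)%E]_z f z.
Proof.
move=> i_f if1; rewrite /Rintegral -(integral21_prod_meas1 i_f).
by congr fine; apply: eq_integral => x _; rewrite fineK//; exact: integrable_fin_num (if1 x).
Qed.

Lemma cfubini12 (F : T1 * T2 -> C) : cint (m1 \x m2)%E F ->
  (forall x, cint m2 (fun y => F (x, y))) ->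
  cintegral m1 (fun x => cintegral m2 (fun y => F (x, y))) = cintegral (m1 \x m2)%E F.
Proof.
move=> [iR iI] i2; apply: eq_ReIm => /=.
  by apply: (rfubini12 iR) => x; have [] := i2 x.
by apply: (rfubini12 iI) => x; have [] := i2 x.
Qed.

Lemma cfubini21 (F : T1 * T2 -> C) : cint (m1 \x m2)%E F ->
  (forall y, cint m1 (fun x => F (x, y))) ->
  cintegral m2 (fun y => cintegral m1 (fun x => F (x, y))) = cintegral (m1 \x m2)%E F.
Proof.
move=> [iR iI] i2; apply: eq_ReIm => /=.
  by apply: (rfubini21 iR) => x; have [] := i2 x.
by apply: (rfubini21 iI) => x; have [] := i2 x.
Qed.

(** Integrability is not assumed: the integrals of the positive and negative parts are measurable in
    [x] by Tonelli, and so is [fine] of their difference. *)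
Lemma measurable_Rintegral (f : T1 * T2 -> R) : measurable_fun setT f ->
  measurable_fun setT (fun x => \int[m2]_y f (x, y)).
Proof.
move=> mf; have mE : measurable_fun setT (EFin \o f) by exact/measurable_EFinP.
rewrite /Rintegral; apply: (measurableT_comp (f := fine)) => //.
rewrite (_ : (fun x => _) = (fun x => (\int[m2]_y ((EFin \o f)^\+ (x, y))) -
    (\int[m2]_y ((EFin \o f)^\- (x, y))))%E); last first.
  apply/funext => x; rewrite [LHS]integralE.
  by congr (_ - _)%E; apply: eq_integral => y _; rewrite ?funeposE ?funenegE.
apply: emeasurable_funB; apply: measurable_fun_fubini_tonelli_F => //.
- exact: measurable_funepos.
- exact: measurable_funeneg.
Qed.

Lemma cmeas_cintegral (F : T1 * T2 -> C) : cmeas F ->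
  cmeas (fun x => cintegral m2 (fun y => F (x, y))).
Proof.
by move=> [mR mI]; split => /=; [exact: (measurable_Rintegral mR)|
  exact: (measurable_Rintegral mI)].
Qed.

(** Collects what both orders of Fubini require. Because the bound is a product, the sections are
    integrable at every point, not merely at almost every one. *)
Lemma cint_prod_le (F : T1 * T2 -> C) (a : T1 -> R) (b : T2 -> R) :
  cmeas F -> rint m1 a -> rint m2 b ->
  (forall x y, normc (F (x, y)) <= a x * b y) ->
  [/\ cint (m1 \x m2)%E F, forall x, cint m2 (fun y => F (x, y)) &
      forall y, cint m1 (fun x => F (x, y))].
Proof.
move=> mF ia ib Fab; split.
- by apply: (cint_le mF (rint_prod ia ib)) => -[x y]; exact: Fab.
- move=> x; apply: (cint_le (cmeas_section x mF) (rintZ (a x) ib)) => y.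
  exact: Fab.
- move=> y; apply: (cint_le _ (rintZ (b y) ia)) => [|x].
    by apply: (cmeas_comp mF); exact: measurable_pair2.
  by rewrite mulrC; exact: Fab.
Qed.

End Fubini.
End DerivativesAndFubini.

(** * Invariance of Lebesgue measure under translations and reflection *)

Section LebesgueInvariance.
Variable R : realType.
Local Notation C := R[i].
Local Notation RR := (measurableTypeR R).
Local Notation mu1 := (@lebesgue_measure R).

Lemma integral_leb_succ n (f : n.+1.-tuple RR -> \bar R) :
  measurable_fun setT f -> (forall t, (0 <= f t)%E) ->
  (\int[leb R n.+1]_t f t = \int[mu1]_x \int[leb R n]_t f (tcons (x, t)))%E.
Proof.
move=> mf f0.
have mt := @measurable_tcons R n.
transitivity (\int[pushforward (mu1 \x leb R n) (@tcons R n)]_t f t)%E; first by [].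
rewrite (ge0_integral_pushforward mt)//=.
rewrite preimage_setT (@fubini_tonelli1 _ _ _ _ _ mu1 (leb R n) (f \o @tcons R n))//.
  exact: measurableT_comp.
by move=> x; exact: f0.
Qed.

Section affine1.
(* The measure-preserving maps x |-> s x + a with s = 1 or -1. *)
Variables (s a : R).
Hypothesis s1 : s = 1 \/ s = -1.

Let phi (x : RR) : RR := s * x + a.

Let mphi : measurable_fun setT phi.
Proof. by apply: measurable_funD => //; exact: measurable_funM. Qed.

(** By uniqueness of Lebesgue measure it suffices to compare it with its image under [phi] on
    half-open intervals. *)
Lemma lebesgue_affine (f : RR -> \bar R) : measurable_fun setT f ->
  (forall x, (0 <= f x)%E) ->
  (\int[mu1]_x f (s * x + a)%R = \int[mu1]_x f x)%E.
Proof.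
move=> mf f0.
have pE A : measurable A -> mu1 A = pushforward mu1 phi A.
  move: A; apply: lebesgue_measure_unique => A /ocitvP[->|[[b c] /= bc ->]].
    by rewrite !measure0.
  rewrite /pushforward; case: s1 => sE.
    rewrite (_ : _ @^-1` _ = `](b - a), (c - a)]%classic); last first.
      apply/seteqP; split => x /=; rewrite /phi sE mul1r !in_itv/= => /andP[? ?]; apply/andP; split; lra.
    rewrite !lebesgue_measure_itv/= !lte_fin ltrD2r; case: ifPn => // _.
    by rewrite -!EFinB; congr EFin; lra.
  (* A reflection moves the open end of the interval to the other side, which leaves the length
     unchanged. *)
  rewrite (_ : _ @^-1` _ = `[(a - c), (a - b)[%classic); last first.
    apply/seteqP; split => x /=; rewrite /phi sE !in_itv/= => /andP[? ?]; apply/andP; split; lra.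
  rewrite !lebesgue_measure_itv/= !lte_fin ltrD2l ltrN2; case: ifPn => // _.
  by rewrite -!EFinB; congr EFin; lra.
transitivity (\int[pushforward mu1 phi]_x f x)%E.
  by rewrite (ge0_integral_pushforward mphi)//= preimage_setT.
by apply: eq_measure_integral => A mA _; exact/esym/pE.
Qed.
End affine1.

Definition taff n (s : R) (a : 'cV[R]_n) (t : n.-tuple RR) : n.-tuple RR :=
  unvec (s *: vec t + a).

Lemma measurable_taff n s (a : 'cV[R]_n) : measurable_fun setT (taff s a).
Proof.
apply: measurable_unvec; apply: mvecD; last exact: mvec_cst.
by apply: mvecZ; exact: mvec_vec.
Qed.

Lemma taff_tcons n s (a : 'cV[R]_n.+1) x t :
  taff s a (tcons (x, t)) =
  tcons (s * x + a ord0 0, taff s (\col_i a (lift ord0 i) 0) t).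
Proof.
apply/eq_from_tnth => i; rewrite tnth_mktuple !mxE.
have [j ->|->] := unliftP ord0 i; last by rewrite !(tnth_nth 0).
by rewrite /tcons /= !tnthS tnth_mktuple !mxE.
Qed.

(** The map acts on each coordinate separately: the induction hypothesis handles the inner integral
    and the one-dimensional case the outer one. *)
Lemma leb_affine n (s : R) (a : 'cV[R]_n) (f : n.-tuple RR -> \bar R) :
  s = 1 \/ s = -1 -> measurable_fun setT f -> (forall t, (0 <= f t)%E) ->
  (\int[leb R n]_t f (taff s a t) = \int[leb R n]_t f t)%E.
Proof.
move=> s1; elim: n a f => [|n IH] a f mf f0.
  by apply: eq_integral => t _; rewrite (tuple0 t) (tuple0 (taff _ _ _)).
have mfc x : measurable_fun setT (fun t => f (tcons (x, t))).
  apply: (measurableT_comp mf); apply: (measurableT_comp (@measurable_tcons R n)).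
  exact: measurable_pair1.
rewrite !integral_leb_succ//; last first.
  by apply: (measurableT_comp mf); exact: measurable_taff.
under eq_integral do under eq_integral do rewrite taff_tcons.
under eq_integral => x _ do
  rewrite (IH _ (fun t => f (tcons (s * x + a ord0 0, t))))//.
rewrite (@lebesgue_affine s _ s1 (fun x => \int[leb R n]_t f (tcons (x, t)))%E)//.
  apply: (@measurable_fun_fubini_tonelli_F _ _ _ _ _ (leb R n) (f \o @tcons R n)) => //.
    by apply: (measurableT_comp mf); exact: measurable_tcons.
  by move=> x; exact: f0.
by move=> x; apply: integral_ge0 => t _; exact: f0.
Qed.

Lemma Rintegral_affine n (s : R) (a : 'cV[R]_n) (f : n.-tuple RR -> R) :
  s = 1 \/ s = -1 -> measurable_fun setT f ->
  \int[leb R n]_t f (taff s a t) = \int[leb R n]_t f t.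
Proof.
move=> s1 mf; have mE : measurable_fun setT (EFin \o f) by exact/measurable_EFinP.
rewrite /Rintegral; congr fine; rewrite [LHS]integralE [RHS]integralE.
congr (_ - _)%E.
  apply: etrans (leb_affine (f := (EFin \o f)^\+%E) a s1 _ _) => //.
    by apply: eq_integral => t _; rewrite !funeposE.
  exact: measurable_funepos.
apply: etrans (leb_affine (f := (EFin \o f)^\-%E) a s1 _ _) => //.
  by apply: eq_integral => t _; rewrite !funenegE.
exact: measurable_funeneg.
Qed.

Lemma rint_affine n (s : R) (a : 'cV[R]_n) (f : n.-tuple RR -> R) :
  s = 1 \/ s = -1 -> rint (leb R n) f -> rint (leb R n) (fun t => f (taff s a t)).
Proof.
move=> s1 i_f; have mf := rint_meas i_f.
apply/integrableP; split.
  by apply/measurable_EFinP; apply: (measurableT_comp mf); exact: measurable_taff.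
rewrite (leb_affine (f := fun t => `|(f t)%:E|%E) a s1)//.
  by have /integrableP[] := i_f.
by apply: measurableT_comp => //; exact/measurable_EFinP.
Qed.

(** The case [s = 1] is used to translate the momentum variable, the case [s = -1] for the
    substitution x' = x - x0 at fixed x. *)
Lemma cintegral_affine n (s : R) (a : 'cV[R]_n) (F : 'cV[R]_n -> C) :
  s = 1 \/ s = -1 -> cmeas (F \o @vec R n) ->
  cintegral (leb R n) (fun t => F (s *: vec t + a)) = cintegral (leb R n) (F \o @vec R n).
Proof.
move=> s1 [mR mI]; apply: eq_ReIm => /=.
  rewrite -(Rintegral_affine a s1 mR); apply: eq_Rintegral => t _.
  by rewrite /= unvecK.
rewrite -(Rintegral_affine a s1 mI); apply: eq_Rintegral => t _.
by rewrite /= unvecK.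
Qed.

End LebesgueInvariance.

(** * An integrable weight, the real Gaussian, and integrals of partial derivatives *)

Section Weight.
Variable R : realType.
Local Notation C := R[i].
Local Notation RR := (measurableTypeR R).
Local Notation Re := (@complex.Re R).
Local Notation Im := (@complex.Im R).
Local Notation normc := (@Normc.normc R).
Local Notation mu1 := (@lebesgue_measure R).

Lemma integral_leb_prod n (a : R -> R) (c : R) :
  measurable_fun setT a -> (forall x, 0 <= a x) ->
  (\int[mu1]_x (a x)%:E = c%:E)%E ->
  (\int[leb R n]_t (\prod_(i < n) a (vec t i 0))%:E = (c ^+ n)%:E)%E.
Proof.
move=> ma a0 ac.
have p0 k (t : k.-tuple RR) : 0 <= \prod_(i < k) a (vec t i 0) by apply: prodr_ge0.
have mp k : measurable_fun setT (fun t : k.-tuple RR => \prod_(i < k) a (vec t i 0)).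
  apply: measurable_prod => i _.
  by apply: (measurableT_comp ma); exact: mvec_vec.
elim: n => [|n IH].
  rewrite [LHS]integral_dirac//= ?diracT ?mul1e.
    by rewrite big_ord0 expr0.
  by have /measurable_EFinP := mp 0%N.
rewrite integral_leb_succ; last 2 first.
- by apply/measurable_EFinP; exact: mp.
- by move=> t; rewrite lee_fin p0.
have pE x (t : n.-tuple RR) : \prod_(i < n.+1) a (vec (tcons (x, t)) i 0) =
    a x * \prod_(i < n) a (vec t i 0).
  rewrite big_ord_recl !mxE /tcons /= tnth0; congr (_ * _).
  by apply: eq_bigr => i _; rewrite !mxE tnthS.
under eq_integral => x _.
  under eq_integral => t _ do rewrite pE EFinM.
  rewrite ge0_integralZl//; [|by apply/measurable_EFinP; exact: mp|by move=> t _; rewrite lee_fin p0|by rewrite lee_fin].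
  rewrite IH.
  over.
rewrite ge0_integralZr//.
- by rewrite ac -EFinM exprS.
- exact/measurable_EFinP.
- by move=> x _; rewrite lee_fin.
- by rewrite lee_fin -lee_fin -IH integral_ge0// => t _; rewrite lee_fin.
Qed.

Lemma integral_oneDsqrV : (\int[mu1]_x ((1 + x ^+ 2)^-1)%:E = pi%:E)%E.
Proof.
rewrite (@ge0_symfun_integralT _ (fun x => (1 + x ^+ 2)^-1)).
- rewrite (_ : [set x | _] = `[0, +oo[%classic); last first.
    by apply/seteqP; split => x/=; rewrite in_itv/= andbT.
  rewrite [X in (_ * X)%E](_ : _ = (pi / 2)%:E).
    by rewrite -EFinM; congr EFin; field.
  exact: integral0y_oneDsqr.
- by move=> x; rewrite invr_ge0 addr_ge0// sqr_ge0.
- exact: continuous_oneDsqrV.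
- by move=> x /=; rewrite sqrrN.
Qed.

(** The common majorant: a product over coordinates, hence integrable with integral pi^n, and of
    polynomial decay, so that Schwartz functions and Gaussians lie below multiples of its square. *)
Definition weight n (x : 'cV[R]_n) : R := \prod_i (1 + x i 0 ^+ 2)^-1.

Lemma weight_gt0 n (x : 'cV[R]_n) : 0 < weight x.
Proof. by apply: prodr_gt0 => i _; rewrite invr_gt0 ltr_pwDl// sqr_ge0. Qed.

Lemma weight_ge0 n (x : 'cV[R]_n) : 0 <= weight x.
Proof. exact/ltW/weight_gt0. Qed.

Lemma measurable_oneDsqrV : measurable_fun setT (fun x : R => (1 + x ^+ 2)^-1).
Proof. by apply: continuous_measurable_fun; exact: continuous_oneDsqrV. Qed.

Lemma measurable_weight d (T : measurableType d) n (h : T -> 'cV[R]_n) :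
  mvec h -> measurable_fun setT (fun t => weight (h t)).
Proof.
move=> mh; apply: measurable_prod => i _.
by apply: (measurableT_comp measurable_oneDsqrV); exact: mh.
Qed.

Lemma rint_weight n : rint (leb R n) (fun t => weight (vec t)).
Proof.
apply/integrableP; split.
  by apply/measurable_EFinP; apply: measurable_weight; exact: mvec_vec.
under eq_integral do rewrite /= ger0_norm ?weight_ge0//.
rewrite (@integral_leb_prod n (fun x => (1 + x ^+ 2)^-1) pi) ?ltry//.
- exact: measurable_oneDsqrV.
- by move=> x; rewrite invr_ge0 addr_ge0// sqr_ge0.
- exact: integral_oneDsqrV.
Qed.

(** In each coordinate 1 + x^2 <= 1 + 2 (x + a)^2 + 2 a^2 <= 4 (1 + (x + a)^2). It controls
    difference quotients with steps of length at most 1. *)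
Lemma weight_shift n (x a : 'cV[R]_n) : (forall i, `|a i 0| <= 1) ->
  weight (x + a) <= 4 ^+ n * weight x.
Proof.
move=> a1; rewrite -[n in 4 ^+ n]card_ord -prodr_const -big_split /=.
apply: ler_prod => i _; rewrite invr_ge0 addr_ge0 ?sqr_ge0//= mxE.
have pos (y : R) : 0 < 1 + y ^+ 2 by rewrite ltr_pwDl// sqr_ge0.
rewrite ler_pdivlMr// mulrC ler_pdivrMr//.
have : (a i 0) ^+ 2 <= 1 by rewrite -real_normK ?num_real// expr_le1.
have := sqr_ge0 (x i 0 + 2 * a i 0); nra.
Qed.

(** A form of Peetre's inequality, 1 + y^2 <= 2 (1 + (x - y)^2) (1 + x^2) in each coordinate: decay
    in x - y and in x is traded for decay in y. *)
Lemma weight_sub n (x y : 'cV[R]_n) :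
  weight (x - y) * weight x <= 2 ^+ n * weight y.
Proof.
rewrite -[n in 2 ^+ n]card_ord -prodr_const -!big_split /=.
apply: ler_prod => i _; rewrite !mxE.
have pos (z : R) : 0 < 1 + z ^+ 2 by rewrite ltr_pwDl// sqr_ge0.
rewrite mulr_ge0 ?invr_ge0 ?(ltW (pos _))//=.
rewrite -invfM ler_pdivlMr// mulrC ler_pdivrMr ?mulr_gt0//.
have := sqr_ge0 ((x i 0 - y i 0) + x i 0); have := sqr_ge0 ((x i 0 - y i 0) * x i 0).
have := sqr_ge0 (x i 0); nra.
Qed.

(** The integrand is a normal density of variance 1/e without its normalization, and such a density
    has total mass 1. *)
Lemma gauss1 (e : R) : 0 < e ->
  (\int[mu1]_x (expR (- (2^-1 * e * x ^+ 2)))%:E = (Num.sqrt (2 * pi / e))%:E)%E.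
Proof.
move=> e0; pose s := (Num.sqrt e)^-1.
have s0 : s != 0 by rewrite invr_eq0 gt_eqF ?sqrtr_gt0.
have pk0 := normal_peak_gt0 s0.
have sE : s ^+ 2 = e^-1 by rewrite exprVn sqr_sqrtr// ltW.
have fE x : expR (- (2^-1 * e * x ^+ 2)) = normal_fun 0 s x.
  by rewrite /normal_fun sE subr0; congr expR; field; rewrite gt_eqF.
under eq_integral do rewrite fE.
have := @integral_normal_pdf R 0 s.
rewrite normal_pdfE// (_ : (\int[mu1]_x _)%E =
  (\int[mu1]_x ((normal_peak s)%:E * (normal_fun 0 s x)%:E))%E); last first.
  by apply: eq_integral.
rewrite ge0_integralZl//; last 3 first.
- by apply/measurable_EFinP; exact: measurable_normal_fun.
- by move=> x _; rewrite lee_fin normal_fun_ge0.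
- by rewrite lee_fin normal_peak_ge0.
rewrite /normal_peak sE -mulrnAr mulrC -(mulr_natl pi) => H.
rewrite -[RHS]mule1 -H muleA -EFinM divff ?mul1e//.
by rewrite gt_eqF// sqrtr_gt0 divr_gt0// mulr_gt0 ?pi_gt0.
Qed.

(* The integral of a partial derivative vanishes because Lebesgue measure is
   translation invariant: it is the limit of the integrals of the difference
   quotients. *)
Lemma Rintegral_partial n (e : 'cV[R]_n) (u du : 'cV[R]_n -> R) (K : R) :
  (forall i, `|e i 0| <= 1) ->
  (forall x, is_derive (0 : R) 1 (fun s : R => u (x + s *: e)) (du x)) ->
  measurable_fun setT (u \o @vec R n) ->
  (forall x, `|u x| <= K * weight x) -> (forall x, `|du x| <= K * weight x) ->
  \int[leb R n]_t du (vec t) = 0.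
Proof.
move=> e1 dud mu uK duK.
have K0 : 0 <= K.
  by have := le_trans (normr_ge0 _) (uK 0); rewrite pmulr_lge0 ?weight_gt0.
(* The derivative at parameter 0 is given at every base point; moving the base point gives it along
   the whole line. *)
have dus x (s : R) : is_derive s 1 (fun s : R => u (x + s *: e)) (du (x + s *: e)).
  have -> : (fun r : R => u (x + r *: e)) =
      (fun r : R => u (x + s *: e + r *: e)) \o (fun r => r - s).
    by apply/funext => r /=; rewrite -addrA -scalerDl addrCA subrr addr0.
  rewrite -[du _]mulr1; apply: is_derive1_comp; first by rewrite subrr.
  by apply: is_derive_eq; rewrite subr0.
pose t k : R := k.+1%:R^-1.
have t0 k : 0 < t k by rewrite invr_gt0.
have t1 k : t k <= 1 by rewrite invf_le1// ler1n.
pose q k (x : n.-tuple RR) := (t k)^-1 * (u (vec x + t k *: e) - u (vec x)).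
have iw : rint (leb R n) (fun x => K * weight (vec x)) by apply/rintZ/rint_weight.
have iu : rint (leb R n) (fun x => u (vec x)) by apply: (rint_le _ iw).
have iut k : rint (leb R n) (fun x => u (vec x + t k *: e)).
  have := @rint_affine R n 1 (t k *: e) _ (or_introl erefl) iu.
  by congr rint; apply/funext => x; rewrite /taff unvecK scale1r.
have q0 k : \int[leb R n]_x q k x = 0.
  rewrite RintegralZl//; last exact: rintB.
  rewrite RintegralB; [|by []|exact: iut|exact: iu]; apply/eqP; rewrite mulf_eq0 subr_eq0; apply/orP; right.
  rewrite -(@Rintegral_affine R n 1 (t k *: e) _ (or_introl erefl) mu); apply/eqP.
  by apply: eq_Rintegral => x _; rewrite /= unvecK scale1r.
(* By the mean value theorem the quotient is [du] at a point shifted by at most 1 in each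
   coordinate, and [weight_shift] costs the factor [4 ^+ n]. *)
have qb k x : `|q k x| <= K * 4 ^+ n * weight (vec x).
  have := @MVT _ (fun s : R => u (vec x + s *: e)) (fun s => du (vec x + s *: e)) 0 (t k)
    (t0 k) (fun s _ => dus _ s).
  rewrite scale0r addr0 subr0; case.
    apply: derivable_within_continuous => s _.
    by have [] := dus (vec x) s.
  move=> s; rewrite in_itv/= => /andP[s0 st] E.
  rewrite /q E mulrCA mulVf ?gt_eqF// mulr1 (le_trans (duK _))//.
  rewrite -mulrA ler_wpM2l// weight_shift// => i.
  rewrite mxE normrM mulr_ile1//.
  by rewrite ger0_norm ?(ltW s0)// (le_trans (ltW st)).
have mq k : measurable_fun setT (q k).
  apply: measurable_funM => //; apply: measurable_funB.
    exact: rint_meas (iut k).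
  exact: rint_meas iu.
have qcv x : q ^~ x @ \oo --> du (vec x).
  have [ex dE] := dud (vec x).
  have hl : (fun h : R => h^-1 *: (u (vec x + (h *: 1 + 0) *: e) - u (vec x + 0 *: e)))
      @ 0^' --> du (vec x) by rewrite -dE; exact: ex.
  have tcv : t @ \oo --> (0 : R) by exact: cvg_harmonic.
  have /cvgr_dnbhsP/(_ t) H := hl.
  rewrite (_ : q ^~ x = fun k => (t k)^-1 *:
      (u (vec x + (t k *: 1 + 0) *: e) - u (vec x + 0 *: e))).
    by apply: H; split => // k; rewrite gt_eqF.
  by apply/funext => k; rewrite addr0 scale0r addr0 -[_ *: 1]/(t k * 1) mulr1.
have iw4 : rint (leb R n) (fun x => K * 4 ^+ n * weight (vec x)).
  exact/rintZ/rint_weight.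
have := rint_dominated mq iw4 qb qcv.
under eq_fun do rewrite q0.
by move/cvg_lim => /= <-//; rewrite lim_cst.
Qed.

Lemma cintegral_partial n (e : 'cV[R]_n) (u du : 'cV[R]_n -> C) (K : R) :
  (forall i, `|e i 0| <= 1) ->
  (forall x, cder (fun s : R => u (x + s *: e)) 0 (du x)) ->
  cmeas (u \o @vec R n) ->
  (forall x, normc (u x) <= K * weight x) -> (forall x, normc (du x) <= K * weight x) ->
  cintegral (leb R n) (fun t => du (vec t)) = 0.
Proof.
move=> e1 dud [mR mI] uK duK; apply: eq_ReIm => /=.
  apply: (@Rintegral_partial n e (fun x => Re (u x)) (fun x => Re (du x)) K) => //.
  - by move=> x; have [] := dud x.
  - by move=> x; rewrite (le_trans (normc_Re _)).
  - by move=> x; rewrite (le_trans (normc_Re _)).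
apply: (@Rintegral_partial n e (fun x => Im (u x)) (fun x => Im (du x)) K) => //.
- by move=> x; have [] := dud x.
- by move=> x; rewrite (le_trans (normc_Im _)).
- by move=> x; rewrite (le_trans (normc_Im _)).
Qed.

End Weight.

(** * The dot product of column vectors *)

Section DotProduct.
Variable R : realType.

Lemma dotE n (u v : 'cV[R]_n) : dot u v = (u^T *m v) 0 0.
Proof. by rewrite mxE; apply: eq_bigr => i _; rewrite mxE. Qed.

Lemma dotC n (u v : 'cV[R]_n) : dot u v = dot v u.
Proof. by apply: eq_bigr => i _; rewrite mulrC. Qed.

Lemma dotDl n (u v w : 'cV[R]_n) : dot (u + v) w = dot u w + dot v w.
Proof. by rewrite !dotE linearD mulmxDl mxE. Qed.

Lemma dotDr n (u v w : 'cV[R]_n) : dot w (u + v) = dot w u + dot w v.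
Proof. by rewrite !dotE mulmxDr mxE. Qed.

Lemma dotZl n a (u v : 'cV[R]_n) : dot (a *: u) v = a * dot u v.
Proof. by rewrite !dotE linearZ -scalemxAl mxE. Qed.

Lemma dotZr n a (u v : 'cV[R]_n) : dot u (a *: v) = a * dot u v.
Proof. by rewrite dotC dotZl dotC. Qed.

Lemma dotNl n (u v : 'cV[R]_n) : dot (- u) v = - dot u v.
Proof. by rewrite -scaleN1r dotZl mulN1r. Qed.

Lemma dotNr n (u v : 'cV[R]_n) : dot u (- v) = - dot u v.
Proof. by rewrite dotC dotNl dotC. Qed.

Lemma dot_mulmx m n (A : 'M[R]_(m, n)) u v : dot (A *m u) v = dot u (A^T *m v).
Proof. by rewrite !dotE trmx_mul mulmxA. Qed.

Lemma dot_delta n (u : 'cV[R]_n) i : dot u (delta_mx i 0) = u i 0.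
Proof.
rewrite /dot (bigD1 i)//= big1 ?addr0 => [|j ji]; rewrite mxE !eqxx ?mulr1//.
by rewrite (negbTE ji) mulr0.
Qed.

Lemma dot_col_mx n (u v u' v' : 'cV[R]_n) :
  dot (col_mx u v) (col_mx u' v') = dot u u' + dot v v'.
Proof. by rewrite !dotE tr_col_mx mul_row_col mxE. Qed.

Lemma dot_ge0 n (u : 'cV[R]_n) : 0 <= dot u u.
Proof. by apply: sumr_ge0 => i _; rewrite -expr2 sqr_ge0. Qed.

Definition dotlin := (dotDl, dotDr, dotNl, dotNr, dotZl, dotZr).

End DotProduct.

(** * Spectral decomposition of symmetric matrices and the inertia *)

Section Spectral.
Variable R : realType.
Local Notation C := R[i].
Local Notation toC := (real_complex R).

(** The diagonalizing matrix may be complex, since it will occur in matrix identities and never as a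
    substitution in an integral. *)
Lemma spectral_symmetric n (M : 'M[R]_n) : M^T = M ->
  exists (lam : 'rV[R]_n) (U : 'M[C]_n),
    (map_mx (@conjc R) U)^T *m U = 1%:M /\
    map_mx toC M = (map_mx (@conjc R) U)^T *m diag_mx (map_mx toC lam) *m U.
Proof.
move=> symM; pose A := map_mx toC M.
have reA : A \is a realmx.
  by apply/mxOverP => i j; rewrite mxE; apply/complex_realP; exists (M i j).
have syA : A \is symmetricmx.
  apply/is_hermitianmxP; rewrite expr0 scale1r map_mx_id//.
  by rewrite map_trmx symM.
have hA : A \is hermsymmx by exact: realsym_hermsym.
have /orthomx_spectralP := hermitian_normalmx hA.
set U := spectralmx A; set sp := spectral_diag A => AE.
have Uu : U \is unitarymx by exact: spectral_unitarymx.
have re_sp : sp \is a realmx by exact: hermitian_spectral_diag_real.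
have cE : map_mx (@Num.conj C) U^T = (map_mx (@conjc R) U)^T.
  by rewrite -map_trmx.
exists (map_mx (@complex.Re R) sp), U; split.
  by rewrite -cE -invmx_unitary// mulVmx// unitarymx_unit.
rewrite -cE -invmx_unitary// -/A {1}AE; congr (_ *m diag_mx _ *m _).
apply/matrixP => i j; rewrite !mxE RRe_real//.
by have /mxOverP := re_sp.
Qed.

Lemma char_poly_spectral n (M : 'M[R]_n) (lam : 'rV[R]_n) (U : 'M[C]_n) :
  (map_mx (@conjc R) U)^T *m U = 1%:M ->
  map_mx toC M = (map_mx (@conjc R) U)^T *m diag_mx (map_mx toC lam) *m U ->
  char_poly M = \prod_i ('X - (lam 0 i)%:P).
Proof.
move=> U1 ME.
have inj : injective (map_poly toC) by apply: map_poly_inj.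
apply: inj; rewrite map_char_poly ME rmorph_prod/=.
under [RHS]eq_bigr do rewrite map_polyXsubC.
have Uu : U \in unitmx by have [] := mulmx1_unit U1.
have -> : (map_mx (@conjc R) U)^T = invmx U.
  by rewrite -[LHS]mulmx1 -(mulmxV Uu) mulmxA U1 mul1mx.
transitivity (char_poly (diag_mx (map_mx toC lam))).
  rewrite /char_poly.
  have -> : char_poly_mx (invmx U *m diag_mx (map_mx toC lam) *m U) =
    map_mx polyC (invmx U) *m char_poly_mx (diag_mx (map_mx toC lam)) *m map_mx polyC U.
    have E : map_mx polyC (invmx U) *m 'X%:M *m map_mx polyC U = 'X%:M.
      by rewrite scalar_mxC -mulmxA -map_mxM mulVmx// map_mx1 mulmx1.
    by rewrite /char_poly_mx mulmxBr mulmxBl E !map_mxM.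
  rewrite !det_mulmx mulrC mulrA -det_mulmx -map_mxM mulmxV//.
  by rewrite map_mx1 det1 mul1r.
rewrite char_poly_trig; last exact: diag_mx_is_trig.
by apply: eq_bigr => i _; rewrite !mxE eqxx.
Qed.

Lemma det_spectral n (M : 'M[R]_n) (lam : 'rV[R]_n) (U : 'M[C]_n) :
  (map_mx (@conjc R) U)^T *m U = 1%:M ->
  map_mx toC M = (map_mx (@conjc R) U)^T *m diag_mx (map_mx toC lam) *m U ->
  \det M = \prod_i lam 0 i.
Proof.
move=> U1 ME; apply: (@complexI R).
rewrite -det_map_mx ME !det_mulmx mulrAC -det_mulmx U1 det1 mul1r det_diag.
by rewrite rmorph_prod; apply: eq_bigr => i _; rewrite mxE.
Qed.

(** In a product of linear factors the multiplicity of a root is the number of indices carrying it;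
    exchanging the two sums counts indices instead of roots. *)
Lemma Inert_prod n (M : 'M[R]_n) (lam : 'rV[R]_n) :
  char_poly M = \prod_i ('X - (lam 0 i)%:P) ->
  Inert M = #|[pred i | lam 0 i < 0]|.
Proof.
move=> cE; rewrite /Inert.
have c0 : char_poly M != 0 by rewrite monic_neq0 ?char_poly_monic.
have mupE a : mup a (char_poly M) = (\sum_i ((lam 0 i : R) == a)%R)%N.
  rewrite cE; elim: (index_enum _) => [|i s IH].
    by rewrite !big_nil mupNroot// root1.
  rewrite !big_cons mupM ?polyXsubC_eq0//.
    by rewrite IH -['X - _]expr1 mup_XsubCX; case: eqP.
  by rewrite monic_neq0 ?monic_prod_XsubC.
under eq_bigr do rewrite mupE.
rewrite exchange_big /= -sum1_card [RHS]big_mkcond /=; apply: eq_bigr => i _.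
have lamr : lam 0 i \in rootsR (char_poly M).
  rewrite -roots_on_rootsR// in_itv/= cE rootE horner_prod.
  by rewrite (bigD1 i)//= hornerXsubC subrr mul0r.
have ur : uniq (rootsR (char_poly M)).
  exact: uniq_roots.
rewrite -[i \in _]/(lam 0 i < 0); case: ifPn => l0.
  rewrite big_mkcond (bigD1_seq (lam 0 i))//= l0 eqxx big1// => a.
  by rewrite eq_sym => /negbTE ->; case: ifP.
rewrite big1_seq// => a /andP[a0 _]; case: eqVneq => // E.
by move: l0; rewrite E a0.
Qed.

End Spectral.

(** * Domination of Gaussians, and prefactors of moderate growth *)

Section GaussianWeight.
Variable R : realType.
Local Notation C := R[i].
Local Notation normc := (@Normc.normc R).
Local Notation toC := (real_complex R).

Lemma expR_dot n (e : R) (p : 'cV[R]_n) :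
  expR (- (2^-1 * e * dot p p)) = \prod_i expR (- (2^-1 * e * p i 0 ^+ 2)).
Proof.
rewrite /dot mulr_sumr -sumrN (big_morph expR (@expRD R) (@expR0 R)).
by apply: eq_bigr => i _; rewrite expr2.
Qed.

(** The weight is squared so that one factor can absorb a [mild] prefactor while the other keeps the
    product integrable. *)
Lemma gauss_weight n (e : R) : 0 < e -> exists2 K, 0 <= K &
  (* For c = min(1, e/4) each coordinate satisfies c (1 + x^2) <= 1 + e x^2/4 <= exp(e x^2/4); the
     square of this, inverted, is the bound. *)
  forall p : 'cV[R]_n, expR (- (2^-1 * e * dot p p)) <= K * weight p ^+ 2.
Proof.
move=> e0; pose c := Num.min 1 (e / 4).
have c0 : 0 < c by rewrite /c lt_min ltr01 divr_gt0.
exists (c ^- 2 ^+ n); first by rewrite exprn_ge0// invr_ge0 exprn_ge0// ltW.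
move=> p; rewrite expR_dot -prodrXl -[n in _ ^+ n]card_ord -prodr_const -big_split /=.
apply: ler_prod => i _; rewrite expR_ge0 /=.
set x := p i 0.
have cx0 : 0 < c * (1 + x ^+ 2) by rewrite mulr_gt0// ltr_pwDl// sqr_ge0.
rewrite exprVn -invfM -exprMn expRN lef_pV2 ?posrE ?exprn_gt0 ?expR_gt0//.
have -> : 2^-1 * e * x ^+ 2 = e / 4 * x ^+ 2 + e / 4 * x ^+ 2 by field.
rewrite expRD -expr2 ler_pXn2r ?nnegrE ?expR_ge0 ?(ltW cx0)//.
apply: le_trans (expR_ge1Dx _); rewrite mulrDr mulr1 lerD//.
  by rewrite ge_min lexx.
by rewrite ler_wpM2r ?sqr_ge0// ge_min lexx orbT.
Qed.

Lemma weight_coord n (p : 'cV[R]_n) i : (1 + p i 0 ^+ 2) * weight p <= 1.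
Proof.
rewrite /weight (bigD1 i)//= mulrA mulfV ?mul1r; last first.
  by rewrite gt_eqF// ltr_pwDl// sqr_ge0.
apply: prodr_ile1 => j _; rewrite invr_ge0 invf_le1 ?addr_ge0 ?sqr_ge0//=.
  by rewrite lerDl sqr_ge0.
by rewrite ltr_pwDl// sqr_ge0.
Qed.

Lemma weight_le1 n (p : 'cV[R]_n) : weight p <= 1.
Proof.
apply: prodr_ile1 => j _; rewrite invr_ge0 invf_le1 ?addr_ge0 ?sqr_ge0//=.
  by rewrite lerDl sqr_ge0.
by rewrite ltr_pwDl// sqr_ge0.
Qed.

Lemma weight_le_inv n (p : 'cV[R]_n) (K a : R) : 0 <= K -> a <= K ->
  a * weight p <= K.
Proof.
move=> K0 aK; apply: (le_trans (ler_wpM2r (weight_ge0 p) aK)).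
by rewrite -[leRHS]mulr1 ler_wpM2l// weight_le1.
Qed.

(* In particular all polynomials of degree at most 2. *)
Definition mild n (g : 'cV[R]_n -> C) :=
  cmeas (g \o @vec R n) /\
  exists2 k, 0 <= k & forall p, normc (g p) * weight p <= k.

Lemma mild_cst n (c : C) : mild (fun _ : 'cV[R]_n => c).
Proof.
split; first exact: cmeas_cst.
by exists (normc c) => [|p]; [exact: normc_ge0|apply: weight_le_inv => //; exact: normc_ge0].
Qed.

Lemma mildD n (f g : 'cV[R]_n -> C) : mild f -> mild g -> mild (fun p => f p + g p).
Proof.
move=> [mf [k k0 fk]] [mg [l l0 gl]]; split; first exact: cmeasD.
exists (k + l) => [|p]; first exact: addr_ge0.
apply: (le_trans (ler_wpM2r (weight_ge0 p) (normcD _ _))).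
by rewrite mulrDl lerD.
Qed.

Lemma mildZ n c (f : 'cV[R]_n -> C) : mild f -> mild (fun p => c * f p).
Proof.
move=> [mf [k k0 fk]]; split; first by apply: cmeasM => //; exact: cmeas_cst.
exists (normc c * k) => [|p]; first by rewrite mulr_ge0 ?normc_ge0.
by rewrite Normc.normcM -mulrA ler_wpM2l ?normc_ge0.
Qed.

Lemma mild_sum n (I : finType) (f : I -> 'cV[R]_n -> C) : (forall i, mild (f i)) ->
  mild (fun p => \sum_i f i p).
Proof.
move=> mf; elim: (index_enum I) => [|i s IH].
  rewrite (_ : (fun _ => _) = (fun=> 0)); first exact: mild_cst.
  by apply/funext => p; rewrite big_nil.
rewrite (_ : (fun _ => _) = (fun p => f i p + \sum_(j <- s) f j p)).
  exact: mildD.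
by apply/funext => p; rewrite big_cons.
Qed.

Lemma mild_coordM n (k l : 'I_n) : mild (fun p => toC (p k 0 * p l 0)).
Proof.
split.
  by apply: cmeas_real; apply: measurable_funM; exact: mvec_vec.
exists 1 => // p; rewrite normc_real normrM.
have h : `|p k 0| * `|p l 0| <= 2^-1 * ((1 + p k 0 ^+ 2) + (1 + p l 0 ^+ 2)).
  rewrite -(real_normK (num_real (p k 0))) -(real_normK (num_real (p l 0))).
  have := sqr_ge0 (`|p k 0| - `|p l 0|); nra.
apply: (le_trans (ler_wpM2r (weight_ge0 p) h)).
by have := weight_coord p k; have := weight_coord p l; nra.
Qed.

Lemma mild_coord n (k : 'I_n) : mild (fun p => toC (p k 0)).
Proof.
split; first by apply: cmeas_real; exact: mvec_vec.
exists 1 => // p; rewrite normc_real.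
have h : `|p k 0| <= 1 + p k 0 ^+ 2.
  rewrite -(real_normK (num_real (p k 0))).
  have := sqr_ge0 (`|p k 0| - 1); have := normr_ge0 (p k 0); nra.
by apply: (le_trans (ler_wpM2r (weight_ge0 p) h)); exact: weight_coord.
Qed.

Lemma is_derive_quadratic (a b c : R) :
  is_derive (0 : R) 1 (fun h : R => a + b * h + c * h ^+ 2) b.
Proof. by apply: is_derive_eq; rewrite /GRing.scale/=; ring. Qed.

End GaussianWeight.

(** * The complex Gaussian with deformed phase and its partial derivatives *)

Section GaussianIntegral.
Variable R : realType.
Local Notation C := R[i].
Local Notation normc := (@Normc.normc R).
Local Notation toC := (real_complex R).
Variables (n : nat) (M : 'M[R]_n) (lam : 'rV[R]_n) (U : 'M[C]_n) (e : R).
Hypothesis symM : M^T = M.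
Local Notation Uh := (map_mx (@conjc R) U)^T.
Hypothesis U1 : Uh *m U = 1%:M.
Hypothesis ME : map_mx toC M = Uh *m diag_mx (map_mx toC lam) *m U.
Hypothesis e0 : 0 < e.
Implicit Types (p y : 'cV[R]_n) (s t : R).

(** The integrand of interest is at [s = t = 1], a real Gaussian at [s = t = 0]. The modulus
    involves neither [s] nor [t] nor [y], so one majorant serves all parameters. *)
Definition gauss_exp s t y p : C := cexp (Complex (- (2^-1 * e * dot p p))
  (2^-1 * s * dot (M *m p) p + t * dot y p)).

Lemma normc_gauss_exp s t y p : normc (gauss_exp s t y p) = expR (- (2^-1 * e * dot p p)).
Proof. by rewrite normc_cexp. Qed.

Lemma cmeas_gauss_exp s t y : cmeas (gauss_exp s t y \o @vec R n).
Proof.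
have mv := @mvec_vec R n.
apply: cmeas_cexp; split => /=.
  apply: measurableT_comp => //; apply: measurable_funM => //.
  exact: measurable_dot.
apply: measurable_funD; apply: measurable_funM => //; apply: measurable_dot => //.
exact: mvecM.
Qed.

Lemma mild_gauss_exp_le (g : 'cV[R]_n -> C) : mild g ->
  exists2 K, 0 <= K & forall s t y p, normc (g p * gauss_exp s t y p) <= K * weight p.
Proof.
move=> [mg [k k0 gk]]; have [K K0 eK] := @gauss_weight R n e e0.
exists (k * K) => [|s t y p]; first exact: mulr_ge0.
rewrite Normc.normcM normc_gauss_exp.
apply: (le_trans (ler_wpM2l (normc_ge0 _) (eK p))).
rewrite (_ : normc (g p) * _ = K * weight p * (normc (g p) * weight p)); last by ring.
rewrite (_ : k * K * weight p = K * weight p * k); last by ring.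
by rewrite ler_wpM2l// mulr_ge0// weight_ge0.
Qed.

Lemma cint_mild (g : 'cV[R]_n -> C) s t y : mild g ->
  cint (leb R n) (fun x => g (vec x) * gauss_exp s t y (vec x)).
Proof.
move=> mg; have [K _ gK] := mild_gauss_exp_le mg; have [mg1 _] := mg.
apply: (cint_le _ (rintZ K (rint_weight R n))) => [|x]; last exact: gK.
by apply: cmeasM => //; exact: cmeas_gauss_exp.
Qed.

Definition gint s t y (g : 'cV[R]_n -> C) : C :=
  cintegral (leb R n) (fun x => g (vec x) * gauss_exp s t y (vec x)).

Lemma gintD s t y f g : mild f -> mild g ->
  gint s t y (fun p => f p + g p) = gint s t y f + gint s t y g.
Proof.
move=> mf mg; rewrite /gint -cintegralD; [|exact: cint_mild..].
by apply: eq_cintegral => p; rewrite mulrDl.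
Qed.

Lemma gintZ s t y c f : mild f -> gint s t y (fun p => c * f p) = c * gint s t y f.
Proof.
move=> mf; rewrite /gint -cintegralZ; last exact: cint_mild.
by apply: eq_cintegral => p; rewrite mulrA.
Qed.

Lemma gint_sum s t y (I : finType) (f : I -> 'cV[R]_n -> C) : (forall i, mild (f i)) ->
  gint s t y (fun p => \sum_i f i p) = \sum_i gint s t y (f i).
Proof.
move=> mf; rewrite /gint.
have [_ <-] := cintegral_sum (fun i => cint_mild s t y (mf i)).
by apply: eq_cintegral => p; rewrite mulr_suml.
Qed.

(** This is e I - i s M; the exponent of [gauss_exp] is - <(e I - i s M) p, p>/2 + i t <y, p>. *)
Definition gmx s : 'M[C]_n := (toC e)%:M - Complex 0 s *: map_mx toC M.

Definition gmxV s : 'M[C]_n :=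
  Uh *m diag_mx (\row_j (Complex e (- (s * lam 0 j)))^-1) *m U.

(** The eigenvalues e - i s lam_j have real part e > 0, so they can be inverted for every real
    [s]. *)
Lemma gmxK s : gmx s *m gmxV s = 1%:M.
Proof.
have UUh : U *m Uh = 1%:M by exact: mulmx1C.
have -> : gmx s = Uh *m diag_mx (\row_j Complex e (- (s * lam 0 j))) *m U.
  rewrite /gmx ME (_ : diag_mx (\row_j Complex e (- (s * lam 0 j))) =
     (toC e)%:M - Complex 0 s *: diag_mx (map_mx toC lam)).
    have E c : Uh *m c%:M *m U = c%:M by rewrite scalar_mxC -mulmxA U1 mulmx1.
    by rewrite mulmxBr mulmxBl E -scalemxAr -scalemxAl.
  apply/matrixP => i j; rewrite !mxE; case: eqVneq => _; rewrite ?mulr1n ?mulr0n.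
    by apply: eq_ReIm; rewrite !ReIm /=; ring.
  by rewrite mulr0 subr0.
rewrite /gmxV !mulmxA -[_ *m U *m Uh]mulmxA UUh mulmx1 -[_ *m diag_mx _ *m diag_mx _]mulmxA.
rewrite mulmx_diag (_ : (\row_j _) = const_mx 1).
  by rewrite diag_const_mx mulmx1.
apply/rowP => j; rewrite !mxE mulfV//.
by apply/eqP => -[E _]; move: e0; rewrite E ltxx.
Qed.

(* The logarithmic derivative of [gauss_exp s t y] in the direction [l]. *)
Definition glin s t y l p : C :=
  - (\sum_j gmx s l j * toC (p j 0)) + Complex 0 t * toC (y l 0).

Lemma glinE s t y l p :
  glin s t y l p = Complex (- (e * p l 0)) (s * (M *m p) l 0 + t * y l 0).
Proof.
rewrite /glin; have -> : \sum_j gmx s l j * toC (p j 0) =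
    Complex (e * p l 0) (- (s * (M *m p) l 0)).
  under eq_bigr do rewrite !mxE mulrBl.
  rewrite sumrB (bigD1 l)//= eqxx mulr1n big1 ?addr0; last first.
    by move=> j jl; rewrite eq_sym (negbTE jl) mulr0n mul0r.
  rewrite [(M *m p) _ _]mxE mulr_sumr; apply: eq_ReIm; rewrite !ReIm ?Re_sum ?Im_sum /=.
    rewrite big1 => [|j _]; first by ring.
    by rewrite ?ReIm /=; ring.
  rewrite !mulr0 !mul0r addr0 add0r; congr (- _); apply: eq_bigr => j _.
  by rewrite ?ReIm /=; ring.
by apply: eq_ReIm; rewrite !ReIm /=; ring.
Qed.

Lemma cder_gauss_exp_partial s t y l p :
  cder (fun h : R => gauss_exp s t y (p + h *: delta_mx l 0)) 0
       (glin s t y l p * gauss_exp s t y p).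
Proof.
pose d : 'cV[R]_n := delta_mx l 0.
(* Along a line the exponent is a quadratic polynomial in [h], and its linear coefficient is the
   derivative at 0; the symmetry of [M] merges the two cross terms. *)
have H : cder (fun h : R => Complex (- (2^-1 * e * dot (p + h *: d) (p + h *: d)))
   (2^-1 * s * dot (M *m (p + h *: d)) (p + h *: d) + t * dot y (p + h *: d)))
   0 (glin s t y l p).
  rewrite glinE; split => /=.
    rewrite (_ : (fun h : R => - (2^-1 * e * dot (p + h *: d) (p + h *: d))) =
      fun h : R => - (2^-1 * e * dot p p) +
        (- (e * p l 0)) * h + (- (2^-1 * e * dot d d)) * h ^+ 2).
      exact: is_derive_quadratic.
    apply/funext => h; rewrite !dotlin (dotC d p) dot_delta; by field.
  rewrite (_ : (fun h : R => 2^-1 * s * dot (M *m (p + h *: d)) (p + h *: d) +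
      t * dot y (p + h *: d)) = fun h : R =>
      (2^-1 * s * dot (M *m p) p + t * dot y p) +
      (s * (M *m p) l 0 + t * y l 0) * h + (2^-1 * s * dot (M *m d) d) * h ^+ 2).
    exact: is_derive_quadratic.
  apply/funext => h; rewrite mulmxDr -scalemxAr !dotlin.
  rewrite (dot_mulmx M d p) symM (dotC d (M *m p)) !dot_delta; by field.
have := cder_cexp H.
by rewrite scale0r addr0.
Qed.

Lemma mild_glin s t y l : mild (glin s t y l).
Proof.
apply: mildD; last exact: mild_cst.
have -> : (fun p => - (\sum_j gmx s l j * toC (p j 0))) =
    (fun p => -1 * (\sum_j gmx s l j * toC (p j 0))).
  by apply/funext => p; rewrite mulN1r.
by apply/mildZ/mild_sum => j; apply/mildZ/mild_coord.
Qed.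

End GaussianIntegral.

(** * Moments of the Gaussian and the equation in [t] *)

Section GaussianODE.
Variable R : realType.
Local Notation C := R[i].
Local Notation normc := (@Normc.normc R).
Local Notation toC := (real_complex R).
Variables (n : nat) (M : 'M[R]_n) (lam : 'rV[R]_n) (U : 'M[C]_n) (e : R).
Hypothesis symM : M^T = M.
Local Notation Uh := (map_mx (@conjc R) U)^T.
Hypothesis U1 : Uh *m U = 1%:M.
Hypothesis ME : map_mx toC M = Uh *m diag_mx (map_mx toC lam) *m U.
Hypothesis e0 : 0 < e.
Implicit Types (p y : 'cV[R]_n) (s t : R).
Local Notation gexp := (gauss_exp M e).
Local Notation gint := (gint M e).
Local Notation gmx := (gmx M e).
Local Notation gmxV := (gmxV lam U e).

Lemma delta_le1 (l i : 'I_n) : `|(delta_mx l 0 : 'cV[R]_n) i 0| <= 1.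
Proof. by rewrite mxE; case: (_ && _); rewrite ?normr1 ?normr0. Qed.

Let le_weightl K1 K2 p (a : R) : 0 <= K2 -> a <= K1 * weight p ->
  a <= (K1 + K2) * weight p.
Proof. by move=> K20 /le_trans; apply; rewrite ler_wpM2r ?weight_ge0// lerDl. Qed.

Let le_weightr K1 K2 p (a : R) : 0 <= K1 -> a <= K2 * weight p ->
  a <= (K1 + K2) * weight p.
Proof. by move=> K20 /le_trans; apply; rewrite ler_wpM2r ?weight_ge0// lerDr. Qed.

(* The vanishing integrals of the partial derivatives of [gexp] and of
   [p_k gexp] are linear equations for the first and second moments, which turn
   the derivatives of [gint] in [t] and [s] into multiples of [gint]. *)
Lemma gint_partial0 s t y l : gint s t y (glin M e s t y l) = 0.
Proof.
have [K1 K10 K1P] := mild_gauss_exp_le M e0 (mild_cst n 1).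
have [K2 K20 K2P] := mild_gauss_exp_le M e0 (mild_glin M e s t y l).
apply: (@cintegral_partial R n (delta_mx l 0) (gexp s t y)
  (fun p => glin M e s t y l p * gexp s t y p) (K1 + K2)).
- exact: delta_le1.
- by move=> p; exact: cder_gauss_exp_partial.
- exact: cmeas_gauss_exp.
- by move=> p; apply: le_weightl => //; have := K1P s t y p; rewrite mul1r.
- by move=> p; apply: le_weightr.
Qed.

Lemma gint_partial1 s k l :
  gint s 0 0 (fun p => toC (k == l)%:R + toC (p k 0) * glin M e s 0 0 l p) = 0.
Proof.
have mc : mild (fun p : 'cV[R]_n => toC (p k 0)) by exact: mild_coord.
have mg : mild (fun p => toC (k == l)%:R + toC (p k 0) * glin M e s 0 0 l p).
  apply: mildD; first exact: mild_cst.
  have -> : (fun p => toC (p k 0) * glin M e s 0 0 l p) =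
     (fun p => \sum_j (- gmx s l j) * toC (p k 0 * p j 0)).
    apply/funext => p; rewrite /glin -[Complex 0 0]/(0 : C) mul0r addr0 mulrN mulr_sumr.
    rewrite -sumrN; apply: eq_bigr => j _.
    by rewrite rmorphM /=; ring.
  by apply: mild_sum => j; apply: mildZ; exact: mild_coordM.
have [K1 K10 K1P] := mild_gauss_exp_le M e0 mc.
have [K2 K20 K2P] := mild_gauss_exp_le M e0 mg.
apply: (@cintegral_partial R n (delta_mx l 0) (fun p => toC (p k 0) * gexp s 0 0 p)
  (fun p => (toC (k == l)%:R + toC (p k 0) * glin M e s 0 0 l p) * gexp s 0 0 p)
  (K1 + K2)).
- exact: delta_le1.
- move=> p.
  have H1 : cder (fun h : R => toC ((p + h *: delta_mx l 0) k 0)) 0 (toC (k == l)%:R).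
    apply: cder_real.
    rewrite (_ : (fun h : R => (p + h *: delta_mx l 0) k 0) =
      fun h => p k 0 + (k == l)%:R * h + 0 * h ^+ 2).
      exact: is_derive_quadratic.
    by apply/funext => h; rewrite !mxE eqxx andbT; ring.
  have := cderM H1 (cder_gauss_exp_partial e symM s 0 0 l p).
  by rewrite scale0r addr0 => H; apply: (cder_eq H); ring.
- by apply: cmeasM; [have [] := mc|exact: cmeas_gauss_exp].
- by move=> p; apply: le_weightl.
- by move=> p; apply: le_weightr.
Qed.

Definition gone : 'cV[R]_n -> C := fun=> 1.

(** Row by row, [gint_partial0] says that (e I - i s M) applied to the vector of first moments is i
    t y times the integral; it remains to invert the matrix. *)
Lemma first_moment s t y :
  \col_j gint s t y (fun p => toC (p j 0)) =
  (Complex 0 t * gint s t y gone) *: (gmxV s *m map_mx toC y).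
Proof.
set m := \col_j _.
suff E : gmx s *m m = (Complex 0 t * gint s t y gone) *: map_mx toC y.
  have VK : gmxV s *m gmx s = 1%:M by apply: mulmx1C; exact: gmxK.
  by rewrite -[m]mul1mx -VK -mulmxA E -scalemxAr.
apply/colP => l; rewrite !mxE.
have := gint_partial0 s t y l.
rewrite /glin gintD//; last 2 first.
- have -> : (fun p => - (\sum_j gmx s l j * toC (p j 0))) =
    (fun p => -1 * (\sum_j gmx s l j * toC (p j 0))).
    by apply/funext => p; rewrite mulN1r.
  by apply/mildZ/mild_sum => j; apply/mildZ/mild_coord.
- exact: mild_cst.
have -> : (fun p => - (\sum_j gmx s l j * toC (p j 0))) =
    (fun p => -1 * (\sum_j gmx s l j * toC (p j 0))).
  by apply/funext => p; rewrite mulN1r.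
rewrite [gint s t y (fun p => -1 * _)]gintZ//; last first.
  by apply: mild_sum => j; apply/mildZ/mild_coord.
rewrite gint_sum//; last by move=> j; apply/mildZ/mild_coord.
have -> : (fun _ : 'cV[R]_n => Complex 0 t * toC (y l 0)) =
   (fun p => (Complex 0 t * toC (y l 0)) * gone p).
  by apply/funext => p; rewrite mulr1.
rewrite gintZ//; last exact: mild_cst.
move/eqP; rewrite mulN1r addrC subr_eq0 => /eqP E.
rewrite mulrAC E; apply: eq_bigr => j _.
by rewrite !mxE gintZ//; exact: mild_coord.
Qed.

(** At t = 0, [gint_partial1] says that (e I - i s M) times the matrix of second moments is the
    integral times the identity. *)
Lemma second_moment s :
  \matrix_(k, l) gint s 0 0 (fun p => toC (p k 0 * p l 0)) =
  gint s 0 0 gone *: gmxV s.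
Proof.
set m := \matrix_(k, l) _.
suff E : gmx s *m m = (gint s 0 0 gone)%:M.
  have VK : gmxV s *m gmx s = 1%:M by apply: mulmx1C; exact: gmxK.
  by rewrite -[m]mul1mx -VK -mulmxA E scalar_mxC mul_scalar_mx.
apply/matrixP => l k; rewrite !mxE.
have mj j : mild (fun p : 'cV[R]_n => - gmx s l j * toC (p k 0 * p j 0)).
  by apply: mildZ; exact: mild_coordM.
have := gint_partial1 s k l.
have -> : (fun p => toC (k == l)%:R + toC (p k 0) * glin M e s 0 0 l p) =
   (fun p => toC (k == l)%:R * gone p + \sum_j (- gmx s l j) * toC (p k 0 * p j 0)).
  apply/funext => p; rewrite /glin -[Complex 0 0]/(0 : C) mul0r addr0 mulrN mulr_sumr.
  rewrite -sumrN mulr1; congr (_ + _); apply: eq_bigr => j _.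
  by rewrite rmorphM /=; ring.
rewrite gintD//; last 2 first.
- by apply: mildZ; exact: mild_cst.
- exact: mild_sum.
rewrite gintZ//; last exact: mild_cst.
rewrite gint_sum// => /eqP; rewrite addr_eq0 -sumrN => /eqP E.
rewrite eq_sym -mulr_natl.
have -> : ((k == l)%:R : C) = toC (k == l)%:R by case: eqP.
rewrite E; apply: eq_bigr => j _.
rewrite gintZ//; last exact: mild_coordM.
rewrite [m _ _]mxE mulNr opprK; congr (_ * gint _ _ _ _).
by apply/funext => p; rewrite mulrC.
Qed.

(** Stated for a family [E] so as to serve both for [t] and for [s]. The third hypothesis gives
    [dg p * E r p] the modulus of one fixed Gaussian, a domination uniform in [r]. *)
Lemma cder_gint (dg : 'cV[R]_n -> C) (E : R -> 'cV[R]_n -> C) r :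
  mild dg -> (forall r, cint (leb R n) (fun x => E r (vec x))) ->
  (exists s t y, forall r p, normc (dg p * E r p) = normc (dg p * gexp s t y p)) ->
  (forall r p, cder (E ^~ p) r (dg p * E r p)) ->
  cder (fun r => cintegral (leb R n) (fun x => E r (vec x))) r
       (cintegral (leb R n) (fun x => dg (vec x) * E r (vec x))).
Proof.
move=> md iE [s' [t' [y' nE]]] dE.
have [K K0 KP] := mild_gauss_exp_le M e0 md.
apply: (@cder_cintegral R _ _ (leb R n) (fun r x => E r (vec x))
  (fun r x => dg (vec x) * E r (vec x)) (fun x => K * weight (vec x))) => //.
- exact/rintZ/rint_weight.
- by move=> r' x; rewrite nE; exact: KP.
Qed.

Lemma cint_gauss_exp s t y : cint (leb R n) (fun x => gexp s t y (vec x)).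
Proof.
have := cint_mild M e0 s t y (mild_cst n 1).
by congr cint; apply/funext => x; rewrite mul1r.
Qed.

Lemma gint_gone s t y :
  gint s t y gone = cintegral (leb R n) (fun x => gexp s t y (vec x)).
Proof. by apply: eq_cintegral => x; rewrite mul1r. Qed.

Lemma cder_gauss_exp_affine (a b c : R) r :
  cder (fun r => cexp (Complex a (r * b + c))) r
    (Complex 0 b * cexp (Complex a (r * b + c))).
Proof.
apply: cder_cexp; split => /=; first exact: is_derive_cst.
by apply: is_derive_eq; rewrite /GRing.scale/=; ring.
Qed.

(** The bilinear, not sesquilinear, value y^T (e I - i s M)^-1 y. *)
Definition gkappa s y : C := \sum_l toC (y l 0) * (gmxV s *m map_mx toC y) l 0.

(** Differentiation in t brings down i <y, p>, and [first_moment] turns its integral into i (i t)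
    kappa F. So F' = - t kappa F, and F exp(t^2 kappa/2) is constant. *)
Lemma gint_t s t y :
  gint s t y gone = gint s 0 0 gone * cexp (- (toC (2^-1 * t ^+ 2) * gkappa s y)).
Proof.
have dF r : cder (fun t => gint s t y gone) r (- (toC r * gkappa s y) * gint s r y gone).
  pose dg p : C := Complex 0 (dot y p).
  have dgE : dg = fun p => \sum_l (Complex 0 (y l 0)) * toC (p l 0).
    apply/funext => p; apply: eq_ReIm; rewrite ?Re_sum ?Im_sum /=.
      by rewrite big1// => j _; ring.
    by apply: eq_bigr => j _; ring.
  have md : mild dg.
    by rewrite dgE; apply: mild_sum => l; apply: mildZ; exact: mild_coord.
  have := @cder_gint dg (fun t => gexp s t y) r md (fun t => cint_gauss_exp s t y).
  rewrite (_ : (fun t => cintegral _ _) = (fun t => gint s t y gone)); last first.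
    by apply/funext => t'; rewrite gint_gone.
  move=> H; apply: cder_eq; first apply: H.
  - exists s, 0, y => t' p; rewrite [LHS]Normc.normcM [RHS]Normc.normcM; congr (_ * _).
    exact: etrans (normc_gauss_exp _ _ _ _ _ _) (esym (normc_gauss_exp _ _ _ _ _ _)).
  - move=> t' p; rewrite /gexp.
    have -> : (fun x => cexp (Complex (- (2^-1 * e * dot p p))
        (2^-1 * s * dot (M *m p) p + x * dot y p))) =
      (fun x => cexp (Complex (- (2^-1 * e * dot p p))
        (x * dot y p + 2^-1 * s * dot (M *m p) p))).
      by apply/funext => x; rewrite addrC.
    by rewrite addrC; exact: cder_gauss_exp_affine.
  rewrite -/(gint s r y dg) dgE gint_sum//; last first.
    by move=> l; apply: mildZ; exact: mild_coord.
  rewrite mulNr mulr_sumr mulr_suml -sumrN; apply: eq_bigr => l _.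
  rewrite gintZ//; last exact: mild_coord.
  have := first_moment s r y; move=> /colP/(_ l); rewrite !mxE => ->.
  rewrite -(_ : Complex 0 1 * toC (y l 0) = Complex 0 (y l 0)); last first.
    by apply: eq_ReIm => /=; ring.
  rewrite -(_ : Complex 0 1 * toC r = Complex 0 r); last first.
    by apply: eq_ReIm => /=; ring.
  have i2 : Complex 0 1 * Complex 0 1 = -1 :> C by apply: eq_ReIm => /=; ring.
  set i := Complex 0 1 in i2 *; set z := (\sum_j _).
  rewrite (_ : i * toC (y l 0) * _ = (i * i) * (toC r * (toC (y l 0) * z) * gint s r y gone)).
    by rewrite i2; ring.
  by ring.
pose phi t := gint s t y gone * cexp (toC (2^-1 * t ^+ 2) * gkappa s y).
have dphi r : cder phi r 0.
  have dq : cder (fun t => toC (2^-1 * t ^+ 2) * gkappa s y) r (toC r * gkappa s y).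
    have d1 : cder (fun t => toC (2^-1 * t ^+ 2)) r (toC r).
      apply: cder_real; apply: is_derive_eq; rewrite /GRing.scale/=; by field.
    by apply: cder_eq; [exact: cderM d1 (cder_cst _ _)|rewrite mulr0 addr0].
  by apply: cder_eq; [exact: cderM (dF r) (cder_cexp dq)|cbv beta; ring].
have gt0 : gint s 0 y gone = gint s 0 0 gone.
  rewrite !gint_gone; apply: eq_cintegral => x; congr cexp; congr Complex.
  by rewrite !mul0r.
have := cder0_cst dphi t 0.
rewrite /phi gt0 expr0n mulr0 mul0r cexp0 mulr1 => <-.
by rewrite -mulrA cexpN mulr1.
Qed.

End GaussianODE.

(** * The equation in [s] and the value of the damped Gaussian integral *)

Section GaussianValue.
Variable R : realType.
Local Notation C := R[i].
Local Notation normc := (@Normc.normc R).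
Local Notation toC := (real_complex R).
Variables (n : nat) (M : 'M[R]_n) (lam : 'rV[R]_n) (U : 'M[C]_n) (e : R).
Hypothesis symM : M^T = M.
Local Notation Uh := (map_mx (@conjc R) U)^T.
Hypothesis U1 : Uh *m U = 1%:M.
Hypothesis ME : map_mx toC M = Uh *m diag_mx (map_mx toC lam) *m U.
Hypothesis e0 : 0 < e.
Implicit Types (p y : 'cV[R]_n) (s t : R).
Local Notation gexp := (gauss_exp M e).
Local Notation gint := (gint M e).
Local Notation gmxV := (gmxV lam U e).
Local Notation gone := (@gone R n).

(* A logarithm of prod_j (e - i s lam_j)^(-1/2), on the branch continuous in s. *)
Definition glog s : C := \sum_j Complex (- (4^-1 * ln (e ^+ 2 + (s * lam 0 j) ^+ 2)))
  (2^-1 * atan (s * lam 0 j / e)).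

(** By [mxtrace_gmxV] this is (i/2) tr (M (e I - i s M)^-1), the logarithmic derivative in [s] of
    det (e I - i s M)^(-1/2). *)
Definition gdlog s : C :=
  Complex 0 2^-1 * \sum_j (toC (lam 0 j) * (Complex e (- (s * lam 0 j)))^-1).

Lemma cder_sum (I : finType) (f : I -> R -> C) (df : I -> C) s :
  (forall i, cder (f i) s (df i)) -> cder (fun r => \sum_i f i r) s (\sum_i df i).
Proof.
move=> dfi; elim: (index_enum I) => [|i l IH].
  rewrite big_nil (_ : (fun _ => _) = (fun=> 0)); first exact: cder_cst.
  by apply/funext => r; rewrite big_nil.
rewrite big_cons (_ : (fun _ => _) = (fun r => f i r + \sum_(j <- l) f j r)).
  exact: cderD.
by apply/funext => r; rewrite big_cons.
Qed.

Lemma cder_glog s : cder glog s (gdlog s).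
Proof.
rewrite /gdlog mulr_sumr; apply: cder_sum => j.
set x := lam 0 j.
have d0 : 0 < e ^+ 2 + (s * x) ^+ 2 by rewrite ltr_pwDl ?exprn_gt0// sqr_ge0.
have -> : Complex 0 2^-1 * (toC x * (Complex e (- (s * x)))^-1) =
    Complex (- (2^-1 * s * x ^+ 2 / (e ^+ 2 + (s * x) ^+ 2)))
            (2^-1 * e * x / (e ^+ 2 + (s * x) ^+ 2)).
  by apply: eq_ReIm; rewrite /= sqrrN; field; rewrite gt_eqF.
split => /=.
- have dl := @is_derive1_ln R _ d0.
  have dq : is_derive s 1 (fun r => e ^+ 2 + (r * x) ^+ 2) (2 * s * x ^+ 2).
    by apply: is_derive_eq; rewrite /GRing.scale/=; ring.
  have dc := @is_derive1_comp R (@ln R) (fun r => e ^+ 2 + (r * x) ^+ 2) s _ _ dl dq.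
  have -> : (fun r => - (4^-1 * ln (e ^+ 2 + (r * x) ^+ 2))) =
      - (4^-1 \*: (@ln R \o (fun r => e ^+ 2 + (r * x) ^+ 2))) by [].
  by apply: is_derive_eq; rewrite /GRing.scale/=; field; rewrite gt_eqF.
- have dq : is_derive s 1 (fun r => r * x / e) (x / e).
    by apply: is_derive_eq; rewrite /GRing.scale/=; ring.
  have dc := @is_derive1_comp R (@atan R) (fun r => r * x / e) s _ _ (is_derive1_atan _) dq.
  have -> : (fun r => 2^-1 * atan (r * x / e)) =
      2^-1 \*: (@atan R \o (fun r => r * x / e)) by [].
  apply: is_derive_eq; rewrite /GRing.scale/=; field.
  by rewrite !gt_eqF// -?exprMn; lra.
Qed.

Lemma mxtrace_gmxV s :
  \tr (map_mx toC M *m gmxV s) =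
  \sum_j (toC (lam 0 j) * (Complex e (- (s * lam 0 j)))^-1).
Proof.
have UUh : U *m Uh = 1%:M by exact: mulmx1C.
rewrite ME /gmxV !mulmxA -[_ *m U *m Uh]mulmxA UUh mulmx1 mxtrace_mulC.
rewrite !mulmxA UUh mul1mx mulmx_diag mxtrace_diag.
by apply: eq_bigr => j _; rewrite !mxE.
Qed.

(** Differentiation in s brings down i <M p, p>/2, a combination of second moments; [second_moment]
    collapses its integral to half of i times a trace, that is, to [gdlog] times the integral. *)
Lemma gint_s s : gint s 0 0 gone = gint 0 0 0 gone * cexp (glog s - glog 0).
Proof.
have dF r : cder (fun s => gint s 0 0 gone) r (gdlog r * gint r 0 0 gone).
  pose dg p : C := Complex 0 (2^-1 * dot (M *m p) p).
  have dgE : dg = fun p => \sum_k \sum_l (Complex 0 2^-1 * toC (M k l)) * toC (p l 0 * p k 0).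
    apply/funext => p; rewrite /dg /dot; apply: eq_ReIm.
      rewrite [RHS]Re_sum [RHS]big1// => k _; rewrite Re_sum big1// => l _ /=; ring.
    rewrite [RHS]Im_sum /= mulr_sumr; apply: eq_bigr => k _.
    rewrite [RHS]Im_sum mxE mulr_suml mulr_sumr; apply: eq_bigr => l _ /=; ring.
  have mdd k l : mild (fun p : 'cV[R]_n => (Complex 0 2^-1 * toC (M k l)) * toC (p l 0 * p k 0)).
    by apply: mildZ; exact: mild_coordM.
  have md : mild dg.
    by rewrite dgE; apply: mild_sum => k; apply: mild_sum => l.
  have := @cder_gint R n M e e0 dg (fun s => gexp s 0 0) r md (fun s => cint_gauss_exp M e0 s 0 0).
  rewrite (_ : (fun t => cintegral _ _) = (fun s => gint s 0 0 gone)); last first.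
    by apply/funext => s'; rewrite gint_gone.
  move=> H; apply: cder_eq; first apply: H.
  - exists 0, 0, 0 => s' p; rewrite [LHS]Normc.normcM [RHS]Normc.normcM; congr (_ * _).
    exact: etrans (normc_gauss_exp _ _ _ _ _ _) (esym (normc_gauss_exp _ _ _ _ _ _)).
  - move=> s' p; rewrite /gauss_exp.
    have -> : (fun x => cexp (Complex (- (2^-1 * e * dot p p))
        (2^-1 * x * dot (M *m p) p + 0 * dot 0 p))) =
      (fun x => cexp (Complex (- (2^-1 * e * dot p p))
        (x * (2^-1 * dot (M *m p) p) + 0))).
      by apply/funext => x; congr cexp; congr Complex; ring.
    have -> : 2^-1 * s' * dot (M *m p) p + 0 * dot 0 p =
        s' * (2^-1 * dot (M *m p) p) + 0 by ring.
    exact: cder_gauss_exp_affine.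
  rewrite -/(gint r 0 0 dg) dgE gint_sum//; last by move=> k; apply: mild_sum => l.
  rewrite /gdlog -mxtrace_gmxV -mulrA mulr_suml mulr_sumr; apply: eq_bigr => k _.
  rewrite gint_sum// mxE mulr_suml mulr_sumr; apply: eq_bigr => l _.
  rewrite gintZ//; last exact: mild_coordM.
  have := second_moment symM U1 ME e0 r => /matrixP/(_ l k); rewrite mxE => ->.
  by rewrite [(map_mx _ M) _ _]mxE mxE; ring.
pose phi s := gint s 0 0 gone * cexp (- glog s).
have dphi r : cder phi r 0.
  have dN : cder (fun s => - glog s) r (- gdlog r).
    have -> : (fun s => - glog s) = (fun s => -1 * glog s).
      by apply/funext => x; rewrite mulN1r.
    by apply: cder_eq; [exact: cderM (cder_cst (-1) r) (cder_glog r)|cbv beta; ring].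
  by apply: cder_eq; [exact: cderM (dF r) (cder_cexp dN)|cbv beta; ring].
have := cder0_cst dphi s 0; rewrite /phi => E.
by rewrite cexpD -[LHS]mulr1 -(cexpN (glog s)) mulrCA E; ring.
Qed.

Lemma gint_0 : gint 0 0 0 gone = toC (Num.sqrt (2 * pi / e) ^+ n).
Proof.
rewrite gint_gone; have E p : gexp 0 0 0 p = toC (expR (- (2^-1 * e * dot p p))).
  by rewrite /gauss_exp mulr0 !mul0r addr0 /cexp expi0 mulr1.
rewrite (eq_cintegral _ (G := fun x => toC (expR (- (2^-1 * e * dot (vec x) (vec x)))))).
  2: by move=> x; exact: E.
apply: eq_ReIm => /=; last by rewrite /Rintegral integral0.
rewrite /Rintegral.
under eq_integral do rewrite expR_dot.
have mg : measurable_fun setT (fun x : R => expR (- (2^-1 * e * x ^+ 2))).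
  apply: measurableT_comp => //; apply: measurableT_comp => //.
  by apply: measurable_funM => //; exact: measurable_funX.
by rewrite (integral_leb_prod n mg (fun x => expR_ge0 _) (gauss1 e0)).
Qed.

Lemma cexp_sum (I : finType) (f : I -> C) : cexp (\sum_i f i) = \prod_i cexp (f i).
Proof. by apply: (big_morph _ (@cexpD R) (@cexp0 R)). Qed.

Lemma gint_value y :
  gint 1 1 y gone = toC (Num.sqrt (2 * pi) ^+ n) * cexp (glog 1) *
    cexp (- (toC 2^-1 * gkappa lam U e 1 y)).
Proof.
rewrite (gint_t symM U1 ME e0) gint_s gint_0 expr1n mulr1; congr (_ * _).
rewrite cexpD [cexp _ * _]mulrC mulrA; congr (_ * _).
(* At s = 0 every arctangent vanishes, and this real factor cancels the power of [e] in [gint_0]. *)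
have -> : cexp (- glog 0) = toC (Num.sqrt e ^+ n).
  rewrite /glog -sumrN cexp_sum rmorphXn/= -[n in RHS]card_ord -prodr_const.
  apply: eq_bigr => j _; rewrite mul0r expr0n addr0 mul0r atan0 mulr0.
  rewrite /cexp /= oppr0 expi0 mulr1 opprK; congr toC.
  rewrite lnXn// -[ln e *+ 2]mulr_natl mulrA (_ : 4^-1 * 2 = 2^-1); last by field.
  by rewrite -powR12_sqrt ?(ltW e0)// /powR gt_eqF.
rewrite -rmorphM/= -exprMn; congr (toC (_ ^+ _)).
rewrite -sqrtrM; first by rewrite divfK// gt_eqF.
by rewrite divr_ge0 ?(ltW e0)// mulr_ge0// ltW// pi_gt0.
Qed.

Definition gcoef y j : R := normc ((U *m map_mx toC y) j 0) ^+ 2.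

Lemma gkappaE s y :
  gkappa lam U e s y = \sum_j toC (gcoef y j) * (Complex e (- (s * lam 0 j)))^-1.
Proof.
set z := U *m map_mx toC y.
(* Since y is real, y^T times the adjoint of U is the adjoint of U y; this is how squared moduli
   appear although the form is bilinear. *)
have zh : (map_mx toC y)^T *m Uh = (map_mx (@conjc R) z)^T.
  rewrite /z map_mxM trmx_mul; congr (_ *m _); apply/matrixP => i j.
  by rewrite !mxE; apply: eq_ReIm; rewrite ?ReIm /= ?oppr0.
have -> : gkappa lam U e s y = ((map_mx toC y)^T *m (gmxV s *m map_mx toC y)) 0 0.
  by rewrite mxE; apply: eq_bigr => l _; rewrite !mxE.
rewrite /gmxV !mulmxA zh -!mulmxA /gcoef -/z; move: z {zh} => z.
rewrite mxE; apply: eq_bigr => j _.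
rewrite mul_diag_mx !mxE mulrCA [RHS]mulrC; congr (_ * _).
rewrite normc_sqrtE sqr_sqrtr ?addr_ge0 ?sqr_ge0//.
by apply: eq_ReIm; rewrite !ReIm; rewrite /=; ring.
Qed.

(** Consequently the factor of the Gaussian integral that depends on y has modulus at most 1, for
    every [e]. *)
Lemma Re_gkappa_ge0 s y : 0 <= complex.Re (gkappa lam U e s y).
Proof.
rewrite gkappaE Re_sum; apply: sumr_ge0 => j _; rewrite Re_M /= mul0r subr0.
rewrite mulr_ge0 ?exprn_ge0 ?normc_ge0// divr_ge0 ?(ltW e0)//.
by rewrite addr_ge0 ?sqr_ge0.
Qed.

End GaussianValue.

(** * Limits of complex sequences and the damping parameters *)

Section ComplexLimits.
Variable R : realType.
Local Notation C := R[i].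
Implicit Types (u v : nat -> C).

Lemma ccvg_cst (c : C) : ccvg (fun=> c) c.
Proof. by split; exact: cvg_cst. Qed.

Lemma ccvgD u v a b : ccvg u a -> ccvg v b -> ccvg (fun k => u k + v k) (a + b).
Proof.
move=> [? ?] [? ?]; split; rewrite !ReIm.
  by under eq_fun do rewrite Re_D; exact: cvgD.
by under eq_fun do rewrite Im_D; exact: cvgD.
Qed.

Lemma ccvgM u v a b : ccvg u a -> ccvg v b -> ccvg (fun k => u k * v k) (a * b).
Proof.
move=> [? ?] [? ?]; split; rewrite !ReIm.
  by under eq_fun do rewrite Re_M; apply: cvgB; exact: cvgM.
by under eq_fun do rewrite Im_M; apply: cvgD; exact: cvgM.
Qed.

Lemma ccvg_sum (I : finType) (f : I -> nat -> C) (a : I -> C) :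
  (forall i, ccvg (f i) (a i)) -> ccvg (fun k => \sum_i f i k) (\sum_i a i).
Proof.
move=> fa; elim: (index_enum I) => [|i s IH].
  rewrite big_nil (_ : (fun _ => _) = (fun=> 0)); first exact: ccvg_cst.
  by apply/funext => k; rewrite big_nil.
rewrite big_cons (_ : (fun _ => _) = (fun k => f i k + \sum_(j <- s) f j k)).
  exact: ccvgD.
by apply/funext => k; rewrite big_cons.
Qed.

Lemma ccvg_cexp u a : ccvg u a -> ccvg (fun k => cexp (u k)) (cexp a).
Proof.
move=> [uR uI]; apply: ccvgM; split => /=.
- exact: (cvg_comp _ _ uR (@continuous_expR R _)).
- exact: cvg_cst.
- exact: (cvg_comp _ _ uI (@continuous_cos R _)).
- exact: (cvg_comp _ _ uI (@continuous_sin R _)).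
Qed.

Lemma ccvg_unique u a b : ccvg u a -> ccvg u b -> a = b.
Proof.
move=> [aR aI] [bR bI]; apply: eq_ReIm.
  exact: (cvg_unique _ aR bR).
exact: (cvg_unique _ aI bI).
Qed.

Definition epsk (k : nat) : R := k.+1%:R^-1.

Lemma epsk_gt0 k : 0 < epsk k.
Proof. by rewrite invr_gt0. Qed.

Lemma cvg_epsk : epsk @ \oo --> (0 : R).
Proof. exact: cvg_harmonic. Qed.

Lemma cvg_epsk_sqrD (x : R) : (fun k => epsk k ^+ 2 + x ^+ 2) @ \oo --> x ^+ 2.
Proof.
rewrite -[X in _ --> X]add0r; apply: cvgD; last exact: cvg_cst.
rewrite (_ : (fun k => epsk k ^+ 2) = (fun k => epsk k * epsk k)).
  by rewrite -(mulr0 0); apply: cvgM; exact: cvg_epsk.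
by apply/funext => k; rewrite expr2.
Qed.

End ComplexLimits.

(** * The Gaussian integral as the damping tends to 0 *)

Section GaussianLimit.
Variable R : realType.
Local Notation C := R[i].
Local Notation normc := (@Normc.normc R).
Local Notation toC := (real_complex R).
Local Notation eps := (@epsk R).
Variables (n : nat) (M : 'M[R]_n).
Hypothesis symM : M^T = M.
Hypothesis detM : \det M != 0.

(** Here the signs of the eigenvalues, and with them the inertia, enter the phase. *)
Lemma cvg_atan_epsk (x : R) : x != 0 ->
  (fun k => atan (x / eps k)) @ \oo --> (if 0 < x then pi / 2 else - (pi / 2)).
Proof.
have P (z : R) : 0 < z -> (fun k => atan (z / eps k)) @ \oo --> pi / 2.
  move=> z0; apply: (cvg_comp (fun k => z / eps k) (@atan R)); last exact: cvgy_atan.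
  rewrite (_ : (fun k => z / eps k) = (fun k => k.+1%:R * z)); last first.
    by apply/funext => k; rewrite /epsk invrK mulrC.
  apply: (cvg_comp (fun k => k.+1%:R) (fun r : R => r * z)); last first.
    exact: (@gt0_cvgMly R +oo _ z id z0 cvg_id).
  apply: (cvg_comp (fun k => k.+1) (fun k : nat => k%:R : R)); last exact: cvgr_idn.
  by under eq_fun do rewrite -addn1; exact: cvg_addnr.
move=> x0; case: ltP => [|xle0]; first exact: P.
rewrite (_ : (fun _ => _) = (fun k => - atan (- x / eps k))).
  by apply: cvgN; apply: P; rewrite oppr_gt0 lt_neqAle x0.
by apply/funext => k; rewrite mulNr atanN opprK.
Qed.

(** The limit is expressed through [M] alone, independently of the diagonalization. The bound
    uniform in [k] and [y] is for dominated convergence in the remaining variables. *)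
Lemma gauss_limit : exists G : nat -> 'cV[R]_n -> C,
  [/\ forall k y, G k y = cintegral (leb R n) (fun x => gauss_exp M (eps k) 1 1 y (vec x)),
      exists K, forall k y, normc (G k y) <= K &
      forall y, ccvg (G ^~ y) (toC (Num.sqrt (2 * pi) ^+ n / Num.sqrt `|\det M|) *
        expi (pi / 4 * (n%:R - 2 * (Inert M)%:R)) *
        expi (- (2^-1 * dot (invmx M *m y) y)))].
Proof.
have [lam [U [U1 ME]]] := spectral_symmetric symM.
have cE := char_poly_spectral U1 ME.
have dE := det_spectral U1 ME.
have lam0 j : lam 0 j != 0.
  by apply: contra detM => /eqP l0; rewrite dE (bigD1 j)//= l0 mul0r.
have l2 j : 0 < lam 0 j ^+ 2 by rewrite lt_def sqr_ge0 sqrf_eq0 lam0.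
exists (fun k y => cintegral (leb R n) (fun x => gauss_exp M (eps k) 1 1 y (vec x))).
have V k y := gint_value symM U1 ME (epsk_gt0 R k) y.
have GE k y : cintegral (leb R n) (fun x => gauss_exp M (eps k) 1 1 y (vec x)) =
    toC (Num.sqrt (2 * pi) ^+ n) * cexp (glog lam (eps k) 1) *
    cexp (- (toC 2^-1 * gkappa lam U (eps k) 1 y)).
  by rewrite -V gint_gone.
have UUh : U *m (map_mx (@conjc R) U)^T = 1%:M by exact: mulmx1C.
split => //.
(* The bound is the modulus at e = 0: each (e^2 + lam_j^2)^(-1/4) decreases in e, and the last
   exponential has modulus at most 1. *)
- exists (Num.sqrt (2 * pi) ^+ n * expR (\sum_j - (4^-1 * ln (lam 0 j ^+ 2)))) => k y.
  rewrite GE Normc.normcM Normc.normcM !normc_cexp normc_real ger0_norm; last first.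
    by rewrite exprn_ge0// sqrtr_ge0.
  rewrite -[leRHS]mulr1; apply: ler_pM.
  + by rewrite mulr_ge0 ?expR_ge0// exprn_ge0// sqrtr_ge0.
  + exact: expR_ge0.
  + rewrite ler_wpM2l ?exprn_ge0 ?sqrtr_ge0// ler_expR /glog Re_sum.
    apply: ler_sum => j _; rewrite /= lerN2 ler_wpM2l ?invr_ge0// ler_ln ?posrE//.
      by rewrite mul1r lerDr sqr_ge0.
    by rewrite mul1r ltr_pwDr// sqr_ge0.
  + rewrite -expR0 ler_expR Re_N Re_M /= mul0r subr0 oppr_le0 mulr_ge0 ?invr_ge0//.
    by apply: Re_gkappa_ge0; exact: epsk_gt0.
- move=> y.
  have -> : (fun k => cintegral (leb R n) (fun x => gauss_exp M (eps k) 1 1 y (vec x))) =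
     (fun k => toC (Num.sqrt (2 * pi) ^+ n) * cexp (glog lam (eps k) 1) *
        cexp (- (toC 2^-1 * gkappa lam U (eps k) 1 y))) by apply/funext => k.
  apply: ccvgM.
  + have toCM (a b : R) : toC (a * b) = toC a * toC b by exact: rmorphM.
    rewrite toCM -[X in ccvg _ X]mulrA; apply: ccvgM; first exact: ccvg_cst.
    have cl : ccvg (fun k => glog lam (eps k) 1) (\sum_j
        Complex (- (4^-1 * ln (lam 0 j ^+ 2)))
                (2^-1 * (if 0 < lam 0 j then pi / 2 else - (pi / 2)))).
      apply: ccvg_sum => j; split => /=.
        apply: cvgN; apply: cvgM; first exact: cvg_cst.
        rewrite mul1r.
        apply: (cvg_comp (fun k => eps k ^+ 2 + lam 0 j ^+ 2) (@ln R)).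
          exact: cvg_epsk_sqrD.
        exact: continuous_ln (l2 j).
      apply: cvgM; first exact: cvg_cst.
      by rewrite mul1r; exact: cvg_atan_epsk.
    have := ccvg_cexp cl; congr ccvg.
    rewrite cexp_sum (_ : toC (Num.sqrt `|\det M|)^-1 =
        \prod_j toC (expR (- (4^-1 * ln (lam 0 j ^+ 2))))); last first.
      rewrite dE -rmorph_prod/=; congr toC.
      rewrite (big_morph (fun x : R => (Num.sqrt `|x|)^-1) (id1 := 1) (op1 := *%R)).
      + apply: eq_bigr => j _; rewrite -[lam 0 j ^+ 2]real_normK ?num_real//.
        rewrite lnXn ?normr_gt0// -[ln _ *+ 2]mulr_natl mulrA.
        rewrite (_ : 4^-1 * 2 = 2^-1); last by field.
        rewrite expRN; congr (_^-1).
        by rewrite -powR12_sqrt// /powR normr_eq0 (negbTE (lam0 j)).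
      + by move=> a b; rewrite normrM sqrtrM// invfM.
      + by rewrite normr1 sqrtr1 invr1.
    (* Each positive eigenvalue contributes pi/4 and each negative one - pi/4; none is 0. *)
    rewrite (_ : pi / 4 * _ = \sum_j 2^-1 * (if 0 < lam 0 j then pi / 2 else - (pi / 2)));
        last first.
      have e1 : n%:R = \sum_(j < n) 1 :> R by rewrite sumr_const card_ord.
      have e2 : #|[pred i | lam 0 i < 0]|%:R = \sum_j (lam 0 j < 0)%R%:R :> R.
        rewrite -sum1_card natr_sum [LHS]big_mkcond; apply: eq_bigr => j _ /=.
        by rewrite -[j \in _]/(lam 0 j < 0); case: ifP.
      rewrite (Inert_prod cE) e1 e2 mulr_sumr -sumrB mulr_sumr; apply: eq_bigr => j _.
      by case: ltgtP (lam0 j) => // _ _ /=; field.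
    by rewrite expi_sum -big_split /=; apply: eq_bigr.
  + have -> : expi (- (2^-1 * dot (invmx M *m y) y)) =
       cexp (- (toC 2^-1 * Complex 0 (dot (invmx M *m y) y))).
      by rewrite /cexp !ReIm /= !mul0r mulr0 addr0 subr0 oppr0 expR0 mul1r.
    apply: ccvg_cexp; rewrite -[X in ccvg _ X]mulN1r.
    under eq_fun do rewrite -mulN1r.
    do 2! (apply: ccvgM; first exact: ccvg_cst).
    have -> : Complex 0 (dot (invmx M *m y) y) = gkappa lam U 0 1 y.
      have Munit : M \in unitmx by rewrite unitmxE unitfE.
      (* The spectral formula for the inverse still makes sense at e = 0 because no eigenvalue
         vanishes, and there it is the inverse of - i M. *)
      have E : gmxV lam U 0 1 = Complex 0 1 *: map_mx toC (invmx M).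
        apply: (@row_free_inj _ _ _ _ (map_mx toC M)).
          by rewrite row_free_unit map_unitmx.
        rewrite /= -scalemxAl -map_mxM mulVmx// map_mx1.
        pose D := diag_mx (\row_j (Complex 0 (- (1 * lam 0 j)))^-1) : 'M[C]_n.
        have DD : D *m diag_mx (map_mx toC lam) = (Complex 0 1)%:M.
          rewrite /D mulmx_diag (_ : (\row_j _) = const_mx (Complex 0 1)).
            by rewrite diag_const_mx.
          apply/rowP => j; rewrite !mxE; apply: eq_ReIm => /=; field; exact: lam0.
        rewrite /gmxV -/D ME -!mulmxA [U *m (_ *m (_ *m U))]mulmxA UUh mul1mx.
        by rewrite [D *m (_ *m _)]mulmxA DD mul_scalar_mx -scalemxAr U1.
      rewrite /gkappa E; apply: eq_ReIm.
        rewrite Re_sum big1// => l _.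
        by rewrite -scalemxAl -map_mxM mxE [map_mx _ _ _ _]mxE /=; ring.
      rewrite Im_sum /dot; apply: eq_bigr => l _.
      by rewrite -scalemxAl -map_mxM [RHS]/= !mxE /=; ring.
    under eq_fun do rewrite gkappaE; rewrite gkappaE.
    apply: ccvg_sum => j; apply: ccvgM; first exact: ccvg_cst.
    rewrite !mul1r; set x := lam 0 j.
    have dk : (fun k => (eps k ^+ 2 + x ^+ 2)^-1) @ \oo --> (x ^+ 2)^-1.
      apply: cvgV; first by rewrite sqrf_eq0 lam0.
      exact: cvg_epsk_sqrD.
    split; rewrite /= sqrrN expr0n add0r.
      by apply: cvgM => //; exact: cvg_epsk.
    by apply: cvgN; apply: cvgM => //; exact: cvg_cst.
Qed.

End GaussianLimit.

(** * Matrix identities for a free symplectic matrix *)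

Section FreeSymplectic.
Variable R : realType.
Variables (n : nat) (P L Q : 'M[R]_n).
Hypothesis hP : P^T = P.
Hypothesis hQ : Q^T = Q.
Hypothesis hL : \det L != 0.
Local Notation S := (free_symplectic P L Q).
Local Notation K := (Wxx P L Q).

Let Lu : L \in unitmx.
Proof. by rewrite unitmxE unitfE. Qed.

(** In the midpoint variables, [wmid] carries the mixed term of W and [wsum] the term in x0 alone;
    see [Wform_midpoint]. *)
Definition wmid : 'M[R]_n := 2^-1 *: (P - Q - L + L^T).
Definition wsum : 'M[R]_n := P + Q + L + L^T.

(** If S maps (x', p') to (x, p), this matrix maps (x', p') to (x', x), the variables of W. As a
    common right factor of S - I and S + I it cancels in [M_]. *)
Let F2 : 'M[R]_(n + n) := block_mx 1%:M 0 (invmx L *m Q) (invmx L).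

Lemma free_symplecticB1 :
  S - 1%:M = block_mx (- 1%:M) 1%:M (Q - L^T) (P - L) *m F2.
Proof.
rewrite mulmx_block !mulmx0 !mul1mx !mulmx1 !add0r (scalar_mx_block n n 1).
rewrite opp_block_mx add_block_mx !oppr0 !addr0.
congr block_mx; first by rewrite addrC.
  rewrite mulmxBl !mulmxA mulmxV// mul1mx; move: (_ *m Q) => X.
  by apply/matrixP => i j; rewrite !mxE; ring.
by rewrite mulmxBl mulmxV.
Qed.

Lemma free_symplecticD1 :
  S + 1%:M = block_mx 1%:M 1%:M (- (L^T + Q)) (P + L) *m F2.
Proof.
rewrite mulmx_block !mulmx0 !mul1mx !mulmx1 !add0r (scalar_mx_block n n 1).
rewrite add_block_mx !addr0.
congr block_mx; first by rewrite addrC.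
  rewrite mulmxDl !mulmxA mulmxV// mul1mx; move: (_ *m Q) => X.
  by apply/matrixP => i j; rewrite !mxE; ring.
by rewrite mulmxDl mulmxV.
Qed.

Lemma det_free_symplecticB1 : \det (S - 1%:M) = (-1) ^+ n * (\det L)^-1 * \det K.
Proof.
rewrite free_symplecticB1 det_mulmx.
have -> : \det F2 = (\det L)^-1 by rewrite /F2 det_lblock det1 mul1r det_inv.
(* Adding the first block column to the second clears the upper right block and leaves (Q - L^T) +
   (P - L) = K in the lower right one. *)
have := det_mulmx (block_mx (- 1%:M) 1%:M (Q - L^T) (P - L)) (block_mx 1%:M 1%:M 0 1%:M : 'M[R]_(n + n)).
rewrite det_ublock !det1 !mulr1 => <-.
rewrite mulmx_block !mulmx0 !mulmx1 !addr0 addNr det_lblock.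
rewrite -scaleN1r detZ det1 mulr1 mulrAC; congr (_ * \det _).
by rewrite /Wxx; apply/matrixP => i j; rewrite !mxE; ring.
Qed.

Hypothesis hK : \det K != 0.
Local Notation H := (invmx K).

Let Ku : K \in unitmx.
Proof. by rewrite unitmxE unitfE. Qed.

Lemma Wxx_sym : K^T = K.
Proof. by apply/matrixP => i j; rewrite !mxE -{1}hP -{1}hQ !mxE; ring. Qed.

Lemma invWxx_sym : H^T = H.
Proof. by rewrite trmx_inv Wxx_sym. Qed.

Lemma wmidT : wmid^T = 2^-1 *: (P - Q - L^T + L).
Proof. by apply/matrixP => i j; rewrite !mxE -{1}hP -{1}hQ !mxE; ring. Qed.

(** Rather than inverting S - I, one checks that the claimed matrix times S - I is J (S + I)/2. *)
Lemma M_free_symplectic : \det (S - 1%:M) != 0 ->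
  M_ S = block_mx (4^-1 *: wsum - wmid^T *m H *m wmid) (wmid^T *m H) (H *m wmid) (- H).
Proof.
move=> dS; set N := block_mx _ _ _ _.
have Su : S - 1%:M \in unitmx by rewrite unitmxE unitfE.
suff E : N *m (S - 1%:M) = 2^-1 *: (Jmx R n *m (S + 1%:M)).
  by rewrite /M_ scalemxAl -E mulmxK.
rewrite free_symplecticB1 free_symplecticD1 !mulmxA scalemxAl.
congr (_ *m _).
(* The lower blocks of the left factor of S - I are K/2 - D and K/2 + D, so multiplying them by the
   inverse of K leaves only terms in D. *)
have e1 : wmid + (Q - L^T) = 2^-1 *: K.
  by apply/matrixP => i j; rewrite !mxE; field.
have e2 : P - L - wmid = 2^-1 *: K.
  by apply/matrixP => i j; rewrite !mxE; field.
rewrite /N /Jmx !mulmx_block !mul0mx !mulmx1 !mul1mx !mulNmx !add0r !addr0.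
rewrite !mulmxN ?mulmx1 ?mul1mx scale_block_mx.
have E1 : wmid^T *m H *m (Q - L^T) = 2^-1 *: wmid^T - wmid^T *m H *m wmid.
  have -> : Q - L^T = 2^-1 *: K - wmid by rewrite -e1; apply/matrixP => i j; rewrite !mxE; ring.
  by rewrite mulmxBr -scalemxAr -[wmid^T *m H *m K]mulmxA mulVmx// mulmx1.
have E2 : wmid^T *m H *m (P - L) = 2^-1 *: wmid^T + wmid^T *m H *m wmid.
  have -> : P - L = 2^-1 *: K + wmid by rewrite -e2; apply/matrixP => i j; rewrite !mxE; ring.
  by rewrite mulmxDr -scalemxAr -[wmid^T *m H *m K]mulmxA mulVmx// mulmx1.
have E3 : H *m (Q - L^T) = 2^-1 *: 1%:M - H *m wmid.
  have -> : Q - L^T = 2^-1 *: K - wmid by rewrite -e1; apply/matrixP => i j; rewrite !mxE; ring.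
  by rewrite mulmxBr -scalemxAr mulVmx.
have E4 : H *m (P - L) = 2^-1 *: 1%:M + H *m wmid.
  have -> : P - L = 2^-1 *: K + wmid by rewrite -e2; apply/matrixP => i j; rewrite !mxE; ring.
  by rewrite mulmxDr -scalemxAr mulVmx.
rewrite E1 E2 E3 E4; move: (_ *m wmid) (_ *m wmid) => X Y; rewrite wmidT /wsum.
by congr block_mx; apply/matrixP => i j; rewrite !mxE; field.
Qed.

Let dotH u v : dot (H *m u) v = dot (H *m v) u.
Proof. by rewrite dot_mulmx invWxx_sym dotC. Qed.

Lemma quadratic_M_free_symplectic (x0 p0 : 'cV[R]_n) : \det (S - 1%:M) != 0 ->
  2^-1 * dot (M_ S *m col_mx x0 p0) (col_mx x0 p0) =
  8^-1 * dot (wsum *m x0) x0 -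
  2^-1 * dot (H *m (p0 - wmid *m x0)) (p0 - wmid *m x0).
Proof.
move=> dS; rewrite M_free_symplectic// mul_block_col dot_col_mx.
rewrite mulmxBl -scalemxAl !mulmxDr !mulmxN !mulNmx -!mulmxA !dotlin.
rewrite !(dot_mulmx wmid^T) trmxK.
set v := wmid *m x0; rewrite (dotH p0 v).
by field.
Qed.

Lemma Wform_midpoint (x x0 : 'cV[R]_n) :
  let y := x - 2^-1 *: x0 in
  Wform P L Q x (x - x0) =
  8^-1 * dot (wsum *m x0) x0 + dot (wmid *m x0) y + 2^-1 * dot (K *m y) y.
Proof.
move=> y.
have -> : x - x0 = y - 2^-1 *: x0.
  by apply/matrixP => i j; rewrite !mxE; field.
have -> : x = y + 2^-1 *: x0 by rewrite /y subrK.
move: y => y.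
rewrite /Wform /wsum /wmid /Wxx -!scalemxAl !mulmxDl !mulNmx !mulmxDr !mulmxN -!scalemxAr !dotlin.
rewrite !(dot_mulmx L^T) trmxK.
have dP u v : dot (P *m u) v = dot (P *m v) u by rewrite dot_mulmx hP dotC.
have dQ u v : dot (Q *m u) v = dot (Q *m v) u by rewrite dot_mulmx hQ dotC.
rewrite (dP y x0) (dQ y x0) (dotC x0 (L *m x0)) (dotC y (L *m y)) (dotC x0 (L *m y)).
by field.
Qed.

End FreeSymplectic.

(** * Signs, powers of i, and the parity of the argument *)

Section Phase.
Variable R : realType.
Local Notation toC := (real_complex R).

(** The eigenvalues of - K^-1 are - 1/lam_j, so each index is negative for exactly one of the two
    matrices. *)
Lemma Inert_oppV n (K : 'M[R]_n) : K^T = K -> \det K != 0 ->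
  (Inert (- invmx K) + Inert K)%N = n.
Proof.
move=> symK dK.
have [lam [U [U1 KE]]] := spectral_symmetric symK.
have dE := det_spectral U1 KE.
have lam0 j : lam 0 j != 0.
  by apply: contra dK => /eqP l0; rewrite dE (bigD1 j)//= l0 mul0r.
have UUh : U *m (map_mx (@conjc R) U)^T = 1%:M by exact: mulmx1C.
pose mu : 'rV[R]_n := \row_j (- (lam 0 j)^-1).
have HE : map_mx toC (- invmx K) = (map_mx (@conjc R) U)^T *m diag_mx (map_mx toC mu) *m U.
  have Ku : K \in unitmx by rewrite unitmxE unitfE.
  apply: (@row_free_inj _ _ _ _ (map_mx toC K)).
    by rewrite row_free_unit map_unitmx.
  rewrite /= -map_mxM mulNmx mulVmx//.
  rewrite KE -!mulmxA [U *m (_ *m (_ *m U))]mulmxA UUh mul1mx [diag_mx _ *m (_ *m _)]mulmxA.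
  rewrite mulmx_diag (_ : (\row_j _) = const_mx (-1)).
    rewrite diag_const_mx mul_scalar_mx -scalemxAr U1 scaleN1r.
    by rewrite map_mxN map_mx1.
  by apply/rowP => j; rewrite !mxE -rmorphM mulNr mulVf// rmorphN1.
rewrite (Inert_prod (char_poly_spectral U1 KE)) (Inert_prod (char_poly_spectral U1 HE)).
rewrite -[RHS]card_ord -(cardC [pred i | lam 0 i < 0]) addnC; congr (_ + _)%N.
apply: eq_card => j; rewrite !inE mxE oppr_lt0 invr_gt0.
by case: ltgtP (lam0 j).
Qed.

Lemma mulr_lt0_addb (a b : R) : a != 0 -> b != 0 ->
  (a * b < 0) = (a < 0) (+) (b < 0).
Proof.
move=> a0 b0; case: (ltgtP a 0) a0 => //= ha _.
  by rewrite nmulr_rlt0// ltNge le_eqVlt (negbTE b0).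
by rewrite pmulr_rlt0.
Qed.

Lemma det_sign n (K : 'M[R]_n) : K^T = K -> \det K != 0 ->
  (\det K < 0) = odd (Inert K).
Proof.
move=> symK dK.
have [lam [U [U1 KE]]] := spectral_symmetric symK.
have dE := det_spectral U1 KE.
have lam0 j : lam 0 j != 0.
  by apply: contra dK => /eqP l0; rewrite dE (bigD1 j)//= l0 mul0r.
rewrite (Inert_prod (char_poly_spectral U1 KE)) dE.
have -> : #|[pred i | lam 0 i < 0]| = (\sum_i (lam 0 i < 0)%R)%N.
  rewrite -sum1_card [LHS]big_mkcond; apply: eq_bigr => j _ /=.
  by rewrite -[j \in _]/(lam 0 j < 0); case: ifP.
elim: (index_enum _) => [|i s IH]; first by rewrite !big_nil ltr10.
rewrite !big_cons oddD -IH.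
have p0 : \prod_(j <- s) lam 0 j != 0.
  by rewrite prodf_seq_neq0; apply/allP => j _; rewrite lam0.
by rewrite mulr_lt0_addb// oddb.
Qed.

Lemma expi_pi2 k : expi (pi / 2 * k%:R) = imag R ^+ k.
Proof.
elim: k => [|k IH]; first by rewrite mulr0 expi0.
rewrite -[k.+1%:R]natr1 mulrDr mulr1 expiD IH exprSr; congr (_ * _).
by rewrite /expi cos_pihalf sin_pihalf.
Qed.

Lemma imag4 : imag R ^+ 4 = 1.
Proof.
by apply: eq_ReIm; rewrite !exprS expr0 !ReIm /=; ring.
Qed.

Lemma imag_neq0 : imag R != 0.
Proof. by apply/eqP => -[/eqP]; rewrite oner_eq0. Qed.

Lemma imag_mod4 (a b : int) : (a = b %[mod 4])%Z -> imag R ^ a = imag R ^ b.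
Proof.
have H (c : int) : imag R ^ c = imag R ^ (c %% 4)%Z.
  rewrite {1}(divz_eq c 4) expfzDr ?imag_neq0// [(_ * 4)%R]mulrC -exprz_exp.
  by rewrite -[imag R ^ 4]/(imag R ^+ 4) imag4 exp1rz mul1r.
by move=> E; rewrite H E -H.
Qed.

(** Modulo 2 the sign of det (S - I) has exponent n + [det L < 0] + Inert K. The hypothesis on m
    replaces the bracket by m, and m + Inert K has the parity of - nu. *)
Lemma arg_parity n (P L Q : 'M[R]_n) (m nu : int) :
  P^T = P -> Q^T = Q -> \det L != 0 -> \det (Wxx P L Q) != 0 ->
  eqmodR (2 * pi) (m%:~R * pi) (real_arg (\det L)) ->
  (nu = m - (Inert (Wxx P L Q))%:Z %[mod 4])%Z ->
  eqmodR 2 (pi^-1 * real_arg (\det (free_symplectic P L Q - 1%:M))) (- nu + n%:Z)%:~R.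
Proof.
move=> hP hQ hL hK [k hk] hnu.
have pi0 : pi != 0 :> R by rewrite gt_eqF// pi_gt0.
have argE (a : R) : a != 0 -> real_arg a = (a < 0)%R%:R * pi.
  by move=> a0; rewrite /real_arg; case: ltgtP a0 => //= _ _; rewrite ?mul0r ?mul1r.
have dS := det_free_symplecticB1 P Q hL.
have dS0 : \det (free_symplectic P L Q - 1%:M) != 0.
  by rewrite dS !mulf_neq0 ?signr_eq0 ?invr_eq0.
have mE : m = (\det L < 0)%R%:Z + k * 2.
  apply: (@intr_inj R); apply: (mulIf pi0).
  by rewrite hk argE// rmorphD rmorphM /=; case: (_ < _) => /=; ring.
have sS : (\det (free_symplectic P L Q - 1%:M) < 0) =
    odd n (+) (\det L < 0) (+) odd (Inert (Wxx P L Q)).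
  rewrite -det_sign ?Wxx_sym// dS -signr_odd.
  rewrite !mulr_lt0_addb ?mulf_neq0 ?signr_eq0 ?invr_eq0// invr_lt0; congr (_ (+) _ (+) _).
  by case: (odd n); rewrite ?expr1 ?expr0 ?oppr_lt0 ?ltr01 ?ltr10.
rewrite argE// mulrCA mulVf// mulr1 sS.
set bL := (\det L < 0) in mE *; set I := Inert _ in hnu *.
have [q nuE] : exists q : int, nu = m - I%:Z + q * 4.
  exists ((nu %/ 4)%Z - ((m - I%:Z) %/ 4)%Z).
  have := divz_eq nu 4; have := divz_eq (m - I%:Z) 4; rewrite hnu.
  by move: (_ %/ _)%Z (_ %/ _)%Z (_ %% _)%Z => u v w; lia.
pose b := odd n (+) bL (+) odd I.
have [r br] : exists r : int, (b : nat)%:Z = - nu + n%:Z + r * 2.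
  have En := odd_double_half n; have EI := odd_double_half I.
  (* Solving for [r] leaves half of b + bL - (n mod 2) - (I mod 2). The two indicators are the cases
     where this half is 1 or -1; otherwise it is 0. *)
  exists (k + q * 2 - n./2%:Z - I./2%:Z 
     + ([&& bL, ~~ odd n & ~~ odd I] : nat)%:Z
     - ([&& ~~ bL, odd n & odd I] : nat)%:Z).
  rewrite nuE mE.
  have -> : n%:Z = (odd n)%:Z + n./2%:Z * 2 by rewrite -{1}En -muln2; lia.
  have -> : I%:Z = (odd I)%:Z + I./2%:Z * 2 by rewrite -{1}EI -muln2; lia.
  by rewrite /b; clear b mE; move: (odd n) bL (odd I) => [] [] [] /=; lia.
exists r; rewrite -[LHS]/((b : nat)%:R) -[X in X = _]/((b : nat)%:Z%:~R : R) br.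
by rewrite rmorphD/= intrM.
Qed.

End Phase.

(** * Schwartz functions and the decay of matrix coefficients *)

Section Schwartz.
Variable R : realType.
Local Notation C := R[i].
Local Notation Re := (@complex.Re R).
Local Notation Im := (@complex.Im R).
Local Notation normc := (@Normc.normc R).
Local Notation toC := (real_complex R).
Variable n : nat.
Implicit Types (u : 'cV[R]_n -> R) (f g : 'cV[R]_n -> C) (x p : 'cV[R]_n).

Lemma is_derive_line u x (v : 'cV[R]_n) : differentiable u x ->
  is_derive (0 : R) 1 (fun h : R => u (x + h *: v)) ('D_v u x).
Proof.
move=> du; have dv : derivable u x v by exact: diff_derivable.
have E : (fun h : R => h^-1 *: (((fun h : R => u (x + h *: v)) \o shift 0) (h *: 1) -
     u (x + (0 : R) *: v))) =
   (fun h : R => h^-1 *: ((u \o shift x) (h *: v) - u x)).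
  apply/funext => h /=; rewrite scale0r !addr0; congr (_ *: (u _ - _)).
  by rewrite addrC -[h *: 1]/(h * 1) mulr1.
by apply: DeriveDef; rewrite /derivable /derive E.
Qed.

Lemma real_schwartz_continuous u : real_schwartz u -> continuous u.
Proof. by move=> su x; apply: differentiable_continuous; have [du _] := su [::]. Qed.

Lemma real_schwartz_partial u i : real_schwartz u ->
  real_schwartz ('D_(delta_mx i 0 : 'cV[R]_n) u).
Proof. by move=> su s; have := su (rcons s i); rewrite /iter_partial foldr_rcons. Qed.

(** Seminorms control monomials times [u]. Each factor (1 + x_j^2)^2 is expanded into the powers 0,
    2 and 4 of x_j, so the induction over coordinates carries an arbitrary monomial [a]. *)
Lemma real_schwartz_weight u : real_schwartz u -> exists2 K, 0 <= K &
  forall x, `|u x| <= K * weight x ^+ 2.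
Proof.
move=> su.
have H (l : seq 'I_n) : forall a : 'I_n -> nat, exists2 K, 0 <= K & forall x,
    `|(\prod_(i < n) x i 0 ^+ a i) * (\prod_(i <- l) (1 + x i 0 ^+ 2) ^+ 2 * u x)| <= K.
  elim: l => [|j l IH] a.
    have [_ /(_ a) [K KP]] := su [::]; exists K.
      exact: le_trans (normr_ge0 _) (KP 0).
    by move=> x; rewrite big_nil mul1r; exact: KP.
  have E k x : \prod_(i < n) x i 0 ^+ (a i + (i == j) * k)%N =
      (\prod_(i < n) x i 0 ^+ a i) * x j 0 ^+ k.
    under eq_bigr do rewrite exprD; rewrite big_split /=; congr (_ * _).
    rewrite (bigD1 j)//= eqxx mul1n big1 ?mulr1// => i /negbTE ->.
    by rewrite mul0n expr0.
  have [K0 K00 P0] := IH a.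
  have [K2 K20 P2] := IH (fun i => a i + (i == j) * 2)%N.
  have [K4 K40 P4] := IH (fun i => a i + (i == j) * 4)%N.
  exists (K0 + 2 * K2 + K4) => [|x]; first by rewrite !addr_ge0// mulr_ge0.
  have := P0 x; have := P2 x; have := P4 x; rewrite !E big_cons.
  set A := \prod_(i < n) _; set B := \prod_(i <- l) _ * u x; set t := x j 0.
  move=> h4 h2 h0.
  rewrite -mulrA -/B.
  have -> : A * ((1 + t ^+ 2) ^+ 2 * B) =
    A * B + 2 * (A * t ^+ 2 * B) + A * t ^+ 4 * B by ring.
  apply: (le_trans (ler_normD _ _)); apply: lerD => //.
  apply: (le_trans (ler_normD _ _)); apply: lerD => //.
  by rewrite normrM ger0_norm// ler_wpM2l.
have [K K0 KP] := H (index_enum _) (fun=> 0%N).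
exists K => // x; have := KP x.
rewrite big1 => [|i _]; last by rewrite expr0.
rewrite mul1r normrM.
have wE : \prod_(i : 'I_n) (1 + x i 0 ^+ 2) ^+ 2 * weight x ^+ 2 = 1.
  rewrite /weight -prodrXl -big_split /= big1// => i _.
  by rewrite exprVn mulfV// expf_neq0// gt_eqF// ltr_pwDl// sqr_ge0.
rewrite ger0_norm; last by apply: prodr_ge0 => i _; rewrite sqr_ge0.
move=> h; rewrite -[leLHS]mul1r -wE mulrAC ler_wpM2r//.
by rewrite sqr_ge0.
Qed.

Definition cpart (i : 'I_n) f x : C :=
  Complex ('D_(delta_mx i 0 : 'cV[R]_n) (fun x => Re (f x)) x)
          ('D_(delta_mx i 0 : 'cV[R]_n) (fun x => Im (f x)) x).

Lemma schwartz_cpart i f : schwartz f -> schwartz (cpart i f).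
Proof. by move=> [sR sI]; split; exact: real_schwartz_partial. Qed.

Lemma cder_cpart i f x : schwartz f ->
  cder (fun h : R => f (x + h *: delta_mx i 0)) 0 (cpart i f x).
Proof.
move=> [sR sI]; split => /=; apply: is_derive_line.
  by have [] := sR [::].
by have [] := sI [::].
Qed.

Lemma schwartz_weight f : schwartz f -> exists2 K, 0 <= K &
  forall x, normc (f x) <= K * weight x ^+ 2.
Proof.
move=> [/real_schwartz_weight[K K0 KP] /real_schwartz_weight[L L0 LP]].
exists (K + L) => [|x]; first exact: addr_ge0.
by rewrite (le_trans (normc_le _))// mulrDl lerD.
Qed.

Lemma cmeas_schwartz d (T : measurableType d) f (h : T -> 'cV[R]_n) :
  schwartz f -> mvec h -> cmeas (fun t => f (h t)).
Proof.
by move=> [sR sI]; apply: cmeas_continuous; exact: real_schwartz_continuous.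
Qed.

(** The bound on [g] supplies two factors [weight x]: [weight_sub] spends one of them to obtain
    decay in x0, and the other remains for x. *)
Lemma schwartz_prod_weight f g : schwartz f -> schwartz g ->
  exists2 K, 0 <= K & forall x0 x,
    normc (f (x - x0) * conjc (g x)) <= K * (weight x0 * weight x).
Proof.
move=> /schwartz_weight[K K0 KP] /schwartz_weight[L L0 LP].
exists (K * L * 2 ^+ n) => [|x0 x]; first by rewrite !mulr_ge0// exprn_ge0.
rewrite Normc.normcM normc_conj.
apply: (le_trans (ler_pM (normc_ge0 _) (normc_ge0 _) (KP _) (LP _))).
have := weight_sub x x0; have := weight_le1 (x - x0).
have := weight_ge0 (x - x0); have := weight_ge0 x; have := weight_ge0 x0.
set a := weight (x - x0); set b := weight x; set c := weight x0; set t := 2 ^+ n.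
move=> c0 b0 a0 a1 ab.
rewrite (_ : K * a ^+ 2 * _ = K * L * (a * (a * b) * b)); last by ring.
rewrite (_ : K * L * t * _ = K * L * (1 * (t * c) * b)); last by ring.
rewrite ler_wpM2l ?mulr_ge0// ler_wpM2r// ler_pM// mulr_ge0//.
Qed.

(* The coefficient (T(x0, p) f, g) up to a unimodular factor. *)
Definition ambig f g (x0 p : 'cV[R]_n) : C :=
  cintegral (leb R n) (fun t => expi (dot p (vec t)) * (f (vec t - x0) * conjc (g (vec t)))).

Lemma cmeas_ambig_integrand f g x0 p : schwartz f -> schwartz g ->
  cmeas (fun t : n.-tuple (measurableTypeR R) =>
    expi (dot p (vec t)) * (f (vec t - x0) * conjc (g (vec t)))).
Proof.
move=> sf sg; have mv := @mvec_vec R n; apply: cmeasM.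
  by apply/cmeas_expi/measurable_dot => //; exact: mvec_cst.
apply: cmeasM; first by apply: cmeas_schwartz => //; apply: mvecD => //; exact: mvec_cst.
by apply/cmeas_conj/cmeas_schwartz.
Qed.

Lemma cint_ambig_integrand f g x0 p : schwartz f -> schwartz g ->
  cint (leb R n) (fun t =>
    expi (dot p (vec t)) * (f (vec t - x0) * conjc (g (vec t)))).
Proof.
move=> sf sg; have [K K0 KP] := schwartz_prod_weight sf sg.
apply: (cint_le (cmeas_ambig_integrand x0 p sf sg)
   (rintZ (K * weight x0) (rint_weight R n))) => t.
by rewrite Normc.normcM normc_expi mul1r -mulrA.
Qed.

Lemma ambig_bound f g : schwartz f -> schwartz g -> exists2 K, 0 <= K &
  forall x0 p, normc (ambig f g x0 p) <= K * weight x0.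
Proof.
move=> sf sg; have [K K0 KP] := schwartz_prod_weight sf sg.
have I0 : 0 <= \int[leb R n]_t weight (vec t).
  by apply: Rintegral_ge0 => t _; exact: weight_ge0.
exists (2 * K * \int[leb R n]_t weight (vec t)) => [|x0 p].
  by rewrite !mulr_ge0.
have i_w := rint_weight R n.
apply: (le_trans (normc_cintegral (cint_ambig_integrand x0 p sf sg)
   (rintZ (K * weight x0) i_w) _)).
  by move=> t; rewrite Normc.normcM normc_expi mul1r -mulrA.
rewrite RintegralZl// le_eqVlt; apply/orP; left; apply/eqP; ring.
Qed.

(** Integration by parts: the derivative of the full integrand has integral 0, and Leibniz' rule
    spreads it over the exponential, f and the conjugate of g. *)
Lemma ambig_partial f g x0 p j : schwartz f -> schwartz g ->
  ambig (cpart j f) g x0 p + ambig f (cpart j g) x0 p =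
  - (Complex 0 (p j 0) * ambig f g x0 p).
Proof.
move=> sf sg; have sf' := schwartz_cpart j sf; have sg' := schwartz_cpart j sg.
have iA := cint_ambig_integrand x0 p sf sg.
have iB := cint_ambig_integrand x0 p sf' sg.
have iD := cint_ambig_integrand x0 p sf sg'.
pose E (x : 'cV[R]_n) : C := expi (dot p x).
pose uu (x : 'cV[R]_n) : C := E x * (f (x - x0) * conjc (g x)).
pose du x := Complex 0 (p j 0) * uu x + (E x * (cpart j f (x - x0) * conjc (g x)) +
    E x * (f (x - x0) * conjc (cpart j g x))).
have [K K0 KP] := schwartz_prod_weight sf sg.
have [K1 K10 K1P] := schwartz_prod_weight sf' sg.
have [K2 K20 K2P] := schwartz_prod_weight sf sg'.
have nE x z : normc (E x * z) = normc z by rewrite Normc.normcM normc_expi mul1r.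
have w1 := weight_le1 x0; have w0 := weight_ge0 x0.
have bd (k : R) x : 0 <= k -> k * (weight x0 * weight x) <= k * weight x.
  by move=> k0; rewrite ler_wpM2l// ler_piMl ?weight_ge0.
have H : cintegral (leb R n) (fun t => du (vec t)) = 0.
  apply: (@cintegral_partial R n (delta_mx j 0) uu du (K + (`|p j 0| * K + (K1 + K2)))).
  - by move=> i; rewrite mxE; case: (_ && _); rewrite ?normr1 ?normr0.
  - move=> x.
    have dE : cder (fun h : R => E (x + h *: delta_mx j 0)) 0 (Complex 0 (p j 0) * E x).
      have := @cder_gauss_exp_affine R 0 (p j 0) (dot p x) 0.
      rewrite (_ : (fun r : R => cexp (Complex 0 (r * p j 0 + dot p x))) = (fun h : R => E (x + h *: delta_mx j 0))).
        rewrite mul0r add0r => H; apply: (cder_eq H).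
        by rewrite /cexp /= expR0 /E mul1r.
      apply/funext => h; rewrite /cexp /= expR0 mul1r /E; congr expi.
      by rewrite dotDr dotZr dot_delta addrC.
    have df : cder (fun h : R => f (x + h *: delta_mx j 0 - x0)) 0 (cpart j f (x - x0)).
      have := cder_cpart j (x - x0) sf; congr cder; apply/funext => h.
      by rewrite addrAC.
    have dg := cder_conj (cder_cpart j x sg).
    have := cderM dE (cderM df dg); cbv beta; rewrite !scale0r !addr0 => H.
    apply: (cder_eq H); rewrite /du /uu.
    ring.
  - exact: cmeas_ambig_integrand.
  - move=> x; rewrite nE (le_trans (KP _ _))// (le_trans (bd K x K0))//.
    by rewrite ler_wpM2r ?weight_ge0// lerDl !addr_ge0// mulr_ge0.
  - move=> x; rewrite (le_trans (normcD _ _))//.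
    rewrite (_ : (K + _) * weight x = K * weight x + (`|p j 0| * (K * weight x) +
       (K1 * weight x + K2 * weight x))); last by ring.
    rewrite ler_wpDl ?mulr_ge0 ?weight_ge0// lerD//.
      rewrite Normc.normcM nE (_ : normc (Complex 0 (p j 0)) = `|p j 0|); last first.
        by rewrite normc_sqrtE /= expr0n add0r sqrtr_sqr.
      by rewrite ler_wpM2l// (le_trans (KP _ _))// bd.
    rewrite (le_trans (normcD _ _))// !nE lerD//.
      by rewrite (le_trans (K1P _ _))// bd.
    by rewrite (le_trans (K2P _ _))// bd.
have := H; rewrite cintegralD; last 2 first.
- exact: cintZ.
- exact: cintD.
rewrite cintegralZ// cintegralD// => /eqP; rewrite addrC addr_eq0 => /eqP.
exact.
Qed.

(** Here z = i p_j, so that 1 - z^2 = 1 + p_j^2; the digits 1 and 2 record derivatives falling on f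
    and on g. *)
Let twice_partial (z a a1 a2 a11 a12 a22 : C) :
  a1 + a2 = - (z * a) -> a11 + a12 = - (z * a1) -> a12 + a22 = - (z * a2) ->
  (1 - z * z) * a = a + -1 * (a11 + (1 + 1) * a12 + a22).
Proof.
move=> h h1 h2; have -> : a11 + (1 + 1) * a12 + a22 = (a11 + a12) + (a12 + a22) by ring.
rewrite h1 h2 -opprD -mulrDr h; ring.
Qed.

(* Multiplication by 1 + p_j^2 acts as 1 - d_j^2 on the product of f and g. *)
Lemma ambig_decay f g : schwartz f -> schwartz g -> exists2 K, 0 <= K &
  forall x0 p, normc (ambig f g x0 p) <= K * (weight x0 * weight p).
Proof.
(* The functions are quantified inside the induction, since each new coordinate differentiates them
   up to twice. *)
have H (l : seq 'I_n) : forall f g, schwartz f -> schwartz g -> exists2 K, 0 <= K &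
    forall x0 p, \prod_(j <- l) (1 + p j 0 ^+ 2) * normc (ambig f g x0 p) <= K * weight x0.
  elim: l => [|j l IH] {}f {}g sf sg.
    have [K K0 KP] := ambig_bound sf sg; exists K => // x0 p.
    by rewrite big_nil mul1r.
  have sf' := schwartz_cpart j sf; have sg' := schwartz_cpart j sg.
  have sf'' := schwartz_cpart j sf'; have sg'' := schwartz_cpart j sg'.
  have [K1 K10 K1P] := IH _ _ sf sg.
  have [K2 K20 K2P] := IH _ _ sf'' sg.
  have [K3 K30 K3P] := IH _ _ sf' sg'.
  have [K4 K40 K4P] := IH _ _ sf sg''.
  exists (K1 + (K2 + 2 * K3 + K4)) => [|x0 p]; first by rewrite !addr_ge0// mulr_ge0.
  have h1 := ambig_partial x0 p j sf sg.
  have h2 := ambig_partial x0 p j sf' sg.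
  have h3 := ambig_partial x0 p j sf sg'.
  have E : toC (1 + p j 0 ^+ 2) * ambig f g x0 p = ambig f g x0 p +
     -1 * (ambig (cpart j (cpart j f)) g x0 p + toC 2 * ambig (cpart j f) (cpart j g) x0 p +
       ambig f (cpart j (cpart j g)) x0 p).
    have i2 : toC (1 + p j 0 ^+ 2) = 1 - Complex 0 (p j 0) * Complex 0 (p j 0).
      by apply: eq_ReIm => /=; ring.
    have t2 : toC 2 = 1 + 1 by apply: eq_ReIm => /=; ring.
    rewrite i2 t2; exact: twice_partial h1 h2 h3.
  rewrite big_cons mulrAC mulrC.
  have -> : (1 + p j 0 ^+ 2) * normc (ambig f g x0 p) =
      normc (toC (1 + p j 0 ^+ 2) * ambig f g x0 p).
    by rewrite Normc.normcM normc_real ger0_norm// addr_ge0// sqr_ge0.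
  set pr := \prod_(_ <- _) _.
  have pr0 : 0 <= pr by apply: prodr_ge0 => i _; rewrite addr_ge0// sqr_ge0.
  rewrite E; apply: (le_trans (ler_wpM2l pr0 (normcD _ _))).
  rewrite mulrDr mulrDl lerD ?K1P//.
  rewrite mulN1r normcN.
  apply: (le_trans (ler_wpM2l pr0 (normcD _ _))); rewrite mulrDr mulrDl lerD ?K4P//.
  apply: (le_trans (ler_wpM2l pr0 (normcD _ _))); rewrite mulrDr mulrDl lerD ?K2P//.
  rewrite Normc.normcM normc_real ger0_norm// mulrCA -mulrA ler_wpM2l//; exact: K3P.
move=> sf sg; have [K K0 KP] := H (index_enum _) f g sf sg.
exists K => // x0 p.
have wE : \prod_(i : 'I_n) (1 + p i 0 ^+ 2) * weight p = 1.
  rewrite /weight -big_split /= big1// => i _.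
  by rewrite mulfV// gt_eqF// ltr_pwDl// sqr_ge0.
rewrite -[leLHS]mul1r -wE mulrAC mulrA ler_wpM2r ?weight_ge0//.
Qed.

End Schwartz.

(** * Evaluation of the Mehlig-Wilkinson integral *)

Section MehligWilkinson.
Variable R : realType.
Local Notation C := R[i].
Local Notation RR := (measurableTypeR R).
Local Notation normc := (@Normc.normc R).
Local Notation toC := (real_complex R).
Local Notation eps := (@epsk R).
Variables (n : nat) (P L Q : 'M[R]_n).
Hypothesis hP : P^T = P.
Hypothesis hQ : Q^T = Q.
Hypothesis hL : \det L != 0.
Local Notation S := (free_symplectic P L Q).
Local Notation K := (Wxx P L Q).
Local Notation H := (invmx K).
Local Notation Del := (wmid P L Q).
Local Notation Sig := (wsum P L Q).
Hypothesis hdet : \det (S - 1%:M) != 0.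
Local Notation T := (n.-tuple RR).
Local Notation mu := (leb R n).
Variables (f g : 'cV[R]_n -> C).
Hypotheses (sf : schwartz f) (sg : schwartz g).

Let hK : \det K != 0.
Proof.
by apply: contra hdet => /eqP K0; rewrite det_free_symplecticB1// K0 mulr0.
Qed.

Let Ku : K \in unitmx.
Proof. by rewrite unitmxE unitfE. Qed.

Let M := - H.

Let symM : M^T = M.
Proof. by rewrite /M linearN /= invWxx_sym. Qed.

Let detM : \det M = (-1) ^+ n / \det K.
Proof. by rewrite /M -scaleN1r detZ det_inv. Qed.

Let detM0 : \det M != 0.
Proof. by rewrite detM mulf_neq0 ?signr_eq0 ?invr_eq0. Qed.

Let invM : invmx M = - K.
Proof.
have MK : M *m (- K) = 1%:M by rewrite mulNmx mulmxN opprK mulVmx.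
by rewrite -[LHS]mulmx1 -MK mulKmx// unitmxE unitfE.
Qed.

Definition mwphase (x0 p0 : 'cV[R]_n) : R :=
  2^-1 * dot (M_ S *m col_mx x0 p0) (col_mx x0 p0).

Definition shear (x0 p0 : 'cV[R]_n) : 'cV[R]_n := p0 - Del *m x0.

(* Damping q = [shear x0 p0] instead of p0 makes the integral over p0 a
   translate of the same Gaussian integral for every x0. *)
Definition cutoff k (x0 p0 : 'cV[R]_n) : C :=
  cexp (Complex (- (2^-1 * eps k * dot (shear x0 p0) (shear x0 p0))) (mwphase x0 p0)).

Definition coefficient (x0 p0 : 'cV[R]_n) : C :=
  inner (weyl_heisenberg (col_mx x0 p0) f) g.

Lemma coefficientE x0 p0 :
  coefficient x0 p0 = expi (- (2^-1 * dot p0 x0)) * ambig f g x0 p0.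
Proof.
rewrite /ambig -cintegralZ; last exact: cint_ambig_integrand.
apply: eq_cintegral => t; rewrite /weyl_heisenberg col_mxKu col_mxKd.
by rewrite addrC expiD !mulrA.
Qed.

Let m1 : mvec (fun t : T * T => vec t.1).
Proof. exact: (mvec_comp (@mvec_vec R n) measurable_fst). Qed.

Let m2 : mvec (fun t : T * T => vec t.2).
Proof. exact: (mvec_comp (@mvec_vec R n) measurable_snd). Qed.

Lemma mvec_col_mx d (X : measurableType d) (h k : X -> 'cV[R]_n) :
  mvec h -> mvec k -> mvec (fun t => col_mx (h t) (k t)).
Proof.
move=> mh mk i; case: (split_ordP i) => j ->.
  by under eq_fun do rewrite col_mxEu; exact: mh.
by under eq_fun do rewrite col_mxEd; exact: mk.
Qed.

Lemma mvec_shear d (X : measurableType d) (h k : X -> 'cV[R]_n) :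
  mvec h -> mvec k -> mvec (fun t => shear (h t) (k t)).
Proof. by move=> mh mk; apply: mvecD => //; apply/mvecN/mvecM. Qed.

Lemma measurable_mwphase d (X : measurableType d) (h k : X -> 'cV[R]_n) :
  mvec h -> mvec k -> measurable_fun setT (fun t => mwphase (h t) (k t)).
Proof.
move=> mh mk; apply: measurable_funM => //.
by apply: measurable_dot; [apply: mvecM|]; exact: mvec_col_mx.
Qed.

Lemma cmeas_cutoff d (X : measurableType d) k (h l : X -> 'cV[R]_n) :
  mvec h -> mvec l -> cmeas (fun t => cutoff k (h t) (l t)).
Proof.
move=> mh ml; apply: cmeas_cexp; split => /=; last exact: measurable_mwphase.
apply: measurableT_comp => //; apply: measurable_funM => //.
by apply: measurable_dot; exact: mvec_shear.
Qed.

Lemma cmeas_ambig : cmeas (fun t : T * T => ambig f g (vec t.1) (vec t.2)).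
Proof.
apply: (@cmeas_cintegral R _ _ _ _ mu (fun s : (T * T) * T =>
  expi (dot (vec s.1.2) (vec s.2)) * (f (vec s.2 - vec s.1.1) * conjc (g (vec s.2))))).
have mf1 : measurable_fun setT (fst : (T * T) * T -> T * T) by exact: measurable_fst.
have ma : mvec (fun s : (T * T) * T => vec s.1.1) by exact: (mvec_comp m1 mf1).
have mb : mvec (fun s : (T * T) * T => vec s.1.2) by exact: (mvec_comp m2 mf1).
have mc : mvec (fun s : (T * T) * T => vec s.2).
  exact: (mvec_comp (@mvec_vec R n) measurable_snd).
apply: cmeasM; first by apply/cmeas_expi/measurable_dot.
apply: cmeasM; last by apply/cmeas_conj/cmeas_schwartz.
by apply: cmeas_schwartz => //; apply: mvecD => //; exact: mvecN.
Qed.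

Lemma cmeas_coefficient : cmeas (fun t : T * T => coefficient (vec t.1) (vec t.2)).
Proof.
under eq_fun do rewrite coefficientE.
apply: cmeasM; last exact: cmeas_ambig.
apply: cmeas_expi; apply: measurableT_comp => //; apply: measurable_funM => //.
exact: measurable_dot.
Qed.

Lemma coefficient_bound : exists2 k, 0 <= k & forall x0 p0,
  normc (coefficient x0 p0) <= k * (weight x0 * weight p0).
Proof.
have [k k0 kP] := ambig_decay sf sg; exists k => // x0 p0.
by rewrite coefficientE Normc.normcM normc_expi mul1r.
Qed.

Lemma normc_cutoff k x0 p0 : normc (cutoff k x0 p0) <= 1.
Proof.
rewrite normc_cexp -expR0 ler_expR /= oppr_le0 mulr_ge0 ?dot_ge0//.
by rewrite mulr_ge0// ltW// epsk_gt0.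
Qed.

Let rww (k : R) : rint (mu \x mu)%E (fun t : T * T => k * (weight (vec t.1) * weight (vec t.2))).
Proof. exact: (rintZ k (rint_prod (rint_weight R n) (rint_weight R n))). Qed.

Definition regularized k : C := cintegral (mu \x mu)%E
  (fun t => cutoff k (vec t.1) (vec t.2) * coefficient (vec t.1) (vec t.2)).

Lemma ccvg_cutoff x0 p0 : ccvg (fun k => cutoff k x0 p0) (expi (mwphase x0 p0)).
Proof.
have -> : expi (mwphase x0 p0) = cexp (Complex 0 (mwphase x0 p0)).
  by rewrite /cexp expR0 mul1r.
apply: ccvg_cexp; split => /=; last exact: cvg_cst.
rewrite -oppr0; apply: cvgN.
rewrite -(mul0r (dot (shear x0 p0) (shear x0 p0))); apply: cvgM; last exact: cvg_cst.
by rewrite -(mulr0 2^-1); apply: cvgM; [exact: cvg_cst|exact: cvg_epsk].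
Qed.

Lemma ccvg_regularized : ccvg regularized (integral_R2n (fun z =>
  expi (2^-1 * dot (M_ S *m z) z) * inner (weyl_heisenberg z f) g)).
Proof.
have [k k0 kP] := coefficient_bound.
apply: (@ccvg_dominated R _ _ _
  (fun j t => cutoff j (vec t.1) (vec t.2) * coefficient (vec t.1) (vec t.2))
  (fun t => expi (mwphase (vec t.1) (vec t.2)) * coefficient (vec t.1) (vec t.2))
  _ _ (rww k)) => [j|j [x p]|t].
- by apply: cmeasM; [exact: cmeas_cutoff|exact: cmeas_coefficient].
- rewrite Normc.normcM -[leRHS]mul1r.
  by apply: ler_pM; rewrite ?normc_ge0 ?normc_cutoff ?kP.
- by apply: ccvgM; [exact: ccvg_cutoff|exact: ccvg_cst].
Qed.

Definition gk k (y : 'cV[R]_n) : C :=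
  cintegral mu (fun x => gauss_exp M (eps k) 1 1 y (vec x)).

(** The part of the phase that does not involve q once p0 = q + D x0 is substituted. *)
Definition midphase (x0 y : 'cV[R]_n) : R :=
  8^-1 * dot (Sig *m x0) x0 + dot (Del *m x0) y.

(** In the variable q the damping and the quadratic phase are centered, so the dependence on x0
    leaves the Gaussian except through y. *)
Lemma cutoff_shear k x0 q y :
  cutoff k x0 (q + Del *m x0) * expi (dot (q + Del *m x0) y) =
  expi (midphase x0 y) * gauss_exp M (eps k) 1 1 y q.
Proof.
have sE : shear x0 (q + Del *m x0) = q by rewrite /shear addrK.
rewrite /cutoff /mwphase quadratic_M_free_symplectic// -/(shear _ _) sE.
rewrite /gauss_exp /cexp /= -mulrA -expiD mulrCA -expiD; congr (_ * expi _).
by rewrite /midphase /M mulNmx dotDl dotNl (dotC y q) mulr1 mul1r; ring.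
Qed.

(** This majorant depends on [k] and [x0]; it is meant for exchanging p0 and x while both are
    fixed. *)
Let rgauss k x0 : exists2 a : T -> R, rint mu a &
  forall t, normc (cutoff k x0 (vec t)) <= a t.
Proof.
have [K1 K10 K1P] := @gauss_weight R n (eps k) (epsk_gt0 R k).
exists (fun t => K1 * weight (shear x0 (vec t))).
  apply: rintZ; have := @rint_affine R n 1 (- (Del *m x0)) _ (or_introl erefl) (rint_weight R n).
  by congr rint; apply/funext => t; rewrite /taff unvecK scale1r.
move=> t; rewrite normc_cexp (le_trans (K1P _))// expr2 mulrA ler_piMr ?weight_le1//.
by rewrite mulr_ge0// weight_ge0.
Qed.

Let mvT := @mvec_vec R n.

Lemma cint_cutoff k x0 y : cint mu (fun t => cutoff k x0 (vec t) * expi (dot (vec t) y)).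
Proof.
have [a ia aP] := rgauss k x0; apply: (cint_le _ ia) => [|t].
  apply: cmeasM; first by apply: cmeas_cutoff => //; exact: mvec_cst.
  by apply: cmeas_expi; apply: measurable_dot => //; exact: mvec_cst.
by rewrite Normc.normcM normc_expi mulr1.
Qed.

Lemma cintegral_cutoff k x0 y :
  cintegral mu (fun t => cutoff k x0 (vec t) * expi (dot (vec t) y)) =
  expi (midphase x0 y) * gk k y.
Proof.
have mF := cint_meas (cint_cutoff k x0 y).
pose F p := cutoff k x0 p * expi (dot p y).
rewrite -[LHS](@cintegral_affine R n 1 (Del *m x0) F (or_introl erefl) mF).
rewrite /gk -cintegralZ; last exact: (cint_gauss_exp M (epsk_gt0 R k)).
by apply: eq_cintegral => t; rewrite scale1r /F cutoff_shear.
Qed.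

(** The integrand in (x0, x) that remains once p0 has been integrated out. *)
Definition swapped k (x0 x : 'cV[R]_n) : C := f (x - x0) * conjc (g x) *
  (expi (midphase x0 (x - 2^-1 *: x0)) * gk k (x - 2^-1 *: x0)).

Let mvmid : mvec (fun t : T * T => vec t.2 - 2^-1 *: vec t.1).
Proof. by apply: mvecD => //; apply/mvecN/mvecZ. Qed.

Lemma cmeas_gk k : cmeas (fun t : T * T => gk k (vec t.2 - 2^-1 *: vec t.1)).
Proof.
apply: (@cmeas_cintegral R _ _ _ _ mu (fun s : (T * T) * T =>
  gauss_exp M (eps k) 1 1 (vec s.1.2 - 2^-1 *: vec s.1.1) (vec s.2))).
have mf1 : measurable_fun setT (fst : (T * T) * T -> T * T) by exact: measurable_fst.
have ma : mvec (fun s : (T * T) * T => vec s.1.2 - 2^-1 *: vec s.1.1).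
  exact: (mvec_comp mvmid mf1).
have mc : mvec (fun s : (T * T) * T => vec s.2).
  exact: (mvec_comp (@mvec_vec R n) measurable_snd).
apply: cmeas_cexp; split => /=.
  by apply: measurableT_comp => //; apply: measurable_funM => //; exact: measurable_dot.
apply: measurable_funD; apply: measurable_funM => //; apply: measurable_dot => //.
exact: mvecM.
Qed.

Let mfg : cmeas (fun t : T * T => f (vec t.2 - vec t.1) * conjc (g (vec t.2))).
Proof.
apply: cmeasM; last by apply/cmeas_conj/cmeas_schwartz.
by apply: cmeas_schwartz => //; apply: mvecD => //; exact: mvecN.
Qed.

Lemma cmeas_swapped k : cmeas (fun t : T * T => swapped k (vec t.1) (vec t.2)).
Proof.
apply: cmeasM => //; apply: cmeasM; last exact: cmeas_gk.
apply: cmeas_expi; apply: measurable_funD.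
  by apply: measurable_funM => //; apply: measurable_dot => //; exact: mvecM.
by apply: measurable_dot => //; exact: mvecM.
Qed.

Lemma gk_bound : exists2 B, 0 <= B & forall k y, normc (gk k y) <= B.
Proof.
have [G [GE [B GB] _]] := gauss_limit symM detM0.
exists B; first exact: le_trans (normc_ge0 _) (GB 0%N 0).
by move=> k y; rewrite /gk -GE.
Qed.

Lemma swapped_bound : exists2 B, 0 <= B & forall k x0 x,
  normc (swapped k x0 x) <= B * (weight x0 * weight x).
Proof.
have [B B0 BP] := gk_bound; have [K1 K10 K1P] := schwartz_prod_weight sf sg.
exists (K1 * B) => [|k x0 x]; first exact: mulr_ge0.
rewrite /swapped Normc.normcM [normc (expi _ * _)]Normc.normcM normc_expi mul1r mulrAC.
by rewrite ler_pM ?normc_ge0.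
Qed.

(** On both sides x0 is the outer variable, so only p0 and x have to be exchanged, at fixed x0,
    where the damping provides absolute convergence. *)
Lemma regularizedE k :
  regularized k = cintegral (mu \x mu)%E (fun t => swapped k (vec t.1) (vec t.2)).
Proof.
have [B B0 BP] := coefficient_bound.
have iw := rint_weight R n.
pose F1 (t : T * T) := cutoff k (vec t.1) (vec t.2) * coefficient (vec t.1) (vec t.2).
have mF1 : cmeas F1 by apply: cmeasM; [exact: cmeas_cutoff|exact: cmeas_coefficient].
have bF1 x p : normc (F1 (x, p)) <= B * weight (vec x) * weight (vec p).
  rewrite /F1 Normc.normcM -[leRHS]mul1r -mulrA.
  by apply: ler_pM; rewrite ?normc_ge0 ?normc_cutoff ?BP.
have [i1 i2 _] := cint_prod_le mF1 (rintZ B iw) iw bF1.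
rewrite /regularized -(cfubini12 i1 i2).
have [B' B'0 B'P] := swapped_bound.
have bF2 (x p : T) : normc (swapped k (vec x) (vec p)) <= B' * weight (vec x) * weight (vec p).
  by rewrite -mulrA B'P.
have [j1 j2 _] := cint_prod_le (cmeas_swapped k) (rintZ B' iw) iw bF2.
rewrite -(cfubini12 j1 j2); apply: eq_cintegral => t1.
set x0 := vec t1.
have [K1 K10 K1P] := schwartz_prod_weight sf sg.
have [a ia aP] := rgauss k x0.
(* The phases <p0, x> of the coefficient and - <p0, x0>/2 of the operator combine into <p0, x -
   x0/2>. *)
pose Psi (s : T * T) : C := cutoff k x0 (vec s.1) *
  expi (dot (vec s.1) (vec s.2 - 2^-1 *: x0)) * (f (vec s.2 - x0) * conjc (g (vec s.2))).
have mPsi : cmeas Psi.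
  have mx0 : mvec (fun _ : T * T => x0) by exact: mvec_cst.
  apply: cmeasM; first apply: cmeasM.
  - exact: cmeas_cutoff.
  - apply: cmeas_expi; apply: measurable_dot => //; exact: mvecD.
  - apply: cmeasM; last by apply/cmeas_conj/cmeas_schwartz.
    by apply: cmeas_schwartz => //; apply: mvecD => //; exact: mvecN.
have bPsi s t : normc (Psi (s, t)) <= a s * (K1 * weight x0 * weight (vec t)).
  rewrite /Psi Normc.normcM [normc (_ * expi _)]Normc.normcM normc_expi mulr1.
  apply: ler_pM; [exact: normc_ge0|exact: normc_ge0|exact: aP|].
  by rewrite -mulrA; exact: K1P.
have [l1 l2 l3] := cint_prod_le mPsi ia (rintZ (K1 * weight x0) iw) bPsi.
transitivity (cintegral mu (fun s => cintegral mu (fun t => Psi (s, t)))).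
  apply: eq_cintegral => s.
  rewrite -[LHS]/(cutoff k x0 (vec s) * coefficient x0 (vec s)) coefficientE.
  rewrite -cintegralZ; last exact: cint_ambig_integrand.
  rewrite -cintegralZ; last exact/cintZ/cint_ambig_integrand.
  apply: eq_cintegral => t; rewrite -[RHS]mulrA mulrA -[LHS]mulrA; congr (_ * _).
  rewrite mulrA -expiD; congr (expi _ * _).
  by rewrite dotDr dotNr dotZr addrC.
rewrite (cfubini12 l1 l2) -(cfubini21 l1 l3); apply: eq_cintegral => t /=.
rewrite /swapped -/x0 -cintegral_cutoff -cintegralZ; last exact: cint_cutoff.
by apply: eq_cintegral => s; rewrite /Psi /= mulrC.
Qed.

Definition gconst : C := toC (Num.sqrt (2 * pi) ^+ n / Num.sqrt `|\det M|) *
  expi (pi / 4 * (n%:R - 2 * (Inert M)%:R)).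

Definition swapped_limit (x0 x : 'cV[R]_n) : C :=
  f (x - x0) * conjc (g x) * expi (Wform P L Q x (x - x0)).

Lemma ccvg_gk y : ccvg (gk ^~ y) (gconst * expi (2^-1 * dot (K *m y) y)).
Proof.
have [G [GE _ /(_ y)]] := gauss_limit symM detM0.
rewrite invM mulNmx dotNl mulrN opprK; congr ccvg.
by apply/funext => k; rewrite GE.
Qed.

Lemma ccvg_swapped x0 x : ccvg (fun k => swapped k x0 x) (gconst * swapped_limit x0 x).
Proof.
set y := x - 2^-1 *: x0.
have -> : gconst * swapped_limit x0 x = f (x - x0) * conjc (g x) *
    (expi (midphase x0 y) * (gconst * expi (2^-1 * dot (K *m y) y))).
  by rewrite /swapped_limit Wform_midpoint// expiD -/y -/(midphase x0 y); ring.
apply: ccvgM; first exact: ccvg_cst.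
by apply: ccvgM; [exact: ccvg_cst|exact: ccvg_gk].
Qed.

Lemma cmeas_swapped_limit : cmeas (fun t : T * T => swapped_limit (vec t.1) (vec t.2)).
Proof.
have md : mvec (fun t : T * T => vec t.2 - vec t.1) by apply: mvecD => //; exact: mvecN.
apply: cmeasM => //; apply: cmeas_expi; apply: measurable_funD.
  apply: measurable_funB.
    by apply: measurable_funM => //; apply: measurable_dot => //; exact: mvecM.
  by apply: measurable_dot => //; exact: mvecM.
by apply: measurable_funM => //; apply: measurable_dot => //; exact: mvecM.
Qed.

Lemma swapped_limit_bound : exists2 B, 0 <= B & forall x0 x,
  normc (swapped_limit x0 x) <= B * (weight x0 * weight x).
Proof.
have [K1 K10 K1P] := schwartz_prod_weight sf sg; exists K1 => // x0 x.
by rewrite /swapped_limit Normc.normcM normc_expi mulr1.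
Qed.

(** The regularized integrals have two limits, one computed before and one after integrating out p0;
    uniqueness of limits equates them. *)
Lemma integral_mehlig_wilkinson :
  integral_R2n (fun z => expi (2^-1 * dot (M_ S *m z) z) * inner (weyl_heisenberg z f) g) =
  gconst * cintegral (mu \x mu)%E (fun t => swapped_limit (vec t.1) (vec t.2)).
Proof.
have [B B0 BP] := swapped_limit_bound; have [B' B'0 B'P] := swapped_bound.
have iL : cint (mu \x mu)%E (fun t : T * T => swapped_limit (vec t.1) (vec t.2)).
  by apply: (cint_le cmeas_swapped_limit (rww B)) => t; exact: BP.
rewrite -cintegralZ//; apply: ccvg_unique ccvg_regularized _.
rewrite (_ : regularized = fun k => cintegral (mu \x mu)%E
    (fun t => swapped k (vec t.1) (vec t.2))); last first.
  by apply/funext => k; rewrite regularizedE.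
apply: (@ccvg_dominated R _ _ _
  (fun k (t : T * T) => swapped k (vec t.1) (vec t.2))
  (fun t => gconst * swapped_limit (vec t.1) (vec t.2)) _ _ (rww B')) => [k|k t|t].
- exact: cmeas_swapped.
- exact: B'P.
- exact: ccvg_swapped.
Qed.

End MehligWilkinson.

(** * The quadratic Fourier transform, its extension to L^2, and the constants *)

Section Conclusion.
Variable R : realType.
Local Notation C := R[i].
Local Notation RR := (measurableTypeR R).
Local Notation normc := (@Normc.normc R).
Local Notation toC := (real_complex R).

Lemma cmeas_Wform_schwartz n (P L Q : 'M[R]_n) (f : 'cV[R]_n -> C) d (X : measurableType d)
    (h k : X -> 'cV[R]_n) : schwartz f -> mvec h -> mvec k ->
  cmeas (fun t => expi (Wform P L Q (h t) (k t)) * f (k t)).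
Proof.
move=> sf mh mk; apply: cmeasM; last exact: cmeas_schwartz.
apply: cmeas_expi; apply: measurable_funD.
  apply: measurable_funB.
    by apply: measurable_funM => //; apply: measurable_dot => //; exact: mvecM.
  by apply: measurable_dot => //; exact: mvecM.
by apply: measurable_funM => //; apply: measurable_dot => //; exact: mvecM.
Qed.

Lemma cint_schwartz_le n (f h : 'cV[R]_n -> C) : schwartz f -> cmeas (h \o @vec R n) ->
  (forall x, normc (h x) <= normc (f x)) -> cint (leb R n) (fun t => h (vec t)).
Proof.
move=> sf mh hf; have [K K0 KP] := schwartz_weight sf.
apply: (cint_le mh (rintZ K (rint_weight R n))) => t.
rewrite (le_trans (hf _))// (le_trans (KP _))// expr2 mulrA.
by rewrite ler_piMr ?weight_le1// mulr_ge0// weight_ge0.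
Qed.

(** The double integral over (x0, x) is taken with x outside, so that for fixed x the inner variable
    x0 can be replaced by x' = x - x0. *)
Lemma inner_quadratic_fourier n (P L Q : 'M[R]_n) (m : int) f g :
  schwartz f -> schwartz g ->
  inner (quadratic_fourier P L Q m f) g =
  toC ((2 * pi) `^ (- (n%:R / 2))) * expi (- (pi * n%:R / 4))
    * (imag R ^ m) * toC (Num.sqrt `|\det L|) *
  cintegral (leb R n \x leb R n)%E (fun t => swapped_limit P L Q f g (vec t.1) (vec t.2)).
Proof.
move=> sf sg; set c := _ * toC (Num.sqrt _).
have iw := rint_weight R n.
have [B B0 BP] := swapped_limit_bound P L Q sf sg.
pose F (t : n.-tuple RR * n.-tuple RR) := c * swapped_limit P L Q f g (vec t.1) (vec t.2).
have mF0 := cmeas_swapped_limit P L Q sf sg.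
have mF : cmeas F by apply: cmeasM => //; exact: cmeas_cst.
have bF0 x0 x : normc (swapped_limit P L Q f g (vec x0) (vec x)) <=
    B * weight (vec x0) * weight (vec x).
  by rewrite -mulrA BP.
have bF x0 x : normc (F (x0, x)) <= normc c * B * weight (vec x0) * weight (vec x).
  by rewrite Normc.normcM -!mulrA ler_wpM2l ?normc_ge0// BP.
have [i1 _ _] := cint_prod_le mF0 (rintZ B iw) iw bF0.
have [j1 _ j3] := cint_prod_le mF (rintZ (normc c * B) iw) iw bF.
rewrite -cintegralZ// -(cfubini21 j1 j3); apply: eq_cintegral => t.
set x := vec t.
pose h x' := c * conjc (g x) * (expi (Wform P L Q x x') * f x').
have mv := @mvec_vec R n.
have mx : mvec (fun _ : n.-tuple RR => x) by exact: mvec_cst.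
have mW := cmeas_Wform_schwartz P L Q sf mx mv.
have iW : cint (leb R n) (fun t => expi (Wform P L Q x (vec t)) * f (vec t)).
  apply: (@cint_schwartz_le n f (fun x' => expi (Wform P L Q x x') * f x')) => // x'.
  by rewrite Normc.normcM normc_expi mul1r.
have mh : cmeas (h \o @vec R n) by apply: cmeasM => //; exact: cmeas_cst.
transitivity (cintegral (leb R n) (h \o @vec R n)).
  rewrite [RHS]cintegralZ//; rewrite /quadratic_fourier -/c /integral_Rn.
  by rewrite mulrAC.
(* The substitution x' = x - x0 is a reflection followed by a translation by x. *)
rewrite -(@cintegral_affine R n (-1) x h (or_intror erefl) mh).
apply: eq_cintegral => s; rewrite scaleN1r [- _ + x]addrC /h /F /swapped_limit /=.
by rewrite -/x; ring.
Qed.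

Lemma cintegral_ae_eq d (T : measurableType d) (mu : {measure set T -> \bar R})
    (F G : T -> C) : cmeas F -> cmeas G -> {ae mu, forall t, F t = G t} ->
  cintegral mu F = cintegral mu G.
Proof.
move=> [FR FI] [GR GI] FG; apply: eq_ReIm; rewrite /= /Rintegral; congr fine.
  apply: ae_eq_integral => //; [exact/measurable_EFinP|exact/measurable_EFinP|].
  by apply: filterS FG => t /= ->.
apply: ae_eq_integral => //; [exact/measurable_EFinP|exact/measurable_EFinP|].
by apply: filterS FG => t /= ->.
Qed.

Lemma schwartz_L2 n (f : 'cV[R]_n -> C) : schwartz f -> L2 f.
Proof.
move=> sf; have [mR mI] := cmeas_schwartz sf (@mvec_vec R n).
have [K K0 KP] := schwartz_weight sf.
split => //.
have i2 : rint (leb R n) (fun t => complex.Re (f (vec t)) ^+ 2 + complex.Im (f (vec t)) ^+ 2).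
  apply: (rint_le _ (rintZ (K ^+ 2) (rint_weight R n))) => [|t].
    by apply: measurable_funD; exact: measurable_funX.
  rewrite ger0_norm ?addr_ge0 ?sqr_ge0//.
  have -> : complex.Re (f (vec t)) ^+ 2 + complex.Im (f (vec t)) ^+ 2 = normc (f (vec t)) ^+ 2.
    by rewrite normc_sqrtE sqr_sqrtr// addr_ge0 ?sqr_ge0.
  have w0 := weight_ge0 (vec t); have w1 := weight_le1 (vec t).
  have h : normc (f (vec t)) <= K * weight (vec t).
    rewrite (le_trans (KP _))// expr2 mulrA ler_piMr// mulr_ge0//.
  apply: (@le_trans _ _ ((K * weight (vec t)) ^+ 2)).
    by rewrite ler_pXn2r ?nnegrE ?normc_ge0// mulr_ge0.
  by rewrite exprMn ler_wpM2l ?sqr_ge0// expr2 ler_piMr.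
have /integrableP[_] := i2; apply: le_lt_trans.
by apply: ge0_le_integral => //= [t _|||t _]; rewrite ?lee_fin ?addr_ge0 ?sqr_ge0 ?ler_norm//;
  apply/measurable_EFinP; try apply: measurableT_comp => //; apply: rint_meas i2.
Qed.

(** On Schwartz functions [U] agrees with the integral operator only up to null sets, which inner
    products ignore; the measurability of [U f] comes from its being in [L2]. *)
Lemma inner_extension n (P L Q : 'M[R]_n) (m : int) U f g :
  is_quadratic_fourier P L Q m U -> schwartz f -> schwartz g ->
  inner (U f) g = inner (quadratic_fourier P L Q m f) g.
Proof.
move=> [[UL2 _ _ _] Uq] sf sg.
have [UR UI _] := UL2 _ (schwartz_L2 sf).
have mg : cmeas (fun t => conjc (g (vec t))).
  by apply/cmeas_conj/cmeas_schwartz => //; exact: mvec_vec.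
apply: cintegral_ae_eq.
- by apply: cmeasM.
- apply: cmeasM => //; apply: cmeasM; first exact: cmeas_cst.
  apply: (@cmeas_cintegral R _ _ _ _ (leb R n) (fun s : n.-tuple RR * n.-tuple RR =>
    expi (Wform P L Q (vec s.1) (vec s.2)) * f (vec s.2))).
  apply: cmeas_Wform_schwartz => //.
    exact: (mvec_comp (@mvec_vec R n) measurable_fst).
  exact: (mvec_comp (@mvec_vec R n) measurable_snd).
- by apply: filterS (Uq f sf) => t ->.
Qed.

(** For the moduli, |det (S - I)| = |det K|/|det L| and |det (- K^-1)| = 1/|det K|, so det K
    cancels. For the phases, n - 2 Inert (- K^-1) = 2 Inert K - n, and the resulting i^(Inert K)
    turns i^nu into i^m. *)
Lemma mehlig_wilkinson_const n (P L Q : 'M[R]_n) (m nu : int) :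
  P^T = P -> Q^T = Q -> \det L != 0 ->
  \det (free_symplectic P L Q - 1%:M) != 0 ->
  (nu = m - (Inert (Wxx P L Q))%:Z %[mod 4])%Z ->
  toC ((2 * pi)^-1 ^+ n) * (imag R ^ nu)
    / toC (Num.sqrt `|\det (free_symplectic P L Q - 1%:M)|) * gconst P L Q =
  toC ((2 * pi) `^ (- (n%:R / 2))) * expi (- (pi * n%:R / 4))
    * (imag R ^ m) * toC (Num.sqrt `|\det L|).
Proof.
move=> hP hQ hL hS hnu.
have dS := det_free_symplecticB1 P Q hL.
have hK : \det (Wxx P L Q) != 0 by apply: contra hS => /eqP K0; rewrite dS K0 mulr0.
have symK := Wxx_sym L hP hQ.
rewrite /gconst; set I' := Inert (- _).
have EI : (I' + Inert (Wxx P L Q))%N = n by exact: Inert_oppV.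
have -> : pi / 4 * (n%:R - 2 * I'%:R) =
    - (pi * n%:R / 4) + pi / 2 * (Inert (Wxx P L Q))%:R :> R.
  have nE : n%:R = I'%:R + (Inert (Wxx P L Q))%:R :> R by rewrite -natrD EI.
  by rewrite nE; field.
rewrite expiD expi_pi2.
have -> : imag R ^ m = imag R ^ nu * imag R ^+ Inert (Wxx P L Q).
  rewrite exprnP -expfzDr ?imag_neq0//; apply: imag_mod4.
  by rewrite -modzDml hnu modzDml subrK.
have dM : `|\det (- invmx (Wxx P L Q))| = `|\det (Wxx P L Q)|^-1.
  by rewrite -scaleN1r detZ det_inv normrM normrX normrN1 expr1n mul1r normfV.
have dS' : `|\det (free_symplectic P L Q - 1%:M)| = `|\det (Wxx P L Q)| / `|\det L|.
  by rewrite dS !normrM normrX normrN1 expr1n mul1r normfV mulrC.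
rewrite dM dS'.
have sK : Num.sqrt `|\det (Wxx P L Q)| != 0 by rewrite gt_eqF// sqrtr_gt0 normr_gt0.
have sL : Num.sqrt `|\det L| != 0 by rewrite gt_eqF// sqrtr_gt0 normr_gt0.
have pE : (2 * pi) `^ (- (n%:R / 2)) = (2 * pi)^-1 ^+ n * Num.sqrt (2 * pi) ^+ n :> R.
  have p0 : 0 < 2 * pi :> R by rewrite mulr_gt0// pi_gt0.
  have s0 : Num.sqrt (2 * pi) != 0 :> R by rewrite gt_eqF// sqrtr_gt0.
  rewrite powRN [n%:R / 2]mulrC powRrM powR12_sqrt ?(ltW p0)// powR_mulrn ?sqrtr_ge0//.
  rewrite -exprMn -{2}(sqr_sqrtr (ltW p0)) -exprVn; congr (_ ^+ n).
  by rewrite expr2 invfM mulfVK.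
rewrite pE sqrtrV// sqrtrM// sqrtrV//.
set a := Num.sqrt `|\det (Wxx P L Q)| in sK *; set b := Num.sqrt `|\det L| in sL *.
have E : toC ((2 * pi)^-1 ^+ n) / toC (a / b) * toC (Num.sqrt (2 * pi) ^+ n / a^-1) =
   toC ((2 * pi)^-1 ^+ n * Num.sqrt (2 * pi) ^+ n) * toC b.
  rewrite -fmorphV -!rmorphM /=; congr toC; rewrite invf_div invrK.
  by field; exact: sK.
rewrite (mulrAC _ (imag R ^ nu)) -(mulrA _ (imag R ^ nu)) [toC (_ / a^-1) * _]mulrC.
have reassoc (x y u v w z t : C) : x * y = z * t -> x * (u * (v * w * y)) = z * v * (u * w) * t.
  by move=> xy; transitivity (x * y * (u * v * w)); [|rewrite xy]; ring.
exact: reassoc E.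
Qed.

End Conclusion.
Theorem proposition6 (R : realType) (n : nat) (P L Q : 'M[R]_n)
    (S : 'M[R]_(n + n)) (m nu : int)
    (hP : P^T = P) (hQ : Q^T = Q) (hL : \det L != 0)
    (hS : S = free_symplectic P L Q) (hSp : Sp S)
    (hdet : \det (S - 1%:M) != 0)
    (hm : eqmodR (2 * pi) (m%:~R * pi) (real_arg (\det L)))
    (hnu : (nu = m - (Inert (Wxx P L Q))%:Z %[mod 4])%Z) :
  [/\ is_mehlig_wilkinson nu S (quadratic_fourier P L Q m),
      forall U, is_quadratic_fourier P L Q m U -> is_mehlig_wilkinson nu S U &
      eqmodR 2 (pi^-1 * real_arg (\det (S - 1%:M))) (- nu + n%:Z)%:~R].
Proof.
subst S.
have main : is_mehlig_wilkinson nu (free_symplectic P L Q) (quadratic_fourier P L Q m).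
  move=> f g sf sg; rewrite /mehlig_wilkinson integral_mehlig_wilkinson// mulrA.
  by rewrite (mehlig_wilkinson_const hP hQ hL hdet hnu) inner_quadratic_fourier.
have hK : \det (Wxx P L Q) != 0.
  by apply: contra hdet => /eqP K0; rewrite det_free_symplecticB1// K0 mulr0.
split => //.
  by move=> U HU f g sf sg; rewrite (inner_extension HU sf sg) main.
exact: (arg_parity hP hQ hL hK hm hnu).
Qed.
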